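(* Let $\Gamma\subseteq \mathrm{SL}_2(\mathbb R)$ be a commensurable subgroup, and let $\widehat\Gamma$ be a maximal commensurable subgroup containing $\Gamma$. Let $k\in\frac12\mathbb Z$, and let $\nu$ be any consistent finite weight $k$ multiplier for $\Gamma$. Suppose that $M_k(\Gamma,\nu)$ and $S_{2-k}(\Gamma,\overline\nu)$ are both trivial (zero). If $\nu$ extends to a consistent finite weight $k$ multiplier $\nu'$ defined on a group $\Gamma'$ with $\Gamma\subseteq\Gamma'\subseteq\widehat\Gamma$, then $$\mathcal H^{(\nu)}_k(z,\tau)\big|_{k,z}\mathrm{Tr}_\nu^{\nu'}=\mathcal H^{(\nu)}_k(z,\tau)\big|_{2-k,\tau}\mathrm{Tr}_{\overline\nu}^{\overline{\nu'}}=\frac{w}{w'}\,\mathcal H^{(\nu')}_k(z,\tau),$$ where $w$ and $w'$ are the widths of the infinite cusps of $\Gamma$ and $\Gamma'$ respectively, and $\mathcal H^{(\nu)}_k$, $\mathcal H^{(\nu')}_k$ are the generating functions attached to $(\Gamma,\nu)$ and $(\Gamma',\nu')$.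
   Context: **Groups and multipliers.** $\mathbb H$ is the upper half-plane, $q^r=e^{2\pi i r z}$, $p^r=e^{2\pi i r\tau}$. A *commensurable subgroup* is a subgroup $\Gamma\subseteq \mathrm{SL}_2(\mathbb R)$ such that $\Gamma\cap \mathrm{SL}_2(\mathbb Z)$ has finite index in both $\Gamma$ and $\mathrm{SL}_2(\mathbb Z)$. Its cusps are the elements of $\Gamma\backslash(\mathbb Q\cup\{\infty\})$. For $\gamma=\begin{pmatrix}a&b\\c&d\end{pmatrix}\in \mathrm{GL}_2^+(\mathbb R)$ put $j(\gamma,z)=\det(\gamma)^{-1/2}(cz+d)$; for $k\in\frac12+\mathbb Z$, $j^k=(\sqrt j)^{2k}$ with the principal square root. Slash operator: $(f|_k\gamma)(z)=j(\gamma,z)^{-k}f(\gamma z)$. Let $\mathfrak G_k$ be the group of pairs $(\gamma,\phi)$ with $\gamma=\begin{pmatrix}a&b\\c&d\end{pmatrix}\in \mathrm{GL}_2^+(\mathbb R)$ and $\phi$ holomorphic on $\mathbb H$ with $|\phi(z)|=\det(\gamma)^{-k/2}|cz+d|^k$, with product $(\gamma,\phi(z))(\mu,\psi(z))=(\gamma\mu,\phi(\mu z)\psi(z))$. A *consistent weight $k$ multiplier* for $\Gamma$ is a function $\nu:\Gamma\to\mathbb C^\times$ such that $\{(\gamma,\nu(\gamma)j(\gamma,z)^k):\gamma\in\Gamma\}$ is a subgroup of $\mathfrak G_k$ and $\nu(\gamma)j(\gamma,z)^k=1$ for all scalar $\gamma\in\Gamma$; it is *finite* if its image is finite. A function $f$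 is modular of weight $k$ for $(\Gamma,\nu)$ if $f(\gamma z)=\nu(\gamma)j(\gamma,z)^kf(z)$ for all $\gamma\in\Gamma$. **Trace.** For $f$ modular of weight $k$ for $(\Gamma,\nu)$, $f|_k\mathrm{Tr}_\nu^{\nu'}=\sum_{[\gamma]\in\Gamma\backslash\Gamma'}\nu'(\gamma)^{-1}f|_k\gamma$. The notation $|_{\kappa,x}\mathrm{Tr}$ means the weight $\kappa$ trace applied in the variable $x\in\{z,\tau\}$. **Spaces.** $M_k^!(\Gamma,\nu)$: weight $k$ modular forms for $(\Gamma,\nu)$ holomorphic on $\mathbb H$ and meromorphic at all cusps; $M_k(\Gamma,\nu)$: those holomorphic at all cusps; $S_k(\Gamma,\nu)$: those vanishing at all cusps; $M_k^{(\infty)}(\Gamma,\nu)\subseteq M^!_k(\Gamma,\nu)$: forms with poles allowed only at the cusp $\infty$; $\widehat M_k^{(\infty)}(\Gamma,\nu)\subseteq M_k^{(\infty)}(\Gamma,\nu)$: those vanishing at every cusp other than $\infty$. **Width, exponents, index sets, bases.** The upper triangular elements of $\Gamma$ have the form $\pm\begin{pmatrix}1&r\\0&1\end{pmatrix}$ with $r$ ranging over $w\mathbb Z$, $w>0$ rational; $w$ is the width of the cusp $\infty$ of $\Gamma$. Let $\varsigma\in[0,1)$ be such that $f(z+w)=e^{2\pi i\varsigma}f(z)$ for every weight $k$ modular $f$ for $(\Gamma,\nu)$ (i.e. $e^{2\pi i\varsigma}=\nu(T)$ if $T=\begin{pmatrix}1&w\\0&1\end{pmatrix}\in\Gamma$,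 and $=\nu(T)i^{2k}$ with $T=-\begin{pmatrix}1&w\\0&1\end{pmatrix}\in\Gamma$ otherwise), and $\mathbb Z^{(\nu)}=\{(n+\varsigma)/w:n\in\mathbb Z\}$; $\mathbb Z^{(\overline\nu)}=-\mathbb Z^{(\nu)}$ (weight $2-k$ for $\overline\nu$). Let $\widetilde I^{(\nu)}_k$ (resp. $\widetilde J^{(\nu)}_k$) be the set of orders of vanishing at $\infty$ (leading exponents of $q$) of nonzero elements of $M_k(\Gamma,\nu)$ (resp. $S_k(\Gamma,\nu)$), and define $I^{(\nu)}_k$, $J^{(\nu)}_k$ by the disjoint unions $$I^{(\nu)}_k\sqcup\widetilde J^{(\overline\nu)}_{2-k}=\mathbb Z^{(\overline\nu)}_{>0}\sqcup(-\widetilde I^{(\nu)}_k),\qquad J^{(\nu)}_k\sqcup\widetilde I^{(\overline\nu)}_{2-k}=\mathbb Z^{(\overline\nu)}_{\ge0}\sqcup(-\widetilde J^{(\nu)}_k).$$ The row-reduced canonical basis $(f^{(\nu)}_{k,m})_{m\in I^{(\nu)}_k}$ of $M^{(\infty)}_k(\Gamma,\nu)$ consists of the unique elements of the form $q^{-m}+\sum_{n\in\mathbb Z^{(\nu)},-n\notin I^{(\nu)}_k}a^{(\nu)}_k(m,n)q^n$; the row-reduced canonical basis $(g^{(\nu)}_{k,n})_{n\in J^{(\nu)}_k}$ of $\widehat M^{(\infty)}_k(\Gamma,\nu)$ consists of the unique elements of the form $q^{-n}+\sum_{m\in\mathbb Z^{(\nu)},-m\notin J^{(\nu)}_k}b^{(\nu)}_k(n,m)q^m$.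 **Generating function.** $\mathcal H^{(\nu)}_k(z,\tau)$ is the meromorphic function on $\mathbb H\times\mathbb H$ given by $\sum_{m\in I^{(\nu)}_k}f^{(\nu)}_{k,m}(z)p^m$ when $\mathrm{Im}\,\tau$ is sufficiently large in terms of $z$; it is also given by $-\sum_{n\in J^{(\overline\nu)}_{2-k}}g^{(\overline\nu)}_{2-k,n}(\tau)q^n$ when $\mathrm{Im}\,z$ is sufficiently large in terms of $\tau$. It is modular in $z$ of weight $k$ with multiplier $\nu$ and in $\tau$ of weight $2-k$ with multiplier $\overline\nu$. The same definitions apply to $(\Gamma',\nu')$.
   Formalization: The trace is summed over cosets of Γ in Γ' with γ and −γ identified; this differs from Γ\Γ' only if −1 lies in Γ' but not in Γ, where the literal sum is twice as large and the stated formula fails (e.g. Γ'=±Γ, w=w'). *)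

(* Defs.v *)
From Stdlib Require Import Reals ZArith List.
From Coquelicot Require Export Coquelicot.

Open Scope R_scope.

(* Weights are half-integers k; they are encoded throughout by the integer
   K = 2k, so that the weight 2 - k is encoded by 4 - K. *)

(** * The upper half-plane *)

(* Functions on the upper half-plane are total functions [C -> C]; only their
   values at points of [upper] are ever used. *)
Definition upper (z : C) : Prop := 0 < Im z.

Definition cexp (z : C) : C :=
  (exp (Re z) * cos (Im z), exp (Re z) * sin (Im z)).

(* e^{2 pi i r z} *)
Definition qpow (r : R) (z : C) : C := cexp (RtoC (2 * PI * r) * Ci * z)%C.

(* Principal branch: argument in (-pi/2, pi/2], so csqrt (-1) = i. *)
Definition csqrt (z : C) : C :=
  (sqrt ((Cmod z + Re z) / 2),
   (if Rle_dec 0 (Im z) then 1 else -1) * sqrt ((Cmod z - Re z) / 2)).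

Definition Czpow (z : C) (n : Z) : C :=
  match n with
  | Z0 => 1%C
  | Zpos p => Cpow z (Pos.to_nat p)
  | Zneg p => (/ Cpow z (Pos.to_nat p))%C
  end.

Definition holomorphic_upper (f : C -> C) : Prop :=
  forall z, upper z -> @ex_derive C_AbsRing C_NormedModule f z.

(** * Matrices, subgroups of SL_2(R) *)

Record mat2 := Mat2 { ma : R; mb : R; mc : R; md : R }.

Definition mdet (g : mat2) : R := ma g * md g - mb g * mc g.
Definition mone : mat2 := Mat2 1 0 0 1.
Definition mopp (g : mat2) : mat2 := Mat2 (- ma g) (- mb g) (- mc g) (- md g).
Definition mmul (g h : mat2) : mat2 :=
  Mat2 (ma g * ma h + mb g * mc h) (ma g * mb h + mb g * md h)
       (mc g * ma h + md g * mc h) (mc g * mb h + md g * md h).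
Definition minv (g : mat2) : mat2 :=
  Mat2 (md g / mdet g) (- mb g / mdet g) (- mc g / mdet g) (ma g / mdet g).
Definition mscalar (g : mat2) : Prop := mb g = 0 /\ mc g = 0 /\ ma g = md g.
Definition mtrans (r : R) : mat2 := Mat2 1 r 0 1.

Definition mobius (g : mat2) (z : C) : C :=
  ((RtoC (ma g) * z + RtoC (mb g)) / (RtoC (mc g) * z + RtoC (md g)))%C.

Definition subset (A B : mat2 -> Prop) : Prop := forall g, A g -> B g.

Definition subgroup_SL2R (G : mat2 -> Prop) : Prop :=
  (forall g, G g -> mdet g = 1) /\
  G mone /\
  (forall g h, G g -> G h -> G (mmul g h)) /\
  (forall g, G g -> G (minv g)).

Definition SL2Z (g : mat2) : Prop :=
  mdet g = 1 /\
  exists a b c d : Z, g = Mat2 (IZR a) (IZR b) (IZR c) (IZR d).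

Definition finite_index (D G : mat2 -> Prop) : Prop :=
  exists l : list mat2,
    forall g, G g -> exists r, In r l /\ G r /\ D (mmul g (minv r)).

Definition commensurable (G : mat2 -> Prop) : Prop :=
  subgroup_SL2R G /\
  finite_index (fun g => G g /\ SL2Z g) G /\
  finite_index (fun g => G g /\ SL2Z g) SL2Z.

Definition maximal_commensurable (G : mat2 -> Prop) : Prop :=
  commensurable G /\
  forall D, commensurable D -> subset G D -> subset D G.

(** * Automorphy factors and multipliers *)

Definition jfac (g : mat2) (z : C) : C :=
  (RtoC (/ sqrt (mdet g)) * (RtoC (mc g) * z + RtoC (md g)))%C.

(* j(g,z)^k = (sqrt j(g,z))^{2k}; this is the ordinary power when k is an
   integer. *)
Definition jpow (K : Z) (g : mat2) (z : C) : C := Czpow (csqrt (jfac g z)) K.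

Definition slash (K : Z) (f : C -> C) (g : mat2) (z : C) : C :=
  (/ jpow K g z * f (mobius g z))%C.

(* The group of pairs (g, phi), phi being regarded as a function on the upper
   half-plane. *)
Definition in_Gk (K : Z) (x : mat2 * (C -> C)) : Prop :=
  let (g, phi) := x in
  0 < mdet g /\
  holomorphic_upper phi /\
  forall z, upper z ->
    Cmod (phi z) =
      Rpower (mdet g) (- (IZR K / 2) / 2) *
      Rpower (Cmod (RtoC (mc g) * z + RtoC (md g))%C) (IZR K / 2).

Definition Gk_mul (x y : mat2 * (C -> C)) : mat2 * (C -> C) :=
  (mmul (fst x) (fst y), fun z => (snd x (mobius (fst y) z) * snd y z)%C).

Definition Gk_one : mat2 * (C -> C) := (mone, fun _ => RtoC 1).

Definition Gk_inv (x : mat2 * (C -> C)) : mat2 * (C -> C) :=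
  (minv (fst x), fun z => (/ snd x (mobius (minv (fst x)) z))%C).

Definition subgroup_Gk (K : Z) (S : mat2 * (C -> C) -> Prop) : Prop :=
  (forall x, S x -> in_Gk K x) /\
  S Gk_one /\
  (forall x y, S x -> S y -> S (Gk_mul x y)) /\
  (forall x, S x -> S (Gk_inv x)).

(* The set of pairs (g, nu(g) j(g,.)^k); it is saturated under equality of
   functions on the upper half-plane. *)
Definition multiplier_lift (K : Z) (G : mat2 -> Prop) (nu : mat2 -> C)
    (x : mat2 * (C -> C)) : Prop :=
  G (fst x) /\
  forall z, upper z -> snd x z = (nu (fst x) * jpow K (fst x) z)%C.

(* A multiplier for [G] is a total function of which only the values on [G]
   are used. *)
Definition consistent_multiplier (K : Z) (G : mat2 -> Prop) (nu : mat2 -> C)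
    : Prop :=
  (forall g, G g -> nu g <> 0%C) /\
  subgroup_Gk K (multiplier_lift K G nu) /\
  forall g, G g -> mscalar g ->
    forall z, upper z -> (nu g * jpow K g z)%C = 1%C.

Definition finite_multiplier (G : mat2 -> Prop) (nu : mat2 -> C) : Prop :=
  exists l : list C, forall g, G g -> In (nu g) l.

Definition conj_mult (nu : mat2 -> C) (g : mat2) : C := Cconj (nu g).

(** * Expansions and modular forms *)

(* l = sum_r c(r) e^{2 pi i r z}, where the real exponents r with c(r) <> 0
   lie in (1/N) Z for some N > 0 and are bounded below. *)
Definition is_qsum (c : R -> C) (z l : C) : Prop :=
  exists (N : nat) (n0 : Z),
    (0 < N)%nat /\
    (forall r, c r <> 0%C -> exists j : nat, r = (IZR n0 + INR j) / INR N) /\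
    @is_series C_AbsRing C_NormedModule
      (fun j : nat => let r := (IZR n0 + INR j) / INR N in
                      (c r * qpow r z)%C) l.

Definition has_qexp (f : C -> C) (c : R -> C) : Prop :=
  forall z, upper z -> is_qsum c z (f z).

(* The cusps are represented by s(oo) with s in SL_2(Z), and the behaviour of f
   at s(oo) is read off the expansion of f|_k s.  The exponents in these
   expansions are rational because the multipliers considered are finite. *)
Definition meromorphic_at_cusp (K : Z) (f : C -> C) (s : mat2) : Prop :=
  exists c, has_qexp (slash K f s) c.

Definition holomorphic_at_cusp (K : Z) (f : C -> C) (s : mat2) : Prop :=
  exists c, has_qexp (slash K f s) c /\ forall r, r < 0 -> c r = 0%C.

Definition vanishing_at_cusp (K : Z) (f : C -> C) (s : mat2) : Prop :=
  exists c, has_qexp (slash K f s) c /\ forall r, r <= 0 -> c r = 0%C.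

(* The cusp s(oo) is G-equivalent to oo. *)
Definition infinite_cusp (G : mat2 -> Prop) (s : mat2) : Prop :=
  exists g, G g /\ mc (mmul g s) = 0.

Definition modular (K : Z) (G : mat2 -> Prop) (nu : mat2 -> C)
    (f : C -> C) : Prop :=
  forall g z, G g -> upper z -> f (mobius g z) = (nu g * jpow K g z * f z)%C.

Definition Mweak (K : Z) (G : mat2 -> Prop) (nu : mat2 -> C)
    (f : C -> C) : Prop :=
  modular K G nu f /\ holomorphic_upper f /\
  forall s, SL2Z s -> meromorphic_at_cusp K f s.

Definition Mform (K : Z) (G : mat2 -> Prop) (nu : mat2 -> C)
    (f : C -> C) : Prop :=
  Mweak K G nu f /\ forall s, SL2Z s -> holomorphic_at_cusp K f s.

Definition Sform (K : Z) (G : mat2 -> Prop) (nu : mat2 -> C)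
    (f : C -> C) : Prop :=
  Mweak K G nu f /\ forall s, SL2Z s -> vanishing_at_cusp K f s.

Definition Minfty (K : Z) (G : mat2 -> Prop) (nu : mat2 -> C)
    (f : C -> C) : Prop :=
  Mweak K G nu f /\
  forall s, SL2Z s -> ~ infinite_cusp G s -> holomorphic_at_cusp K f s.

Definition Minfty_hat (K : Z) (G : mat2 -> Prop) (nu : mat2 -> C)
    (f : C -> C) : Prop :=
  Minfty K G nu f /\
  forall s, SL2Z s -> ~ infinite_cusp G s -> vanishing_at_cusp K f s.

Definition trivial_space (V : (C -> C) -> Prop) : Prop :=
  forall f, V f -> forall z, upper z -> f z = 0%C.

(** * Width, exponents and index sets *)

Definition is_width (G : mat2 -> Prop) (w : R) : Prop :=
  0 < w /\
  forall r, (G (mtrans r) \/ G (mopp (mtrans r))) <->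
            exists n : Z, r = IZR n * w.

Definition is_shift (K : Z) (G : mat2 -> Prop) (nu : mat2 -> C) (w s : R)
    : Prop :=
  0 <= s < 1 /\
  (G (mtrans w) -> cexp (RtoC (2 * PI * s) * Ci)%C = nu (mtrans w)) /\
  (~ G (mtrans w) ->
     cexp (RtoC (2 * PI * s) * Ci)%C =
       (nu (mopp (mtrans w)) * Czpow Ci K)%C).

(* Z^{(nu)} *)
Definition exponents (K : Z) (G : mat2 -> Prop) (nu : mat2 -> C) (x : R)
    : Prop :=
  exists w s, is_width G w /\ is_shift K G nu w s /\
    exists n : Z, x = (IZR n + s) / w.

(* The set of orders at oo of the nonzero elements of V. *)
Definition orders (V : (C -> C) -> Prop) (x : R) : Prop :=
  exists f c, V f /\ has_qexp f c /\ c x <> 0%C /\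
    forall r, r < x -> c r = 0%C.

(* The defining disjoint unions  I + A = B + C  are solved for I as
   I = (B u C) \ A.  The set -Z^{(nu)} plays the role of Z^{(conj nu)}. *)
Definition index_I (K : Z) (G : mat2 -> Prop) (nu : mat2 -> C) (m : R)
    : Prop :=
  ((0 < m /\ exponents K G nu (- m)) \/ orders (Mform K G nu) (- m)) /\
  ~ orders (Sform (4 - K) G (conj_mult nu)) m.

Definition index_J (K : Z) (G : mat2 -> Prop) (nu : mat2 -> C) (n : R)
    : Prop :=
  ((0 <= n /\ exponents K G nu (- n)) \/ orders (Sform K G nu) (- n)) /\
  ~ orders (Mform (4 - K) G (conj_mult nu)) n.

(* F = q^{-m} + (terms q^n with n in Z^{(nu)} and -n not in I). *)
Definition row_reduced (K : Z) (G : mat2 -> Prop) (nu : mat2 -> C)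
    (I : R -> Prop) (m : R) (F : C -> C) : Prop :=
  exists c, has_qexp F c /\ c (- m) = 1%C /\
    forall n, n <> - m -> c n <> 0%C -> exponents K G nu n /\ ~ I (- n).

(* A family indexed by I is a family indexed by R and extended by 0 off I. *)
Definition canonical_basis (K : Z) (G : mat2 -> Prop) (nu : mat2 -> C)
    (V : (C -> C) -> Prop) (I : R -> Prop) (F : R -> C -> C) : Prop :=
  (forall m, ~ I m -> forall z, upper z -> F m z = 0%C) /\
  (forall m, I m -> V (F m) /\ row_reduced K G nu I m (F m)).

Definition canonical_f (K : Z) (G : mat2 -> Prop) (nu : mat2 -> C)
    : (R -> C -> C) -> Prop :=
  canonical_basis K G nu (Minfty K G nu) (index_I K G nu).

Definition canonical_g (K : Z) (G : mat2 -> Prop) (nu : mat2 -> C)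
    : (R -> C -> C) -> Prop :=
  canonical_basis K G nu (Minfty_hat K G nu) (index_J K G nu).

(** * Meromorphic functions of two variables *)

Definition CxC : NormedModule C_AbsRing :=
  prod_NormedModule C_AbsRing C_NormedModule C_NormedModule.

Definition holomorphic2_at (F : C * C -> C) (p : C * C) : Prop :=
  @locally CxC p
    (fun q => @ex_filterdiff C_AbsRing CxC C_NormedModule F (@locally CxC q)).

Definition upper2 (p : C * C) : Prop := upper (fst p) /\ upper (snd p).

(* A meromorphic function is represented by a total function which is locally a
   quotient A/B of holomorphic functions; its values on the locus B = 0 are
   unconstrained. *)
Definition meromorphic2 (F : C * C -> C) : Prop :=
  forall p, upper2 p -> exists A B : C * C -> C,
    holomorphic2_at A p /\ holomorphic2_at B p /\
    ~ @locally CxC p (fun q => B q = 0%C) /\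
    @locally CxC p (fun q => B q <> 0%C -> F q = (A q / B q)%C).

(* Equality of the meromorphic functions represented by F and F'. *)
Definition mero_eq (F F' : C * C -> C) : Prop :=
  meromorphic2 F /\ meromorphic2 F' /\
  forall p, upper2 p -> holomorphic2_at F p -> holomorphic2_at F' p ->
    F p = F' p.

(** * The generating function and the trace *)

Definition generating_function (K : Z) (G : mat2 -> Prop) (nu : mat2 -> C)
    (H : C * C -> C) : Prop :=
  meromorphic2 H /\
  (exists f, canonical_f K G nu f /\
    forall z, upper z -> exists Y : R, forall tau, upper tau -> Y < Im tau ->
      is_qsum (fun m => f m z) tau (H (z, tau))) /\
  (exists g, canonical_g (4 - K) G (conj_mult nu) g /\
    forall tau, upper tau -> exists Y : R, forall z, upper z -> Y < Im z ->
      is_qsum (fun n => g n tau) z (- H (z, tau))%C).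

(* Representatives of G \ G', the elements of G' being identified with the
   transformations of the upper half-plane they induce: g and -g count once.
   This differs from the coset space of matrices only if -1 lies in G' but not
   in G; the matrix cosets of g and -g then contribute equal terms to the trace,
   which would double it while leaving the widths unchanged. *)
Definition coset_reps (G G' : mat2 -> Prop) (reps : list mat2) : Prop :=
  NoDup reps /\
  (forall r, In r reps -> G' r) /\
  forall g, G' g ->
    exists! r, In r reps /\
      (G (mmul g (minv r)) \/ G (mopp (mmul g (minv r)))).

Definition trace (K : Z) (nu' : mat2 -> C) (reps : list mat2) (f : C -> C)
    (z : C) : C :=
  fold_right Cplus (RtoC 0)
    (map (fun g => (/ nu' g * slash K f g z)%C) reps).

(* Main.v *)
Require Import Defs.
From Stdlib Require Import Reals ZArith List Lra Lia Classical ClassicalEpsilon Permutation.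
From Coquelicot Require Import Coquelicot.

(** The trace of a basis form [f_m] for [G] is a form for [G'], and so is
    [(w / w') f'_m]. Both are holomorphic at the cusps not equivalent to oo, and
    they have the same principal part at oo (with [f'_m = 0] if [-m] is not an
    exponent for [G']). Indeed, among the terms
    [nu'(g)^-1 f_m | g] of the trace only those whose coset fixes the cusp oo have
    a principal part at oo. These cosets are represented by the first [w / w']
    powers of the translation that generates the stabiliser of oo in [G'], so
    their terms multiply the coefficient of [q^r] by a sum of powers of a root of
    unity: [w / w'] if [r] is an exponent for [G'], and 0 otherwise. The difference
    of the two forms lies in [M_k(G, nu)], which is zero. The same argument, with
    vanishing in place of holomorphy and [S_(2-k)] in place of [M_k], applies to the
    dual basis [g_n]; both are instances of [trace_of_basis]. The triviality of the
    two spaces enters a second time, as it makes the index sets as large as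
    possible: the basis elements then have no other principal terms.

    Taking the trace coefficientwise ([trace_expansion]), the trace of [H] in [z]
    equals [(w / w') H'] at the points with [Im tau > Y(z)], and the trace in [tau]
    equals it at those with [Im z > Y(tau)], where [Y] depends arbitrarily on its
    argument. It remains to continue these equalities analytically, for
    meromorphic functions whose representatives have arbitrary values at the zeros
    of the denominators. By Baire's theorem [Y] is bounded on a set that is dense in
    some disc, so a holomorphic cross difference of the two quotients vanishes on a
    dense subset of a bidisc, hence identically there; this propagates along
    segments because germs of holomorphic functions form an integral domain
    ([agree_of_region]).

    The identity theorem behind this is proved for functions that are merely
    complex differentiable. Goursat's theorem for [h (exp w)] shows that the mean
    of [h] over a circle does not depend on its radius, which gives the maximum
    principle; if [f] vanishes near 0, the principle applied to [f / t^n] for all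
    [n] shows that [f] vanishes on the whole disc ([identity_disc]).

    On the arithmetic side, a commensurable group permutes the cusps of
    [SL_2(Z)], since these are the fixed points of its unipotent elements
    ([cusp_image]); so [f | g s] is [f | s'] after an upper triangular substitution
    with rational [a^2], which preserves expansions ([trace_term_regular_at_cusp]).
    The principal branches of [j^k] compose up to a sign, which is constant by
    connectedness ([jpow_cocycle]). *)

Lemma choice_function (A B : Type) (P : A -> B -> Prop) :
  (forall x, exists y, P x y) -> exists f, forall x, P x (f x).
Proof.
  intros H. exists (fun x => proj1_sig (constructive_indefinite_description _ (H x))).
  intros x. exact (proj2_sig (constructive_indefinite_description _ (H x))).
Qed.

(** * Complex differentiability *)

Notation cderivable f z := (@ex_derive C_AbsRing C_NormedModule f z).

(** The complex plane carries two uniform structures, the product of two real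
    lines and the one of the modulus: a function is differentiable on the
    latter, takes its values in the former, and [C * C] is built on the former.
    The next lemmas pass between the two, and to discs. *)
Lemma locally_C_disc (z : C) (P : C -> Prop) :
  @locally C_UniformSpace z P <->
  exists d, 0 < d /\ forall w, Cmod (w - z)%C < d -> P w.
Proof.
  split; intros HH; [apply locally_C in HH; revert HH | apply locally_C; revert HH].
  - intros [d Hd]. exists d. split; [apply cond_pos|]. intros w Hw. apply Hd. exact Hw.
  - intros [d [Hd H]]. exists (mkposreal d Hd). intros w Hw. apply H. exact Hw.
Qed.

Lemma cderivable_eps (f : C -> C) (z : C) :
  cderivable f z <->
  exists l : C, forall eps, 0 < eps -> exists d, 0 < d /\ forall w,
    Cmod (w - z) < d -> Cmod (f w - f z - l * (w - z)) <= eps * Cmod (w - z).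
Proof.
  split.
  - intros [l [_ Hl]]. exists l. intros eps Heps.
    specialize (Hl z (fun P HP => HP) (mkposreal eps Heps)).
    destruct Hl as [d Hd]. exists d. split; [apply cond_pos|].
    intros w Hw. specialize (Hd w Hw).
    replace (f w - f z - l * (w - z))%C with
      (f w - f z - (w - z) * l)%C by ring. exact Hd.
  - intros [l Hl]. exists l. split.
    + apply is_linear_scal_l.
    + intros x Hx.
      assert (x = z) as ->.
      { symmetry.
        apply (is_filter_lim_locally_unique (K:=C_AbsRing) (V:=AbsRing_NormedModule C_AbsRing)).
        exact Hx. }
      intros eps. destruct (Hl eps (cond_pos eps)) as [d [Hd H]].
      exists (mkposreal d Hd). intros w Hw. specialize (H w Hw).
      replace (f w - f z - l * (w - z))%C with
      (f w - f z - (w - z) * l)%C in H by ring. exact H.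
Qed.

Lemma locally_CxC (p : C * C) (P : C * C -> Prop) :
  @locally CxC p P <->
  exists d, 0 < d /\ forall z t, Cmod (z - fst p) < d -> Cmod (t - snd p) < d -> P (z, t).
Proof.
  split.
  - intros [d Hd]. exists d. split; [apply cond_pos|].
    intros z t Hz Ht. apply Hd. split; simpl.
    + apply C_NormedModule_mixin_compat1. exact Hz.
    + apply C_NormedModule_mixin_compat1. exact Ht.
  - intros [d [Hd H]].
    assert (0 < d / 2) as Hd2 by lra.
    exists (mkposreal _ Hd2). intros [z t] [Hz Ht].
    assert (Hs : sqrt 2 < 2).
    { rewrite <- (sqrt_square 2) at 2 by lra. apply sqrt_lt_1; lra. }
    assert (Hs0 := sqrt_lt_R0 2 ltac:(lra)).
    apply H.
    + apply C_NormedModule_mixin_compat2 in Hz. simpl in Hz.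
      change (Cmod (z - fst p) < sqrt 2 * (d/2)) in Hz. nra.
    + apply C_NormedModule_mixin_compat2 in Ht. simpl in Ht.
      change (Cmod (t - snd p) < sqrt 2 * (d/2)) in Ht. nra.
Qed.

Lemma ex_filterdiff_C_codomain {U : NormedModule C_AbsRing} (f : U -> C) F :
  @ex_filterdiff C_AbsRing U C_NormedModule f F <->
  @ex_filterdiff C_AbsRing U (AbsRing_NormedModule C_AbsRing) f F.
Proof.
  split; intros [l [Hl H]]; exists l; (split; [|exact H]);
  destruct Hl as [a b c]; (split; [exact a | exact b | exact c]).
Qed.

Lemma ex_filterdiff_C_domain {U : NormedModule C_AbsRing} (f : C -> U) (z : C) :
  @ex_filterdiff C_AbsRing C_NormedModule U f (@locally C_UniformSpace z) <->
  @ex_filterdiff C_AbsRing (AbsRing_NormedModule C_AbsRing) U f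
    (@locally (AbsRing_UniformSpace C_AbsRing) z).
Proof.
  split; intros [l [Hl H]]; exists l.
  - split; [destruct Hl as [a b c]; split; [exact a | exact b | exact c]|].
    intros x Hx. assert (x = z) as ->.
    { symmetry. exact (is_filter_lim_locally_unique (V := AbsRing_NormedModule C_AbsRing) _ _ Hx). }
    intros eps. exact (proj1 (locally_C z _) (H z (fun P HP => HP) eps)).
  - split; [destruct Hl as [a b c]; split; [exact a | exact b | exact c]|].
    intros x Hx. assert (x = z) as ->.
    { symmetry. exact (is_filter_lim_locally_unique (V := C_NormedModule) _ _ Hx). }
    intros eps. exact (proj2 (locally_C z _) (H z (fun P HP => HP) eps)).
Qed.

Lemma cderivable_const (a z : C) : cderivable (fun _ => a) z.
Proof. apply ex_derive_const. Qed.
Lemma cderivable_id (z : C) : cderivable (fun w => w) z.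
Proof.
  apply cderivable_eps. exists (RtoC 1). intros eps He. exists 1. split; [lra|].
  intros w _. replace (w - z - 1 * (w - z))%C with (RtoC 0) by ring. rewrite Cmod_0.
  assert (H := Cmod_ge_0 (w - z)). nra.
Qed.

Lemma cderivable_plus (f g : C -> C) (z : C) : cderivable f z -> cderivable g z ->
  cderivable (fun w => f w + g w)%C z.
Proof. intros Hf Hg. exact (ex_derive_plus f g z Hf Hg). Qed.
Lemma cderivable_mult (f g : C -> C) (z : C) : cderivable f z -> cderivable g z ->
  cderivable (fun w => f w * g w)%C z.
Proof.
  intros Hf Hg.
  apply ex_derive_filterdiff, ex_filterdiff_C_codomain in Hf.
  apply ex_derive_filterdiff, ex_filterdiff_C_codomain in Hg.
  apply ex_derive_filterdiff, ex_filterdiff_C_codomain.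
  exact (@ex_filterdiff_mult_fct C_AbsRing (AbsRing_NormedModule C_AbsRing) f g z Cmult_comm Hf Hg).
Qed.

Lemma cderivable_comp (f g : C -> C) (z : C) : cderivable g z -> cderivable f (g z) ->
  cderivable (fun w => f (g w)) z.
Proof.
  intros Hg Hf. apply ex_derive_filterdiff, ex_filterdiff_C_codomain in Hg.
  apply ex_derive_filterdiff in Hf. apply ex_derive_filterdiff.
  exact (@ex_filterdiff_comp' C_AbsRing (AbsRing_NormedModule C_AbsRing)
    (AbsRing_NormedModule C_AbsRing) C_NormedModule g f z Hg Hf).
Qed.

Lemma cderivable_ext_loc (f g : C -> C) (z : C) : (exists d, 0 < d /\
  forall w, Cmod (w - z) < d -> f w = g w) ->
  cderivable f z -> cderivable g z.
Proof.
  intros [d [Hd H]]. apply ex_derive_ext_loc.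
  exists (mkposreal d Hd). intros w Hw. apply H. exact Hw.
Qed.

Definition ccontinuous (f : C -> C) (z : C) : Prop :=
  forall eps, 0 < eps -> exists d, 0 < d /\ forall w, Cmod (w - z) < d -> Cmod (f w - f z) < eps.

Lemma cderivable_continuous (f : C -> C) (z : C) : cderivable f z -> ccontinuous f z.
Proof.
  intros H eps He. apply ex_derive_continuous in H.
  destruct (H (fun w => Cmod (w - f z) < eps)) as [d Hd].
  - apply locally_C_disc. exists eps. auto.
  - exists d. split; [apply cond_pos | exact Hd].
Qed.

Lemma Cmod_le_sub (a b : C) : Cmod a - Cmod b <= Cmod (a - b).
Proof.
  assert (H := Cmod_triangle (a - b) b). replace (a - b + b)%C with a in H by ring. lra.
Qed.

Lemma Cmod_sub_sym (a b : C) : Cmod (a - b) = Cmod (b - a).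
Proof. rewrite <- Cmod_opp. f_equal. ring. Qed.
Lemma cderivable_affine (a b z : C) : cderivable (fun w => a * w + b)%C z.
Proof.
  apply cderivable_plus; [|apply cderivable_const].
  apply cderivable_mult; [apply cderivable_const | apply cderivable_id].
Qed.

Lemma cderivable_inv (z : C) : z <> 0%C -> cderivable Cinv z.
Proof.
  intros Hz. apply cderivable_eps. exists (- / (z * z))%C. intros eps He.
  assert (Hm := proj1 (Cmod_gt_0 z) Hz). set (m := Cmod z) in *.
  exists (Rmin (m / 2) (eps * m * m * m / 2)). split.
  { apply Rmin_pos; [lra|]. assert (0 < m * m) by nra.
    assert (0 < eps * m * m * m) by (repeat apply Rmult_lt_0_compat; lra). lra. }
  intros w Hwz. destruct (Rmin_Rgt_l _ _ _ Hwz) as [H1 H2].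
  assert (H3 : m / 2 < Cmod w).
  { assert (H := Cmod_le_sub z w). rewrite Cmod_sub_sym in H. fold m in H. lra. }
  assert (Hw : w <> 0%C). { apply Cmod_gt_0. lra. }
  replace (/ w - / z - - / (z * z) * (w - z))%C with ((w - z) * (w - z) * / (z * z * w))%C
    by (field; auto).
  rewrite !Cmod_mult, Cmod_inv, !Cmod_mult. 2:{ repeat apply Cmult_neq_0; auto. }
  fold m. set (x := Cmod (w - z)) in *. assert (0 <= x) by apply Cmod_ge_0.
  assert (0 < m * m * Cmod w) by (repeat apply Rmult_lt_0_compat; lra).
  rewrite Rmult_assoc, (Rmult_comm eps). apply Rmult_le_compat_l; [lra|].
  apply (Rmult_le_reg_r (m * m * Cmod w)); [lra|]. rewrite Rmult_assoc, Rinv_l by lra.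
  apply Rle_trans with (eps * m * m * m / 2); [lra|].
  assert (0 < eps * m * m) by (repeat apply Rmult_lt_0_compat; lra). nra.
Qed.

Lemma cderivable_div (f g : C -> C) (z : C) : cderivable f z -> cderivable g z -> g z <> 0%C ->
  cderivable (fun w => f w / g w)%C z.
Proof.
  intros Hf Hg H0. apply cderivable_mult; [exact Hf|]. apply (cderivable_comp Cinv g); [exact Hg|].
  apply cderivable_inv, H0.
Qed.

Lemma cderivable_pow (f : C -> C) (z : C) n : cderivable f z ->
  cderivable (fun w => Cpow (f w) n) z.
Proof.
  intros Hf. induction n as [|n IH]; simpl.
  - apply cderivable_const.
  - apply cderivable_mult; assumption.
Qed.

Lemma Cmod_le_Rabs (z : C) : Cmod z <= Rabs (Re z) + Rabs (Im z).
Proof.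
  destruct z as [x y]. simpl.
  replace (x, y) with (RtoC x + Ci * RtoC y)%C
    by (unfold RtoC, Ci, Cplus, Cmult; simpl; f_equal; ring).
  eapply Rle_trans; [apply Cmod_triangle|].
  rewrite Cmod_mult, Cmod_Ci, !Cmod_R. lra.
Qed.

Lemma im_le_Cmod (z : C) : Rabs (Im z) <= Cmod z.
Proof.
  eapply Rle_trans; [|apply Rmax_Cmod]. apply Rmax_r.
Qed.

(** ** The exponential *)

Lemma cexp_plus (z w : C) : cexp (z + w) = (cexp z * cexp w)%C.
Proof.
  destruct z as [a b], w as [c d]. unfold cexp, Cmult; simpl.
  rewrite exp_plus, cos_plus, sin_plus. f_equal; ring.
Qed.

Lemma cexp_0 : cexp 0 = 1%C.
Proof. unfold cexp, RtoC; simpl. rewrite exp_0, cos_0, sin_0. f_equal; ring. Qed.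
Lemma Cmod_cexp (z : C) : Cmod (cexp z) = exp (Re z).
Proof.
  unfold cexp, Cmod; simpl.
  replace (_ + _) with (exp (Re z) * exp (Re z) * ((sin (Im z))² + (cos (Im z))²)) by (unfold Rsqr;
    ring).
  rewrite sin2_cos2, Rmult_1_r. apply sqrt_square. left. apply exp_pos.
Qed.

Lemma Cmod_cexp_le_1 (z : C) : Re z <= 0 -> Cmod (cexp z) <= 1.
Proof.
  intros H. rewrite Cmod_cexp, <- exp_0. destruct (Req_dec (Re z) 0) as [->|Hn]; [lra|].
  left. apply exp_increasing. lra.
Qed.

Lemma cexp_neq_0 (z : C) : cexp z <> 0%C.
Proof. apply Cmod_gt_0. rewrite Cmod_cexp. apply exp_pos. Qed.

Lemma real_derive_eps (f : R -> R) (x l : R) : is_derive f x l ->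
  forall eps, 0 < eps -> exists d, 0 < d /\ forall y, Rabs (y - x) < d ->
    Rabs (f y - f x - l * (y - x)) <= eps * Rabs (y - x).
Proof.
  intros [_ H] eps He. specialize (H x (fun P HP => HP) (mkposreal eps He)).
  destruct H as [d Hd]. exists d. split; [apply cond_pos|]. intros y Hy.
  specialize (Hd y Hy). replace (l * (y - x)) with ((y - x) * l) by ring. exact Hd.
Qed.

(** Reduces to the derivatives at 0 of the real [exp], [cos] and [sin]. *)
Lemma cexp_near_0 eps : 0 < eps -> exists d, 0 < d /\ forall h, Cmod h < d ->
  Cmod (cexp h - 1 - h) <= eps * Cmod h.
Proof.
  intros He.
  set (e := Rmin (eps / 8) (1/2)).
  assert (He0 : 0 < e) by (apply Rmin_pos; lra).
  assert (He1 : e <= eps / 8) by apply Rmin_l.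
  assert (He2 : e <= 1/2) by apply Rmin_r.
  destruct (real_derive_eps exp 0 1) with (eps := e) as [d1 [Hd1 H1]]; auto.
  { assert (Hq := is_derive_exp 0). rewrite exp_0 in Hq. exact Hq. }
  destruct (real_derive_eps cos 0 0) with (eps := e) as [d2 [Hd2 H2]]; auto.
  { assert (Hq := is_derive_cos 0). rewrite sin_0, Ropp_0 in Hq. exact Hq. }
  destruct (real_derive_eps sin 0 1) with (eps := e) as [d3 [Hd3 H3]]; auto.
  { assert (Hq := is_derive_sin 0). rewrite cos_0 in Hq. exact Hq. }
  exists (Rmin (Rmin d1 e) (Rmin d2 d3)). split; [repeat apply Rmin_pos; lra|].
  intros [x y] Hh. destruct (Rmin_Rgt_l _ _ _ Hh) as [Ha Hb].
  destruct (Rmin_Rgt_l _ _ _ Ha) as [Hx1 Hx2]. destruct (Rmin_Rgt_l _ _ _ Hb) as [Hy1 Hy2].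
  unfold Rgt in *.
  assert (Hx := re_le_Cmod (x, y)). assert (Hy := im_le_Cmod (x, y)). simpl in Hx, Hy.
  set (m := Cmod (x, y)) in *.
  specialize (H1 x). specialize (H2 y). specialize (H3 y).
  rewrite !Rminus_0_r in *. rewrite exp_0 in H1. rewrite cos_0 in H2. rewrite sin_0 in H3.
  specialize (H1 ltac:(lra)). specialize (H2 ltac:(lra)). specialize (H3 ltac:(lra)).
  rewrite Rmult_0_l, Rminus_0_r in H2. rewrite Rminus_0_r, Rmult_1_l in H3. rewrite Rmult_1_l in H1.
  replace (cexp (x, y) - 1 - (x, y))%C with (RtoC (exp x - 1 - x)
    + (RtoC (exp x) * (RtoC (cos y - 1) + Ci * RtoC (sin y - y)) + RtoC (exp x - 1) * (Ci * RtoC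
        y)))%C
    by (unfold cexp, RtoC, Ci, Cminus, Cplus, Copp, Cmult; simpl; f_equal; ring).
  eapply Rle_trans; [apply Cmod_triangle|].
  assert (T1 := Cmod_triangle (RtoC (exp x) * (RtoC (cos y - 1) + Ci * RtoC (sin y - y)))
    (RtoC (exp x - 1) * (Ci * RtoC y))).
  assert (T2 := Cmod_triangle (RtoC (cos y - 1)) (Ci * RtoC (sin y - y))).
  rewrite !Cmod_mult, Cmod_Ci, !Cmod_R in *.
  assert (0 <= m) by apply Cmod_ge_0.
  assert (A0 : Rabs (exp x - 1) <= 2 * m).
  { replace (exp x - 1) with ((exp x - 1 - x) + x) by ring. eapply Rle_trans; [apply Rabs_triang|].
    nra. }
  assert (A1 : Rabs (exp x) <= 2).
  { replace (exp x) with ((exp x - 1) + 1) by ring. eapply Rle_trans; [apply Rabs_triang|].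
    rewrite Rabs_R1. lra. }
  assert (Hem : e * m <= eps / 8 * m) by nra. assert (0 <= eps * m) by nra.
  assert (B1 : Rabs (exp x) * Cmod (RtoC (cos y - 1) + Ci * RtoC (sin y - y)) <= 2 * (2 * (e * m)))
    by (apply Rmult_le_compat; [apply Rabs_pos | apply Cmod_ge_0 | exact A1 | nra]).
  assert (B2 : Rabs (exp x - 1) * (1 * Rabs y) <= 2 * m * e)
    by (apply Rmult_le_compat; try apply Rabs_pos; [assert (X := Rabs_pos y) | | ]; lra).
  assert (B3 : Rabs (exp x - 1 - x) <= e * m) by nra.
  nra.
Qed.

Lemma cderivable_cexp (z : C) : cderivable cexp z.
Proof.
  apply cderivable_eps. exists (cexp z). intros eps He.
  assert (Hm := Cmod_cexp z). assert (Hp := exp_pos (Re z)).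
  destruct (cexp_near_0 (eps / exp (Re z))) as [d [Hd H]].
  { apply Rdiv_lt_0_compat; lra. }
  exists d. split; [exact Hd|]. intros w Hw.
  replace (cexp w) with (cexp z * cexp (w - z))%C by (rewrite <- cexp_plus; f_equal; ring).
  replace (cexp z * cexp (w - z) - cexp z - cexp z * (w - z))%C with
    (cexp z * (cexp (w - z) - 1 - (w - z)))%C by ring.
  rewrite Cmod_mult, Hm. specialize (H _ Hw).
  apply (Rmult_le_compat_l (exp (Re z))) in H; [|lra].
  eapply Rle_trans; [exact H|]. right. field. lra.
Qed.

(** * Goursat's theorem *)

Lemma nested_intervals (x r : nat -> R) : (forall n, 0 <= r n) ->
  (forall n, x n <= x (S n) /\ x (S n) + r (S n) <= x n + r n) ->
  exists l, forall n, x n <= l <= x n + r n.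
Proof.
  intros Hr Hn.
  assert (Hmono : forall n k, x n <= x (n + k)%nat /\ x (n + k)%nat + r (n + k)%nat <= x n + r n).
  { intros n k. induction k as [|k IH]; [rewrite Nat.add_0_r; lra|].
    rewrite Nat.add_succ_r. destruct (Hn (n + k)%nat). lra. }
  assert (Hcross : forall n m, x n <= x m + r m).
  { intros n m. destruct (Nat.le_ge_cases n m) as [L|L].
    - destruct (Hmono n (m - n)%nat). replace (n + (m - n))%nat with m in * by lia.
      specialize (Hr m). lra.
    - destruct (Hmono m (n - m)%nat). replace (m + (n - m))%nat with n in * by lia.
      specialize (Hr n). lra. }
  destruct (completeness (fun y => exists n, y = x n)) as [l [H1 H2]].
  { exists (x 0%nat + r 0%nat). intros y [n ->]. apply Hcross. }
  { exists (x 0%nat). exists 0%nat. reflexivity. }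
  exists l. intros n. split.
  - apply H1. exists n. reflexivity.
  - apply H2. intros y [m ->]. apply Hcross.
Qed.

(** [P n x y s] speaks of the rectangle with corner [(x, y)] and sides [a s], [b s]
    reached after [n] steps, each of which at least halves the sides. *)
Lemma nested_rectangles (a b : R) (P : nat -> R -> R -> R -> Prop) (x0 y0 : R) :
  0 < a -> 0 < b ->
  (forall n x y s, 0 < s -> P n x y s -> exists x' y' s',
    (0 < s' <= s / 2 /\ P (S n) x' y' s') /\
    (x <= x' /\ x' + a * s' <= x + a * s) /\ (y <= y' /\ y' + b * s' <= y + b * s)) ->
  P 0%nat x0 y0 1 ->
  exists xs ys, forall n, exists x y s, 0 < s <= (/ 2) ^ n /\ P n x y s /\
    x <= xs <= x + a * s /\ y <= ys <= y + b * s.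
Proof.
  intros Ha Hb Hstep H0.
  set (T := {q : nat * (R * R * R) | let '(n, (x, y, s)) := q in 0 < s <= (/ 2) ^ n /\ P n x y s}).
  assert (Hs : forall p : T, exists q : T,
    let '(n, (x, y, s)) := proj1_sig p in let '(n', (x', y', s')) := proj1_sig q in
    n' = S n /\ (x <= x' /\ x' + a * s' <= x + a * s) /\ (y <= y' /\ y' + b * s' <= y + b * s)).
  { intros [[n [[x y] s]] [Hs Hp]].
    destruct (Hstep n x y s (proj1 Hs) Hp) as (x' & y' & s' & [Hs' Hp'] & Hx & Hy).
    unshelve eexists (exist _ (S n, (x', y', s')) _); simpl; [split; [lra | exact Hp'] | auto]. }
  destruct (choice_function _ _ _ Hs) as [F HF].
  unshelve epose (p0 := exist _ (0%nat, (x0, y0, 1)) _ : T); [simpl; split; [lra | exact H0]|].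
  set (u := fun n => proj1_sig (Nat.iter n F p0)).
  assert (Hu : forall n, let '(m, (x, y, s)) := u n in let '(m', (x', y', s')) := u (S n) in
    m' = S m /\ (x <= x' /\ x' + a * s' <= x + a * s) /\ (y <= y' /\ y' + b * s' <= y + b * s))
    by (intros n; apply (HF (Nat.iter n F p0))).
  assert (Hin : forall n, let '(m, (x, y, s)) := u n in 0 < s <= (/ 2) ^ m /\ P m x y s)
    by (intros n; exact (proj2_sig (Nat.iter n F p0))).
  assert (Hm : forall n, fst (u n) = n).
  { induction n as [|n IH]; [reflexivity|]. specialize (Hu n).
    destruct (u n) as [m [[x y] s]], (u (S n)) as [m' [[x' y'] s']]. simpl in *. lia. }
  destruct (nested_intervals (fun n => fst (fst (snd (u n))))
    (fun n => a * snd (snd (u n)))) as [xs Hxs].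
  { intros n. specialize (Hin n). destruct (u n) as [m [[x y] s]]. simpl. nra. }
  { intros n. specialize (Hu n). destruct (u n) as [m [[x y] s]], (u (S n)) as [m' [[x' y'] s']].
    tauto. }
  destruct (nested_intervals (fun n => snd (fst (snd (u n))))
    (fun n => b * snd (snd (u n)))) as [ys Hys].
  { intros n. specialize (Hin n). destruct (u n) as [m [[x y] s]]. simpl. nra. }
  { intros n. specialize (Hu n). destruct (u n) as [m [[x y] s]], (u (S n)) as [m' [[x' y'] s']].
    tauto. }
  exists xs, ys. intros n. specialize (Hin n). specialize (Hm n). specialize (Hxs n).
  specialize (Hys n).
  destruct (u n) as [m [[x y] s]]. simpl in *. subst m. exists x, y, s. tauto.
Qed.

Notation CInt := (@RInt C_R_CompleteNormedModule).
Notation ex_CInt := (@ex_RInt C_R_NormedModule).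

Lemma ccontinuous_minus (f g : C -> C) z :
  ccontinuous f z -> ccontinuous g z -> ccontinuous (fun w => f w - g w)%C z.
Proof.
  intros Hf Hg eps He. destruct (Hf (eps / 2) ltac:(lra)) as [d1 [Hd1 H1]].
  destruct (Hg (eps / 2) ltac:(lra)) as [d2 [Hd2 H2]].
  exists (Rmin d1 d2). split; [apply Rmin_pos; lra|]. intros w Hw.
  specialize (H1 w (Rlt_le_trans _ _ _ Hw (Rmin_l _ _))).
  specialize (H2 w (Rlt_le_trans _ _ _ Hw (Rmin_r _ _))).
  replace (f w - g w - (f z - g z))%C with ((f w - f z) + - (g w - g z))%C by ring.
  eapply Rle_lt_trans; [apply Cmod_triangle|]. rewrite Cmod_opp. lra.
Qed.

Lemma continuous_path (f : C -> C) (p : R -> C) (x : R) :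
  (forall t, Cmod (p t - p x) = Rabs (t - x)) ->
  ccontinuous f (p x) -> @continuous R_UniformSpace C_UniformSpace (fun t => f (p t)) x.
Proof.
  intros Hp Hf P [eps HP]. destruct (Hf eps (cond_pos eps)) as [d [Hd H]].
  exists (mkposreal d Hd). intros t Ht. apply HP.
  apply C_NormedModule_mixin_compat1. apply H. rewrite Hp. exact Ht.
Qed.

Lemma Cmod_horizontal y x t : Cmod ((t, y) - (x, y)) = Rabs (t - x).
Proof.
  replace ((t, y) - (x, y))%C with (RtoC (t - x)); [apply Cmod_R|].
  unfold RtoC, Cminus, Cplus, Copp; simpl. f_equal; ring.
Qed.

Lemma Cmod_vertical x y t : Cmod ((x, t) - (x, y)) = Rabs (t - y).
Proof.
  replace ((x, t) - (x, y))%C with (Ci * RtoC (t - y))%C.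
  - rewrite Cmod_mult, Cmod_Ci, Cmod_R. ring.
  - unfold RtoC, Ci, Cmult, Cminus, Cplus, Copp; simpl. f_equal; ring.
Qed.

Definition on_rect (x y a b : R) (P : C -> Prop) : Prop :=
  forall s t, x <= s <= x + a -> y <= t <= y + b -> P (s, t).

Lemma ex_CInt_h (W : C -> C) y x1 x2 : x1 <= x2 ->
  (forall s, x1 <= s <= x2 -> ccontinuous W (s, y)) -> ex_CInt (fun t => W (t, y)) x1 x2.
Proof.
  intros L H. apply (@ex_RInt_continuous C_R_CompleteNormedModule).
  rewrite Rmin_left, Rmax_right by exact L. intros z Hz.
  apply (continuous_path W (fun t => (t, y))); [intros t; apply Cmod_horizontal | auto].
Qed.

Lemma ex_CInt_v (W : C -> C) x y1 y2 : y1 <= y2 ->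
  (forall s, y1 <= s <= y2 -> ccontinuous W (x, s)) -> ex_CInt (fun t => W (x, t)) y1 y2.
Proof.
  intros L H. apply (@ex_RInt_continuous C_R_CompleteNormedModule).
  rewrite Rmin_left, Rmax_right by exact L. intros z Hz.
  apply (continuous_path W (fun t => (x, t))); [intros t; apply Cmod_vertical | auto].
Qed.

(** The integral of [W(z) dz] along the positively oriented boundary of the
    rectangle with corner [(x, y)] and sides [a], [b]. *)
Definition boundary_integral (W : C -> C) (x y a b : R) : C :=
  (CInt (fun t => W (t, y)) x (x + a)%R - CInt (fun t => W (t, (y + b)%R)) x (x + a)%R
   + Ci * (CInt (fun t => W ((x + a)%R, t)) y (y + b)%R - CInt (fun t => W (x, t)) y (y + b)%R))%C.

Lemma CInt_minus (f g : R -> C) a b : ex_CInt f a b -> ex_CInt g a b ->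
  CInt (fun t => f t - g t)%C a b = (CInt f a b - CInt g a b)%C.
Proof. intros Hf Hg. exact (@RInt_minus C_R_CompleteNormedModule f g a b Hf Hg). Qed.

Lemma CInt_Chasles (f : R -> C) a b c : ex_CInt f a b -> ex_CInt f b c ->
  CInt f a c = (CInt f a b + CInt f b c)%C.
Proof. intros Hf Hg. symmetry. exact (@RInt_Chasles C_R_CompleteNormedModule f a b c Hf Hg). Qed.

Lemma CInt_bound (f : R -> C) a b M : a <= b -> (forall t, a <= t <= b -> Cmod (f t) <= M) ->
  ex_CInt f a b -> Cmod (CInt f a b) <= (b - a) * M.
Proof.
  intros L H He. rewrite Cmod_norm.
  apply (@norm_RInt_le_const C_R_NormedModule f a b (CInt f a b) M L).
  { intros t Ht. rewrite <- Cmod_norm. apply H, Ht. }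
  exact (@RInt_correct C_R_CompleteNormedModule f a b He).
Qed.

Lemma ex_CInt_edges W x y a b : 0 <= a -> 0 <= b -> on_rect x y a b (ccontinuous W) ->
  ex_CInt (fun t => W (t, y)) x (x + a) /\ ex_CInt (fun t => W (t, y + b)) x (x + a) /\
  ex_CInt (fun t => W (x + a, t)) y (y + b) /\ ex_CInt (fun t => W (x, t)) y (y + b).
Proof.
  intros Ha Hb HW.
  split; [apply (ex_CInt_h W y) | split; [apply (ex_CInt_h W (y + b)) |
    split; [apply (ex_CInt_v W (x + a)) | apply (ex_CInt_v W x)]]];
    try lra; intros s Hs; apply HW; lra.
Qed.

Lemma boundary_integral_minus V W x y a b : 0 <= a -> 0 <= b ->
  on_rect x y a b (ccontinuous V) -> on_rect x y a b (ccontinuous W) ->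
  boundary_integral (fun w => V w - W w)%C x y a b =
  (boundary_integral V x y a b - boundary_integral W x y a b)%C.
Proof.
  intros Ha Hb HV HW. unfold boundary_integral.
  destruct (ex_CInt_edges V x y a b Ha Hb HV) as (V1 & V2 & V3 & V4).
  destruct (ex_CInt_edges W x y a b Ha Hb HW) as (W1 & W2 & W3 & W4).
  rewrite (CInt_minus (fun t => V (t, y)) (fun t => W (t, y))),
    (CInt_minus (fun t => V (t, (y + b)%R)) (fun t => W (t, (y + b)%R))),
    (CInt_minus (fun t => V ((x + a)%R, t)) (fun t => W ((x + a)%R, t))),
    (CInt_minus (fun t => V (x, t)) (fun t => W (x, t))) by assumption. ring.
Qed.

Lemma boundary_integral_bound W x y a b M : 0 <= a -> 0 <= b ->
  on_rect x y a b (ccontinuous W) -> on_rect x y a b (fun w => Cmod (W w) <= M) ->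
  Cmod (boundary_integral W x y a b) <= 2 * (a + b) * M.
Proof.
  intros Ha Hb HW HM. unfold boundary_integral.
  destruct (ex_CInt_edges W x y a b Ha Hb HW) as (W1 & W2 & W3 & W4).
  assert (E1 := CInt_bound _ x (x + a) M ltac:(lra) (fun t Ht => HM t y Ht ltac:(lra)) W1).
  assert (E2 := CInt_bound _ x (x + a) M ltac:(lra) (fun t Ht => HM t (y + b) Ht ltac:(lra)) W2).
  assert (E3 := CInt_bound _ y (y + b) M ltac:(lra) (fun t Ht => HM (x + a) t ltac:(lra) Ht) W3).
  assert (E4 := CInt_bound _ y (y + b) M ltac:(lra) (fun t Ht => HM x t ltac:(lra) Ht) W4).
  eapply Rle_trans; [apply Cmod_triangle|]. rewrite Cmod_mult, Cmod_Ci.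
  unfold Cminus.
  assert (T1 := Cmod_triangle (CInt (fun t => W (t, y)) x (x + a))
    (- CInt (fun t => W (t, y + b)) x (x + a))).
  assert (T2 := Cmod_triangle (CInt (fun t => W (x + a, t)) y (y + b))
    (- CInt (fun t => W (x, t)) y (y + b))).
  rewrite Cmod_opp in T1, T2. lra.
Qed.

Lemma boundary_integral_split W x y a b : 0 <= a -> 0 <= b ->
  on_rect x y a b (ccontinuous W) ->
  boundary_integral W x y a b =
  (boundary_integral W x y (a/2)%R (b/2)%R + boundary_integral W (x + a/2)%R y (a/2)%R (b/2)%R
   + boundary_integral W x (y + b/2)%R (a/2)%R (b/2)%R + boundary_integral W (x + a/2)%R (y +
       b/2)%R (a/2)%R (b/2)%R)%C.
Proof.
  intros Ha Hb HW. unfold boundary_integral.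
  replace (x + a/2 + a/2) with (x + a) by field. replace (y + b/2 + b/2) with (y + b) by field.
  assert (A : forall v, y <= v <= y + b -> CInt (fun t => W (t, v)) x (x + a) =
    (CInt (fun t => W (t, v)) x (x + a/2)%R + CInt (fun t => W (t, v)) (x + a/2)%R (x + a)%R)%C).
  { intros v Hv. apply CInt_Chasles; apply ex_CInt_h; try lra; intros s Hs; apply HW; lra. }
  assert (B : forall v, x <= v <= x + a -> CInt (fun t => W (v, t)) y (y + b) =
    (CInt (fun t => W (v, t)) y (y + b/2)%R + CInt (fun t => W (v, t)) (y + b/2)%R (y + b)%R)%C).
  { intros v Hv. apply CInt_Chasles; apply ex_CInt_v; try lra; intros s Hs; apply HW; lra. }
  rewrite !A, !B by lra. ring.
Qed.

Lemma CInt_affine (p q r s a b : R) :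
  CInt (fun t => (p + q * t, r + s * t)) a b =
  (p * (b - a) + q * (b * b - a * a) / 2, r * (b - a) + s * (b * b - a * a) / 2).
Proof.
  apply (@is_RInt_unique C_R_CompleteNormedModule).
  assert (H : forall u v, is_RInt (fun t => u + v * t) a b (u * (b - a) + v * (b * b - a * a) / 2)).
  { intros u v.
    replace (u * (b - a) + v * (b * b - a * a) / 2) with (minus ((fun t => u * t + v * t * t / 2)
      b) ((fun t => u * t + v * t * t / 2) a)).
    - apply (is_RInt_derive (V := R_CompleteNormedModule) (fun t => u * t + v * t * t / 2)).
      + intros t _. auto_derive; [exact I | field].
      + intros t _. apply (ex_derive_continuous (fun t => u + v * t)). auto_derive. exact I.
    - unfold minus, plus, opp; simpl. field. }
  apply (@is_RInt_fct_extend_pair R_NormedModule R_NormedModule); simpl; apply H.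
Qed.

Lemma boundary_integral_affine c l x y a b :
  boundary_integral (fun w => c + l * w)%C x y a b = 0%C.
Proof.
  destruct c as [c1 c2], l as [l1 l2]. unfold boundary_integral.
  assert (A : forall v u1 u2, CInt (fun t => (c1, c2) + (l1, l2) * (t, v))%C u1 u2 =
     CInt (fun t => ((c1 - l2 * v) + l1 * t, (c2 + l1 * v) + l2 * t)) u1 u2).
  { intros v u1 u2. apply (@RInt_ext C_R_CompleteNormedModule). intros t _.
    unfold Cplus, Cmult; simpl. f_equal; ring. }
  assert (B : forall v u1 u2, CInt (fun t => (c1, c2) + (l1, l2) * (v, t))%C u1 u2 =
     CInt (fun t => ((c1 + l1 * v) + (- l2) * t, (c2 + l2 * v) + l1 * t)) u1 u2).
  { intros v u1 u2. apply (@RInt_ext C_R_CompleteNormedModule). intros t _.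
    unfold Cplus, Cmult; simpl. f_equal; ring. }
  rewrite !A, !B, !CInt_affine. unfold RtoC, Ci, Cminus, Cplus, Copp, Cmult; simpl. f_equal; field.
Qed.

Lemma ccontinuous_affine c l z : ccontinuous (fun w => c + l * w)%C z.
Proof.
  intros eps He.
  destruct (cderivable_continuous _ z (cderivable_affine l c z) eps He) as [d [Hd H]].
  exists d. split; [exact Hd|]. intros w Hw. specialize (H w Hw).
  replace (c + l * w - (c + l * z))%C with (l * w + c - (l * z + c))%C by ring. exact H.
Qed.

(** Bisection: a nonzero boundary integral would be as large, relative to the
    area, on arbitrarily small rectangles around a point, where [W] is affine up
    to an error that is small relative to the diameter. *)
Theorem goursat W x0 y0 a b : 0 < a -> 0 < b ->
  on_rect x0 y0 a b (fun z => cderivable W z) -> boundary_integral W x0 y0 a b = 0%C.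
Proof.
  intros Ha Hb HW. apply NNPP. intros Hn. apply Cmod_gt_0 in Hn.
  set (k := Cmod (boundary_integral W x0 y0 a b)) in *.
  destruct (nested_rectangles a b (fun _ x y s => x0 <= x /\ x + a * s <= x0 + a /\ y0 <= y /\
    y + b * s <= y0 + b /\
     k * (s * s) <= Cmod (boundary_integral W x y (a * s) (b * s))) x0 y0 Ha Hb) as (xs & ys & H).
  - intros _ x y s Hs (H1 & H2 & H3 & H4 & H5).
    assert (0 < a * s) by nra. assert (0 < b * s) by nra.
    rewrite boundary_integral_split in H5; [|lra|lra|].
    2:{ intros u v Hu Hv. apply cderivable_continuous. apply HW; lra. }
    apply NNPP. intros Hno.
    assert (Hq : forall i j, (i = 0 \/ i = 1) -> (j = 0 \/ j = 1) ->
      Cmod (boundary_integral W (x + i * (a * s / 2)) (y + j * (b * s / 2)) (a * s / 2)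
        (b * s / 2)) < k * (s / 2 * (s / 2))).
    { intros i j Hi Hj. apply Rnot_le_lt. intros Hle. apply Hno.
      exists (x + i * (a * s / 2)), (y + j * (b * s / 2)), (s / 2).
      replace (a * (s / 2)) with (a * s / 2) by field.
      replace (b * (s / 2)) with (b * s / 2) by field.
      destruct Hi as [-> | ->]; destruct Hj as [-> | ->]; repeat split; try lra. }
    assert (Q1 := Hq 0 0 ltac:(lra) ltac:(lra)). assert (Q2 := Hq 0 1 ltac:(lra) ltac:(lra)).
    assert (Q3 := Hq 1 0 ltac:(lra) ltac:(lra)). assert (Q4 := Hq 1 1 ltac:(lra) ltac:(lra)).
    rewrite !Rmult_0_l, !Rmult_1_l, !Rplus_0_r in *.
    assert (T := Cmod_triangle).
    revert Q1 Q2 Q3 Q4 H5.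
    set (I1 := boundary_integral W x y _ _). set (I2 := boundary_integral W x (y + _) _ _).
    set (I3 := boundary_integral W (x + _) y _ _).
    set (I4 := boundary_integral W (x + _) (y + _) _ _).
    intros Q1 Q2 Q3 Q4 H5.
    assert (T1 := T (I1 + I3 + I2)%C I4). assert (T2 := T (I1 + I3)%C I2). assert (T3 := T I1 I3).
    replace (k * (s / 2 * (s / 2))) with (k * (s * s) / 4) in * by field. lra.
  - rewrite !Rmult_1_r. fold k. repeat split; lra.
  - assert (Hxy : x0 <= xs <= x0 + a /\ y0 <= ys <= y0 + b).
    { destruct (H 0%nat) as (x & y & s & Hs & (H1 & H2 & H3 & H4 & _) & Hx & Hy). lra. }
    assert (Hd := HW xs ys (proj1 Hxy) (proj2 Hxy)). apply cderivable_eps in Hd.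
    destruct Hd as [l Hl].
    assert (Hab : 0 < (a + b) * (a + b)) by nra.
    destruct (Hl (k / (4 * ((a + b) * (a + b))))) as [d [Hd Hw]].
    { apply Rdiv_lt_0_compat; lra. }
    destruct (pow_lt_1_zero (/ 2) ltac:(rewrite Rabs_right; lra) (d / (a + b))) as [n Hn'].
    { apply Rdiv_lt_0_compat; lra. }
    specialize (Hn' n (Nat.le_refl _)).
    destruct (H n) as (x & y & s & Hs & (H1 & H2 & H3 & H4 & H5) & Hx & Hy).
    assert (Hsd : (a + b) * s < d).
    { rewrite Rabs_right in Hn' by lra. apply Rlt_div_r in Hn'; [nra | lra]. }
    assert (0 < a * s) by nra. assert (0 < b * s) by nra.
    set (z0 := (xs, ys)) in *.
    set (Af := fun w => ((W z0 - l * z0) + l * w)%C).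
    assert (HcW : on_rect x y (a * s) (b * s) (ccontinuous W)).
    { intros u v Hu Hv. apply cderivable_continuous. apply HW; lra. }
    assert (HcA : on_rect x y (a * s) (b * s) (ccontinuous Af)).
    { intros u v Hu Hv. apply ccontinuous_affine. }
    assert (E := boundary_integral_minus W Af x y (a * s) (b * s) ltac:(lra) ltac:(lra) HcW HcA).
    unfold Af in E at 2. rewrite boundary_integral_affine in E.
    assert (E' : boundary_integral (fun w => W w - Af w)%C x y (a * s)
      (b * s) = boundary_integral W x y (a * s) (b * s)).
    { rewrite E. ring. } clear E.
    assert (Bd := boundary_integral_bound (fun w => W w - Af w)%C x y (a * s) (b * s)
      (k / (4 * ((a + b) * (a + b))) * ((a + b) * s)) ltac:(lra) ltac:(lra)).
    rewrite E' in Bd.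
    assert (Bd' : 2 * (a * s + b * s) * (k / (4 * ((a + b) * (a + b))) * ((a + b) * s)) =
      k * (s * s) / 2) by (field; lra).
    rewrite Bd' in Bd.
    assert (Hs0 := proj1 Hs). assert (Hss : 0 < s * s) by nra.
    assert (Hks := Rmult_lt_0_compat _ _ Hn Hss). fold k in Hks.
    enough (Cmod (boundary_integral W x y (a * s) (b * s)) <= k * (s * s) / 2) by lra.
    apply Bd.
    + intros u v Hu Hv. apply ccontinuous_minus; [apply HcW | apply HcA]; lra.
    + intros u v Hu Hv. unfold Af.
      replace (W (u, v) - (W z0 - l * z0 + l * (u, v)))%C with (W (u, v) - W z0 - l * ((u,
        v) - z0))%C by ring.
      assert (Hm : Cmod ((u, v) - z0) <= (a + b) * s).
      { eapply Rle_trans; [apply Cmod_le_Rabs|]. unfold z0; simpl.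
        assert (Rabs (u + - xs) <= a * s) by (apply Rabs_le; lra).
        assert (Rabs (v + - ys) <= b * s) by (apply Rabs_le; lra). lra. }
      eapply Rle_trans; [apply Hw; lra|]. apply Rmult_le_compat_l; [|exact Hm].
      left. apply Rdiv_lt_0_compat; lra.
Qed.

(** * Maximum principle and identity theorem *)

Lemma CInt_const (c : C) a b : CInt (fun _ => c) a b = (RtoC (b - a) * c)%C.
Proof.
  rewrite (@RInt_const C_R_CompleteNormedModule).
  destruct c as [u v]. unfold scal, RtoC, Cmult; simpl. unfold prod_scal, scal; simpl.
  unfold mult; simpl. f_equal; ring.
Qed.

Lemma Ci_cancel (a b c : C) : (a - a + Ci * (b - c) = 0)%C -> b = c.
Proof.
  destruct b as [b1 b2], c as [c1 c2]. intros G.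
  replace (a - a + Ci * ((b1, b2) - (c1, c2)))%C with (Ci * ((b1, b2) - (c1, c2)))%C in G by ring.
  unfold Ci, RtoC, Cminus, Cplus, Copp, Cmult in G; simpl in G. injection G. intros. f_equal; lra.
Qed.

(** Goursat's theorem for [h (exp w)] on [[-S, 0] x [0, 2 pi]]: the horizontal
    sides cancel by periodicity, so the mean of [h] over a circle around 0 does
    not depend on the radius. *)
Lemma circle_mean (h : C -> C) (S : R) : 0 < S ->
  (forall z, Cmod z <= 1 -> cderivable h z) ->
  CInt (fun t => h (cexp (0, t))) 0 (2 * PI) = CInt (fun t => h (cexp (- S, t))) 0 (2 * PI).
Proof.
  intros HS Hh. assert (HP := PI_RGT_0).
  assert (G := goursat (fun w => h (cexp w)) (- S) 0 S (2 * PI) HS ltac:(lra)).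
  unfold boundary_integral in G. cbv beta in G.
  replace (- S + S) with 0 in G by ring. rewrite !Rplus_0_l in G.
  assert (E : CInt (fun t => h (cexp (t, 2 * PI))) (- S) 0 = CInt (fun t => h (cexp (t, 0)))
    (- S) 0).
  { apply (@RInt_ext C_R_CompleteNormedModule). intros t _. f_equal. unfold cexp; simpl.
    rewrite cos_2PI, sin_2PI, cos_0, sin_0. reflexivity. }
  rewrite E in G.
  apply (Ci_cancel (CInt (fun t => h (cexp (t, 0))) (- S) 0)). apply G.
  intros s t Hs Ht. apply (cderivable_comp h cexp); [apply cderivable_cexp|].
    apply Hh, Cmod_cexp_le_1. simpl. lra.
Qed.

(** Shrinking the circle in [circle_mean] gives the mean value property. *)
Lemma center_bound (h : C -> C) (M : R) :
  (forall z, Cmod z <= 1 -> cderivable h z) ->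
  (forall t, 0 <= t <= 2 * PI -> Cmod (h (cexp (0, t))) <= M) ->
  Cmod (h 0%C) <= M.
Proof.
  intros Hh HM. assert (HP := PI_RGT_0).
  apply Rnot_lt_le. intros Hlt. set (e := (Cmod (h 0%C) - M) / 2).
  assert (He : 0 < e) by (unfold e; lra).
  destruct (cderivable_continuous h 0%C (Hh 0%C ltac:(rewrite Cmod_0; lra)) e He) as [d [Hd H]].
  destruct (Rlt_le_dec 0 (- ln (d / 2))) as [HS|HS].
  2:{ exfalso. assert (1 <= d / 2).
      { rewrite <- exp_0, <- (exp_ln (d / 2)) by lra.
        destruct (Req_dec (ln (d / 2)) 0) as [->|]; [lra|]. left; apply exp_increasing; lra. }
      assert (Hq := HM 0 ltac:(lra)).
      replace (cexp (0, 0)) with (RtoC 1) in Hq by (symmetry; exact cexp_0).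
      specialize (H 1%C). replace (1 - 0)%C with (RtoC 1) in H by ring. rewrite Cmod_1 in H.
      specialize (H ltac:(lra)).
      assert (T := Cmod_le_sub (h 0%C) (h 1%C)). rewrite Cmod_sub_sym in T. unfold e in H. lra. }
  set (S := - ln (d / 2)) in *.
  assert (Hexp : exp (- S) = d / 2) by (unfold S; rewrite Ropp_involutive; apply exp_ln; lra).
  assert (HSexp : exp (- S) < 1) by (rewrite <- exp_0; apply exp_increasing; lra).
  assert (E := circle_mean h S HS Hh).
  assert (Hcv : forall x t, x <= 0 -> ccontinuous (fun w => h (cexp w)) (x, t)).
  { intros x t Hx. apply cderivable_continuous.
    apply (cderivable_comp h cexp); [apply cderivable_cexp|].
    apply Hh, Cmod_cexp_le_1. exact Hx. }
  assert (I0 : ex_CInt (fun t => h (cexp (0, t))) 0 (2 * PI)).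
  { apply (ex_CInt_v (fun w => h (cexp w))); [lra|]. intros s _. apply Hcv. lra. }
  assert (I1 : ex_CInt (fun t => h (cexp (- S, t))) 0 (2 * PI)).
  { apply (ex_CInt_v (fun w => h (cexp w))); [lra|]. intros s _. apply Hcv. lra. }
  assert (B0 := CInt_bound _ 0 (2 * PI) M ltac:(lra) HM I0).
  assert (I2 : ex_CInt (fun _ => h 0%C) 0 (2 * PI)) by apply ex_RInt_const.
  assert (I3 : ex_CInt (fun t => h (cexp ((- S)%R, t)) - h 0%C)%C 0 (2 * PI)).
  { exact (@ex_RInt_minus C_R_NormedModule _ _ 0 (2 * PI) I1 I2). }
  assert (B1 : Cmod (CInt (fun t => h (cexp ((- S)%R,
    t)) - h 0%C)%C 0 (2 * PI)) <= (2 * PI - 0) * e).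
  { apply CInt_bound; [lra| |exact I3]. intros t _. left. apply H.
    replace (cexp ((- S)%R, t) - 0)%C with (cexp ((- S)%R, t)) by ring. rewrite Cmod_cexp. simpl.
    lra. }
  rewrite (CInt_minus (fun t => h (cexp (- S, t)))
    (fun _ => h 0%C)), CInt_const in B1 by assumption.
  rewrite <- E in B1.
  assert (T := Cmod_le_sub (RtoC (2 * PI - 0) * h 0%C)%C (CInt (fun t => h (cexp (0,
    t))) 0 (2 * PI))).
  rewrite Cmod_sub_sym in B1. rewrite Cmod_mult, Cmod_R, Rabs_right in T by lra.
  assert ((2 * PI) * Cmod (h 0%C) <= 2 * PI * (M + e)) by lra.
  apply Rmult_le_reg_l in H0; [|lra]. unfold e in H0. lra.
Qed.

Lemma circle_bounded (h : C -> C) : (forall z, Cmod z <= 1 -> cderivable h z) ->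
  exists M, 0 <= M /\ forall t, 0 <= t <= 2 * PI -> Cmod (h (cexp (0, t))) <= M.
Proof.
  intros Hh. assert (HP := PI_RGT_0).
  destruct (continuity_ab_maj (fun t => Cmod (h (cexp (0, t)))) 0 (2 * PI)) as [m [Hm _]]; [lra| |].
  - intros t _. apply continuity_pt_filterlim.
    apply (continuous_comp (fun t => h (cexp (0, t))) Cmod).
    + apply (continuous_path (fun w => h (cexp w))
        (fun t => (0, t))); [intros s; apply Cmod_vertical|].
      apply cderivable_continuous, (cderivable_comp h cexp); [apply cderivable_cexp|].
      apply Hh, Cmod_cexp_le_1. simpl. lra.
    + apply (continuous_ext (@norm R_AbsRing C_R_NormedModule)); [intros x; symmetry; apply
        Cmod_norm|].
      exact (@filterlim_norm R_AbsRing C_R_NormedModule (h (cexp (0, t)))).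
  - exists (Cmod (h (cexp (0, m)))). split; [apply Cmod_ge_0 | exact Hm].
Qed.

(** The quotients [f / t^n] are holomorphic as [f] vanishes near 0. The Moebius map
    [phi] sends the unit disc onto the disc of radius 3/2 and 0 to 1, so the maximum
    principle bounds [f 1] by [M (2/3)^n] for every [n], where [M] bounds [f] on the
    circle of radius 3/2. *)
Lemma identity_disc (f : C -> C) :
  (forall t, Cmod t < 2 -> cderivable f t) ->
  (exists d, 0 < d /\ forall t, Cmod t < d -> f t = 0%C) ->
  f 1%C = 0%C.
Proof.
  intros Hf [d [Hd H0]].
  set (phi := fun z : C => ((RtoC 9 * z + RtoC 6) / (RtoC 4 * z + RtoC 6))%C).
  (* |9z+6|^2 - (9/4)|4z+6|^2 = 45 (|z|^2 - 1) *)
  assert (Hsq : forall z, Cmod (RtoC 9 * z + RtoC 6) ^ 2 =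
    9/4 * Cmod (RtoC 4 * z + RtoC 6) ^ 2 + 45 * (Cmod z ^ 2 - 1)).
  { intros [x y]. rewrite !Cmod2_alt. unfold RtoC, Cplus, Cmult, Re, Im; simpl. field. }
  assert (Hden : forall z, Cmod z <= 1 -> (RtoC 4 * z + RtoC 6)%C <> 0%C).
  { intros z Hz. apply Cmod_gt_0.
    assert (T := Cmod_le_sub (RtoC 6) (- (RtoC 4 * z))%C).
    rewrite Cmod_opp, Cmod_mult, !Cmod_R in T.
    replace (RtoC 6 - - (RtoC 4 * z))%C with (RtoC 4 * z + RtoC 6)%C in T by ring.
    rewrite !Rabs_right in T by lra. lra. }
  assert (Hphi : forall z, Cmod z <= 1 -> Cmod (phi z) <= 3 / 2).
  { intros z Hz. unfold phi. rewrite Cmod_div by auto.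
    assert (Hp := proj1 (Cmod_gt_0 _) (Hden z Hz)).
    apply Rle_div_l; [exact Hp|].
    specialize (Hsq z). assert (Cmod z ^ 2 <= 1). { assert (X := Cmod_ge_0 z). simpl. nra. }
    assert (X := Cmod_ge_0 (RtoC 9 * z + RtoC 6)). nra. }
  assert (Hphi1 : forall z, Cmod z = 1 -> Cmod (phi z) = 3 / 2).
  { intros z Hz. unfold phi. assert (Hz' : Cmod z <= 1) by lra. rewrite Cmod_div by auto.
    assert (Hp := proj1 (Cmod_gt_0 _) (Hden z Hz')).
    apply Rmult_eq_reg_r with (Cmod (RtoC 4 * z + RtoC 6)); [|lra].
    unfold Rdiv at 1. rewrite Rmult_assoc, Rinv_l, Rmult_1_r by lra.
    specialize (Hsq z). rewrite Hz in Hsq.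
    assert (X := Cmod_ge_0 (RtoC 9 * z + RtoC 6)). nra. }
  assert (Hdphi : forall z, Cmod z <= 1 -> cderivable phi z).
  { intros z Hz.
    apply (cderivable_div (fun z => RtoC 9 * z + RtoC 6)%C (fun z => RtoC 4 * z + RtoC 6)%C); auto;
    apply cderivable_affine. }
  assert (Hphi0 : phi 0%C = 1%C).
  { unfold phi. rewrite !Cmult_0_r, !Cplus_0_l. field. }
  destruct (circle_bounded (fun z => f (phi z))) as [M [HM0 HM]].
  { intros z Hz. apply (cderivable_comp f phi); [auto|]. apply Hf. specialize (Hphi z Hz). lra. }
  assert (Hn : forall n, Cmod (f 1%C) <= M * (2 / 3) ^ n).
  { intros n.
    assert (B := center_bound (fun z => f (phi z) * Cpow (/ phi z) n)%C (M * (2 / 3) ^ n)).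
    simpl in B. rewrite Hphi0 in B.
    replace (f 1 * Cpow (/ 1) n)%C with (f 1%C) in B.
    2:{ replace (/ RtoC 1)%C with (RtoC 1) by (field; apply C1_nz).
        replace (Cpow (RtoC 1) n) with (RtoC 1); [ring|]. rewrite <- RtoC_pow, pow1. reflexivity. }
    apply B.
    - intros z Hz.
      apply (cderivable_comp (fun t => f t * Cpow (/ t) n)%C phi); [auto|].
      assert (Hb := Hphi z Hz).
      destruct (Rlt_le_dec 0 (Cmod (phi z))) as [Hp|Hp].
      + apply cderivable_mult; [apply Hf; lra|]. apply cderivable_pow. apply cderivable_inv.
        apply Cmod_gt_0, Hp.
      + assert (E : phi z = 0%C) by (apply Cmod_eq_0; assert (X := Cmod_ge_0 (phi z)); lra).
        rewrite E. apply (cderivable_ext_loc (fun _ => RtoC 0)); [|apply cderivable_const].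
        exists d. split; [exact Hd|]. intros w Hw. rewrite H0; [ring|].
        replace (w - 0)%C with w in Hw by ring. exact Hw.
    - intros t Ht. assert (Hz : Cmod (cexp (0, t)) = 1) by (rewrite Cmod_cexp; apply exp_0).
      rewrite Cmod_mult, Cmod_pow, Cmod_inv.
      2:{ apply Cmod_gt_0. rewrite Hphi1; lra. }
      rewrite (Hphi1 _ Hz). replace (/ (3 / 2)) with (2 / 3) by field.
      apply Rmult_le_compat_r; [apply pow_le; lra | apply HM, Ht]. }
  apply Cmod_eq_0. apply Rle_antisym; [|apply Cmod_ge_0].
  apply Rnot_lt_le. intros Hpos.
  destruct (pow_lt_1_zero (2 / 3) ltac:(rewrite Rabs_right; lra)
    (Cmod (f 1%C) / (M + 1))) as [n Hnn].
  { apply Rdiv_lt_0_compat; lra. }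
  specialize (Hnn n (Nat.le_refl _)). specialize (Hn n).
  assert (P := pow_le (2/3) n ltac:(lra)). rewrite Rabs_right in Hnn by lra.
  apply Rlt_div_r in Hnn; [nra | lra].
Qed.

(** * Functions of two variables *)

Notation near2 p P := (@locally CxC p P).
Definition diff2 (F : C * C -> C) (q : C * C) : Prop :=
  @ex_filterdiff C_AbsRing CxC C_NormedModule F (@locally CxC q).
Definition bidisc (p : C * C) (r : R) (q : C * C) : Prop :=
  Cmod (fst q - fst p) < r /\ Cmod (snd q - snd p) < r.

Lemma near2_filter (q : C * C) : Filter (@locally CxC q).
Proof. exact (@filter_filter _ _ (@locally_filter CxC q)). Qed.
Lemma near2_bidisc p (P : C * C -> Prop) :
  near2 p P <-> exists r, 0 < r /\ forall q, bidisc p r q -> P q.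
Proof.
  split.
  - intros H. apply locally_CxC in H. destruct H as [d [Hd H]]. exists d. split; [exact Hd|].
    intros [z t] [Hz Ht]. apply H; assumption.
  - intros [r [Hr H]]. apply locally_CxC. exists r. split; [exact Hr|]. intros z t Hz Ht. apply H.
    split; assumption.
Qed.

Lemma near2_and p (P Q : C * C -> Prop) : near2 p P -> near2 p Q -> near2 p (fun q => P q /\ Q q).
Proof. exact (@filter_and CxC (@locally CxC p) (near2_filter p) P Q). Qed.
Lemma near2_imp p (P Q : C * C -> Prop) : (forall q, P q -> Q q) -> near2 p P -> near2 p Q.
Proof. exact (@filter_imp CxC (@locally CxC p) (near2_filter p) P Q). Qed.
Lemma near2_at p (P : C * C -> Prop) : near2 p P -> P p.
Proof. exact (@locally_singleton CxC p P). Qed.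
Lemma near2_near2 p (P : C * C -> Prop) : near2 p P -> near2 p (fun q => near2 q P).
Proof. exact (@locally_locally CxC p P). Qed.
Lemma bidisc_center p r : 0 < r -> bidisc p r p.
Proof.
  intros Hr. split.
  - replace (fst p - fst p)%C with (RtoC 0) by ring. rewrite Cmod_0. exact Hr.
  - replace (snd p - snd p)%C with (RtoC 0) by ring. rewrite Cmod_0. exact Hr.
Qed.

Lemma bidisc_le p r r' q : r <= r' -> bidisc p r q -> bidisc p r' q.
Proof. intros L [H1 H2]. split; lra. Qed.
Lemma near2_bidisc_self p r q : bidisc p r q -> near2 q (bidisc p r).
Proof.
  intros [H1 H2]. apply near2_bidisc.
  exists (Rmin (r - Cmod (fst q - fst p)) (r - Cmod (snd q - snd p))).
  split; [apply Rmin_pos; lra|].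
  intros [z t] [Hz Ht]. simpl in *.
  assert (M1 := Rmin_l (r - Cmod (fst q - fst p)) (r - Cmod (snd q - snd p))).
  assert (M2 := Rmin_r (r - Cmod (fst q - fst p)) (r - Cmod (snd q - snd p))).
  split; simpl.
  - replace (z - fst p)%C with ((z - fst q) + (fst q - fst p))%C by ring.
    eapply Rle_lt_trans; [apply Cmod_triangle|]. lra.
  - replace (t - snd p)%C with ((t - snd q) + (snd q - snd p))%C by ring.
    eapply Rle_lt_trans; [apply Cmod_triangle|]. lra.
Qed.

Lemma near2_bidisc_of p r (P : C * C -> Prop) q : (forall q, bidisc p r q -> P q) ->
  bidisc p r q -> near2 q P.
Proof. intros H Hq. apply (near2_imp q (bidisc p r)); [exact H|]. apply near2_bidisc_self, Hq. Qed.

Lemma diff2_const a q : diff2 (fun _ => a) q.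
Proof. apply ex_filterdiff_const. Qed.
Lemma diff2_plus F G q : diff2 F q -> diff2 G q -> diff2 (fun x => F x + G x)%C q.
Proof. intros HF HG.
exact (@ex_filterdiff_plus_fct C_AbsRing CxC C_NormedModule _ (near2_filter q) F G HF HG). Qed.
Lemma diff2_minus F G q : diff2 F q -> diff2 G q -> diff2 (fun x => F x - G x)%C q.
Proof. intros HF HG.
exact (@ex_filterdiff_minus_fct C_AbsRing CxC C_NormedModule _ (near2_filter q) F G HF HG). Qed.
Lemma diff2_mult F G q : diff2 F q -> diff2 G q -> diff2 (fun x => F x * G x)%C q.
Proof.
  intros HF HG. apply ex_filterdiff_C_codomain in HF. apply ex_filterdiff_C_codomain in HG.
  apply ex_filterdiff_C_codomain.
  exact (@ex_filterdiff_mult_fct C_AbsRing CxC F G q Cmult_comm HF HG).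
Qed.

Lemma diff2_fst q : diff2 fst q.
Proof.
  apply ex_filterdiff_linear. exact (@is_linear_fst C_AbsRing C_NormedModule C_NormedModule).
Qed.

Lemma diff2_snd q : diff2 snd q.
Proof.
  apply ex_filterdiff_linear. exact (@is_linear_snd C_AbsRing C_NormedModule C_NormedModule).
Qed.

Lemma diff2_comp (f : C -> C) F q : diff2 F q -> cderivable f (F q) -> diff2 (fun x => f (F x)) q.
Proof.
  intros HF Hf. apply ex_derive_filterdiff in Hf. apply ex_filterdiff_C_domain in Hf.
  exact (@ex_filterdiff_comp' C_AbsRing CxC C_NormedModule C_NormedModule F f q HF Hf).
Qed.

Lemma diff2_comp_pair F f g q : diff2 f q -> diff2 g q -> diff2 F (f q, g q) ->
  diff2 (fun x => F (f x, g x)) q.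
Proof.
  intros Hf Hg HF.
  apply (@ex_filterdiff_comp'_2 C_AbsRing CxC C_NormedModule C_NormedModule C_NormedModule f g (fun
    a b => F (a, b)) q Hf Hg).
  refine (@ex_filterdiff_ext C_AbsRing CxC C_NormedModule _ (near2_filter _) F _ _ HF).
  intros [a b]. reflexivity.
Qed.

Lemma cderivable_comp_pair F (f g : C -> C) t : cderivable f t -> cderivable g t ->
  diff2 F (f t, g t) ->
  cderivable (fun x => F (f x, g x)) t.
Proof.
  intros Hf Hg HF. apply ex_derive_filterdiff. apply ex_derive_filterdiff in Hf.
  apply ex_derive_filterdiff in Hg.
  apply (@ex_filterdiff_comp'_2 C_AbsRing (AbsRing_NormedModule C_AbsRing) C_NormedModule
    C_NormedModule C_NormedModule f g (fun a b => F (a, b)) t Hf Hg).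
  refine (@ex_filterdiff_ext C_AbsRing CxC C_NormedModule _ (near2_filter _) F _ _ HF).
  intros [a b]. reflexivity.
Qed.

Lemma diff2_continuous F q : diff2 F q -> forall eps, 0 < eps ->
  near2 q (fun x => Cmod (F x - F q) < eps).
Proof.
  intros H eps He. apply filterdiff_continuous in H.
  apply (H (fun w => Cmod (w - F q) < eps)).
  apply locally_C_disc. exists eps. split; [exact He|]. intros w Hw. exact Hw.
Qed.

Lemma diff2_nonzero F q : diff2 F q -> F q <> 0%C -> near2 q (fun x => F x <> 0%C).
Proof.
  intros H Hn. apply Cmod_gt_0 in Hn. assert (L := diff2_continuous F q H _ Hn).
  revert L. apply near2_imp. intros x Hx E. rewrite E in Hx.
  replace (0 - F q)%C with (- F q)%C in Hx by ring. rewrite Cmod_opp in Hx. lra.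
Qed.

Lemma hol2_mult F G p : holomorphic2_at F p -> holomorphic2_at G p ->
  holomorphic2_at (fun x => F x * G x)%C p.
Proof. intros HF HG. generalize (near2_and p _ _ HF HG). apply near2_imp. intros q [H1 H2].
apply diff2_mult; assumption. Qed.
Lemma hol2_plus F G p : holomorphic2_at F p -> holomorphic2_at G p ->
  holomorphic2_at (fun x => F x + G x)%C p.
Proof. intros HF HG. generalize (near2_and p _ _ HF HG). apply near2_imp. intros q [H1 H2].
apply diff2_plus; assumption. Qed.
Lemma hol2_minus F G p : holomorphic2_at F p -> holomorphic2_at G p ->
  holomorphic2_at (fun x => F x - G x)%C p.
Proof. intros HF HG. generalize (near2_and p _ _ HF HG). apply near2_imp. intros q [H1 H2].
apply diff2_minus; assumption. Qed.
Lemma hol2_const a p : holomorphic2_at (fun _ => a) p.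
Proof. apply (near2_bidisc p). exists 1. split; [lra|]. intros q _. apply diff2_const. Qed.

(** Restrict to the complex line through [q] and [q']: the radii are such that the
    parameters of modulus less than 2 stay in the bidisc of radius [r]. *)
Lemma identity_bidisc E p r q q' : (forall x, bidisc p r x -> diff2 E x) ->
  bidisc p (r / 8) q -> bidisc p (r / 8) q' -> near2 q (fun x => E x = 0%C) -> E q' = 0%C.
Proof.
  intros HE [Hq1 Hq2] [Hr1 Hr2] H0. destruct q as [q1 q2], q' as [r1 r2], p as [p1 p2]. simpl in *.
  assert (Hdist : forall a b c : C, Cmod (a - c) < r / 8 -> Cmod (b - c) < r / 8 ->
    Cmod (b - a) < r / 4).
  { intros a b c Ha Hb. replace (b - a)%C with ((b - c) + - (a - c))%C by ring.
    eapply Rle_lt_trans; [apply Cmod_triangle|]. rewrite Cmod_opp. lra. }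
  assert (D1 := Hdist _ _ _ Hq1 Hr1). assert (D2 := Hdist _ _ _ Hq2 Hr2).
  assert (Hr : 0 < r) by (assert (X := Cmod_ge_0 (q1 - p1)); lra).
  assert (Hl := identity_disc (fun t => E (q1 + t * (r1 - q1), q2 + t * (r2 - q2))%C)).
  simpl in Hl.
  replace (q1 + 1 * (r1 - q1))%C with r1 in Hl by ring.
  replace (q2 + 1 * (r2 - q2))%C with r2 in Hl by ring.
  apply Hl; clear Hl.
  - intros t Ht.
    apply (cderivable_comp_pair E (fun t => q1 + t * (r1 - q1))%C (fun t => q2 + t * (r2 - q2))%C).
    + apply cderivable_plus; [apply cderivable_const|].
      apply cderivable_mult; [apply cderivable_id | apply cderivable_const].
    + apply cderivable_plus; [apply cderivable_const|].
      apply cderivable_mult; [apply cderivable_id | apply cderivable_const].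
    + apply HE. split; simpl.
      * replace (q1 + t * (r1 - q1) - p1)%C with ((q1 - p1) + t * (r1 - q1))%C by ring.
        eapply Rle_lt_trans; [apply Cmod_triangle|]. rewrite Cmod_mult.
        assert (X := Cmod_ge_0 t). assert (Y := Cmod_ge_0 (r1 - q1)). nra.
      * replace (q2 + t * (r2 - q2) - p2)%C with ((q2 - p2) + t * (r2 - q2))%C by ring.
        eapply Rle_lt_trans; [apply Cmod_triangle|]. rewrite Cmod_mult.
        assert (X := Cmod_ge_0 t). assert (Y := Cmod_ge_0 (r2 - q2)). nra.
  - apply near2_bidisc in H0. destruct H0 as [d [Hd H0]].
    exists (d / r). split; [apply Rdiv_lt_0_compat; lra|]. intros t Ht. apply H0.
    assert (Ht' : Cmod t * r < d).
    { apply Rlt_div_r in Ht; lra. }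
    assert (X := Cmod_ge_0 t).
    split; simpl.
    + replace (q1 + t * (r1 - q1) - q1)%C with (t * (r1 - q1))%C by ring. rewrite Cmod_mult. nra.
    + replace (q2 + t * (r2 - q2) - q2)%C with (t * (r2 - q2))%C by ring. rewrite Cmod_mult. nra.
Qed.

Definition nonzero_germ (B : C * C -> C) (p : C * C) : Prop := ~ near2 p (fun q => B q = 0%C).

Lemma nonzero_germ_spread B p : holomorphic2_at B p -> nonzero_germ B p -> near2 p (nonzero_germ B).
Proof.
  intros HB Hn. apply near2_bidisc in HB. destruct HB as [r [Hr H]].
  apply near2_bidisc. exists (r / 8). split; [lra|]. intros q Hq Hz. apply Hn.
  apply near2_bidisc. exists (r / 8). split; [lra|]. intros q' Hq'.
  apply (identity_bidisc B p r q q'); assumption.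
Qed.

(** The ring of germs of holomorphic functions is an integral domain. *)
Lemma nonzero_germ_mult B1 B2 p : holomorphic2_at B1 p -> holomorphic2_at B2 p ->
  nonzero_germ B1 p -> nonzero_germ B2 p -> nonzero_germ (fun q => B1 q * B2 q)%C p.
Proof.
  intros H1 H2 N1 N2 H0.
  assert (S := nonzero_germ_spread B2 p H2 N2).
  apply N1. generalize (near2_and _ _ _ (near2_and _ _ _ H1 S) (near2_near2 _ _ H0)).
  apply near2_imp.
  intros q [[Hd Hs] Hz]. apply NNPP. intros Hne. apply Hs.
  generalize (near2_and _ _ _ (diff2_nonzero B1 q Hd Hne) Hz). apply near2_imp.
  intros x [Hx Hx0]. apply NNPP. intros Hx2. apply (Cmult_neq_0 _ _ Hx Hx2 Hx0).
Qed.

(** * Germs of meromorphic functions *)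

(** Equality of germs of meromorphic functions. The values of a representing
    function are arbitrary on the zero set of its denominator, so equality is
    asked only off the zeros of some holomorphic [B]. *)
Definition agree (F F' : C * C -> C) (p : C * C) : Prop :=
  exists B, holomorphic2_at B p /\ nonzero_germ B p /\ near2 p (fun q => B q <> 0%C -> F q = F' q).

Lemma agree_trans F1 F2 F3 p : agree F1 F2 p -> agree F2 F3 p -> agree F1 F3 p.
Proof.
  intros (B & HB & NB & EB) (B' & HB' & NB' & EB').
  exists (fun q => B q * B' q)%C. split; [apply hol2_mult; assumption|].
  split; [apply nonzero_germ_mult; assumption|].
  generalize (near2_and _ _ _ EB EB'). apply near2_imp. intros q [E1 E2] Hn.
  rewrite E1; [apply E2|]; intros E; apply Hn; rewrite E; ring.
Qed.

Lemma agree_sym F F' p : agree F F' p -> agree F' F p.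
Proof.
  intros (B & HB & NB & EB). exists B. split; [exact HB|]. split; [exact NB|].
  revert EB. apply near2_imp. intros q E Hn. symmetry. auto.
Qed.

Lemma agree_value F F' p : agree F F' p -> holomorphic2_at F p -> holomorphic2_at F' p ->
  F p = F' p.
Proof.
  intros (B & HB & NB & EB) HF HF'. apply NNPP. intros Hne.
  apply NB. assert (Hd : diff2 (fun q => F q - F' q)%C p).
  { apply diff2_minus; [exact (near2_at _ _ HF) | exact (near2_at _ _ HF')]. }
  apply diff2_nonzero in Hd.
  - generalize (near2_and _ _ _ Hd EB). apply near2_imp. intros q [H1 H2]. apply NNPP. intros Hq.
    apply H1. rewrite (H2 Hq). ring.
  - intros E. apply Hne. replace (F p) with ((F p - F' p) + F' p)%C by ring. rewrite E. ring.
Qed.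

Lemma mero_eq_of_agree F F' : meromorphic2 F -> meromorphic2 F' ->
  (forall p, upper2 p -> agree F F' p) -> mero_eq F F'.
Proof.
  intros HF HF' H. split; [exact HF|]. split; [exact HF'|]. intros p Hp H1 H2.
  apply agree_value; auto.
Qed.

(** Writing [F = A / B] and [F' = A' / B'], take [D = A B' - A' B] and
    [E = B B']. *)
Lemma agree_cross F F' p : upper2 p -> meromorphic2 F -> meromorphic2 F' ->
  exists D E r, 0 < r /\
    (forall q, bidisc p r q -> diff2 D q /\ diff2 E q /\ nonzero_germ E q /\ (E q <> 0%C ->
      (F q = F' q <-> D q = 0%C))).
Proof.
  intros Hp HF HF'. destruct (HF p Hp) as (A & B & HA & HB & NB & EB).
  destruct (HF' p Hp) as (A' & B' & HA' & HB' & NB' & EB').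
  set (D := (fun q => A q * B' q - A' q * B q)%C). set (E := (fun q => B q * B' q)%C).
  assert (HD : holomorphic2_at D p) by (apply hol2_minus; apply hol2_mult; assumption).
  assert (HE : holomorphic2_at E p) by (apply hol2_mult; assumption).
  assert (NE : nonzero_germ E p) by (apply nonzero_germ_mult; assumption).
  assert (SE := nonzero_germ_spread E p HE NE).
  assert (L := near2_and _ _ _ (near2_and _ _ _ HD HE)
    (near2_and _ _ _ SE (near2_and _ _ _ EB EB'))).
  apply near2_bidisc in L. destruct L as [r [Hr L]]. exists D, E, r. split; [exact Hr|].
  intros q Hq. destruct (L q Hq) as [[L1 L2] [L3 [L4 L5]]]. repeat split; try assumption.
  - intros HFF. assert (Hb : B q <> 0%C) by (intros X; apply H; unfold E; rewrite X; ring).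
    assert (Hb' : B' q <> 0%C) by (intros X; apply H; unfold E; rewrite X; ring).
    rewrite L4, L5 in HFF by assumption. unfold D.
    replace (A q) with (A q / B q * B q)%C by (field; assumption). rewrite HFF. field. assumption.
  - intros HD0. assert (Hb : B q <> 0%C) by (intros X; apply H; unfold E; rewrite X; ring).
    assert (Hb' : B' q <> 0%C) by (intros X; apply H; unfold E; rewrite X; ring).
    rewrite L4, L5 by assumption. unfold D in HD0.
    replace (A q / B q)%C with ((A q * B' q - A' q * B q + A' q * B q) / (B q * B' q))%C by (field;
      auto).
    rewrite HD0. field. auto.
Qed.

(** With [D] and [E] from [agree_cross]: agreement at one point makes [D] vanish near
    it, hence on the whole bidisc. *)
Lemma agree_local F F' p : upper2 p -> meromorphic2 F -> meromorphic2 F' ->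
  exists r, 0 < r /\ forall q q', bidisc p r q -> bidisc p r q' -> agree F F' q -> agree F F' q'.
Proof.
  intros Hp HF HF'. destruct (agree_cross F F' p Hp HF HF') as (D & E & r & Hr & H).
  exists (r / 8). split; [lra|]. intros q q' Hq Hq' (B & HB & NB & EB).
  assert (Hin : forall x, bidisc p (r / 8) x -> bidisc p r x) by (intros x; apply bidisc_le; lra).
  assert (Hol : forall x, bidisc p r x -> holomorphic2_at D x /\ holomorphic2_at E x).
  { intros x Hx. split; apply (near2_bidisc_of p r); try exact Hx; intros y Hy; apply (H y Hy). }
  assert (HDz : near2 q (fun x => D x = 0%C)).
  { apply NNPP. intros ND. destruct (Hol q (Hin _ Hq)) as [HD HE].
    assert (NE : nonzero_germ E q) by (apply (H q (Hin _ Hq))).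
    apply (nonzero_germ_mult D (fun x => B x * E x)%C q HD (hol2_mult _ _ _ HB HE) ND
      (nonzero_germ_mult _ _ _ HB HE NB NE)).
    generalize (near2_and _ _ _ EB (near2_bidisc_self _ _ _ (Hin _ Hq))). apply near2_imp.
    intros x [Hx1 Hx2]. destruct (classic (B x = 0%C)) as [X|X]; [rewrite X; ring|].
    destruct (classic (E x = 0%C)) as [Y|Y]; [rewrite Y; ring|].
    destruct (H x Hx2) as (_ & _ & _ & Hiff). rewrite (proj1 (Hiff Y) (Hx1 X)). ring. }
  assert (HD0 : forall x, bidisc p (r / 8) x -> D x = 0%C).
  { intros x Hx. apply (identity_bidisc D p r q x); auto. intros y Hy. apply (H y Hy). }
  exists E. split; [apply Hol; auto|]. split; [apply H; auto|].
  apply (near2_bidisc_of p (r / 8)); [|exact Hq']. intros x Hx Hn.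
  apply (H x (Hin x Hx)); auto.
Qed.

(** With [D] and [E] from [agree_cross]: [D E] is continuous and vanishes wherever
    [F = F']. *)
Lemma agree_of_dense F F' p : upper2 p -> meromorphic2 F -> meromorphic2 F' ->
  (exists d, 0 < d /\ forall q, bidisc p d q -> forall e, 0 < e ->
    exists q', bidisc q e q' /\ F q' = F' q') ->
  agree F F' p.
Proof.
  intros Hp HF HF' [d [Hd Hdense]]. destruct (agree_cross F F' p Hp HF HF') as (D & E & r & Hr & H).
  assert (HDE : forall x, bidisc p (Rmin r d) x -> (D x * E x = 0)%C).
  { intros x Hx. apply NNPP. intros Hne.
    assert (Hxr := bidisc_le _ _ _ _ (Rmin_l r d) Hx).
    assert (Hxd := bidisc_le _ _ _ _ (Rmin_r r d) Hx).
    destruct (H x Hxr) as (H1 & H2 & _ & _).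
    assert (L := diff2_nonzero _ x (diff2_mult _ _ _ H1 H2) Hne).
    assert (L' := near2_and _ _ _ L (near2_bidisc_self _ _ _ Hxr)).
    apply near2_bidisc in L'. destruct L' as [e [He L']].
    destruct (Hdense x Hxd e He) as [q' [Hq' Heq]]. destruct (L' q' Hq') as [Hn Hb].
    destruct (H q' Hb) as (_ & _ & _ & Hiff). apply Hn.
    rewrite (proj1 (Hiff ltac:(intros X; apply Hn; rewrite X; ring)) Heq). ring. }
  assert (Hm : 0 < Rmin r d) by (apply Rmin_pos; assumption).
  assert (Hpr := bidisc_center p r Hr).
  assert (HD : holomorphic2_at D p) by (apply (near2_bidisc_of p r); [intros y Hy; apply (H y Hy) |
    exact Hpr]).
  assert (HE : holomorphic2_at E p) by (apply (near2_bidisc_of p r); [intros y Hy; apply (H y Hy) |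
    exact Hpr]).
  destruct (H p Hpr) as (_ & _ & NE & _).
  assert (HDz : near2 p (fun x => D x = 0%C)).
  { apply NNPP. intros ND. apply (nonzero_germ_mult D E p HD HE ND NE).
    apply (near2_bidisc_of p (Rmin r d)); [exact HDE | apply bidisc_center, Hm]. }
  exists E. split; [exact HE|]. split; [exact NE|].
  generalize (near2_and _ _ _ HDz (near2_bidisc_self _ _ _ Hpr)). apply near2_imp.
  intros x [Hx Hb] Hn. apply (H x Hb); assumption.
Qed.

(** Connectedness of the unit interval, in a form that suits the propagation of a
    locally constant property along a segment. *)
Lemma segment_connected (P : R -> Prop) : P 0 ->
  (forall t, 0 <= t <= 1 -> exists d, 0 < d /\ forall s s', 0 <= s <= 1 -> 0 <= s' <= 1 ->
     Rabs (s - t) < d -> Rabs (s' - t) < d -> P s -> P s') -> P 1.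
Proof.
  intros H0 H.
  destruct (completeness (fun t => 0 <= t <= 1 /\ P t)) as [m [Hm1 Hm2]].
  { exists 1. intros x [Hx _]. lra. }
  { exists 0. split; [lra | exact H0]. }
  assert (Hm : 0 <= m <= 1).
  { split; [apply Hm1; split; [lra | exact H0] | apply Hm2; intros x [Hx _]; lra]. }
  destruct (H m Hm) as [d [Hd Hloc]].
  assert (Hex : exists t, 0 <= t <= 1 /\ P t /\ m - d < t).
  { apply NNPP. intros Hno. assert (Hb : m <= m - d); [|lra]. apply Hm2. intros x [Hx1 Hx2].
    apply Rnot_lt_le. intros Hl. apply Hno. exists x. auto. }
  destruct Hex as (t & Ht & Hta & Htm).
  assert (Htm' : t <= m) by (apply Hm1; auto).
  set (m' := Rmin 1 (m + d / 2)).
  assert (Hm'1 := Rmin_l 1 (m + d / 2)). assert (Hm'2 := Rmin_r 1 (m + d / 2)).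
  fold m' in Hm'1, Hm'2.
  assert (Hm'0 : m <= m') by (apply Rmin_glb; lra).
  assert (Ha : P m') by (apply (Hloc t m'); try lra; try (apply Rabs_def1; lra); exact Hta).
  assert (Hmm : m' <= m) by (apply Hm1; split; [lra | exact Ha]).
  assert (m' = 1) as E1; [|rewrite E1 in Ha; exact Ha].
  unfold m' in *. destruct (Rle_dec 1 (m + d / 2)) as [l|l].
  - apply Rmin_left. exact l.
  - rewrite Rmin_right in Hmm by lra. lra.
Qed.

Lemma upper2_segment p q t : upper2 p -> upper2 q -> 0 <= t <= 1 ->
  upper2 (fst p + RtoC t * (fst q - fst p), snd p + RtoC t * (snd q - snd p))%C.
Proof.
  intros [H1 H2] [H3 H4] Ht. destruct p as [[a b] [c d]], q as [[a' b'] [c' d']].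
  unfold upper2, upper, Im, Cplus, Cminus, Copp, Cmult, RtoC in *; simpl in *. split; nra.
Qed.

Lemma agree_everywhere F F' p0 p1 : meromorphic2 F -> meromorphic2 F' -> upper2 p0 -> upper2 p1 ->
  agree F F' p0 -> agree F F' p1.
Proof.
  intros HF HF' Hp0 Hp1 H0.
  set (P := fun t => (fst p0 + RtoC t * (fst p1 - fst p0), snd p0 + RtoC t * (snd p1 - snd p0))%C).
  assert (P0 : P 0 = p0) by (unfold P; destruct p0; simpl; f_equal; ring).
  assert (P1 : P 1 = p1) by (unfold P; destruct p0, p1; simpl; f_equal; ring).
  set (L := Cmod (fst p1 - fst p0) + Cmod (snd p1 - snd p0) + 1).
  assert (HL : 0 < L) by (unfold L; assert (X := Cmod_ge_0 (fst p1 - fst p0)); assert (Y :=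
    Cmod_ge_0 (snd p1 - snd p0)); lra).
  rewrite <- P1. apply (segment_connected (fun t => agree F F' (P t))); [rewrite P0; exact H0|].
  intros m Hm.
  destruct (agree_local F F' (P m) (upper2_segment _ _ m Hp0 Hp1 Hm) HF HF') as [r [Hr Hloc]].
  exists (r / L). split; [apply Rdiv_lt_0_compat; lra|].
  assert (Hclose : forall t, Rabs (t - m) < r / L -> bidisc (P m) r (P t)).
  { intros t Hst. apply Rlt_div_r in Hst; [|exact HL].
    assert (Y := Rabs_pos (t - m)). unfold L in Hst.
    assert (X1 := Cmod_ge_0 (fst p1 - fst p0)). assert (X2 := Cmod_ge_0 (snd p1 - snd p0)).
    unfold P; split; simpl.
    - replace (fst p0 + t * (fst p1 - fst p0) - (fst p0 + m * (fst p1 - fst p0)))%C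
        with (RtoC (t - m) * (fst p1 - fst p0))%C by (rewrite RtoC_minus; ring).
      rewrite Cmod_mult, Cmod_R. nra.
    - replace (snd p0 + t * (snd p1 - snd p0) - (snd p0 + m * (snd p1 - snd p0)))%C
        with (RtoC (t - m) * (snd p1 - snd p0))%C by (rewrite RtoC_minus; ring).
      rewrite Cmod_mult, Cmod_R. nra. }
  intros t t' _ _ Ht Ht'. apply Hloc; apply Hclose; assumption.
Qed.

Lemma Im_near (z w : C) r : Cmod (z - w) < r -> Im w - r < Im z < Im w + r.
Proof.
  intros H. assert (H1 := Rle_lt_trans _ _ _ (im_le_Cmod _) H). apply Rabs_def2 in H1.
  destruct z, w. simpl in *. lra.
Qed.

(** Baire category: the sublevel sets of [Y] cover the half-plane, so they cannot
    all be nowhere dense. *)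
Lemma sublevel_somewhere_dense (Y : C -> R) :
  exists (z1 : C) (N d : R), upper z1 /\ 0 < d /\ forall z, Cmod (z - z1) < d -> forall e, 0 < e ->
    exists z', Cmod (z' - z) < e /\ upper z' /\ Y z' <= N.
Proof.
  apply NNPP. intros Hno.
  destruct (nested_rectangles 1 1 (fun n x y s => 0 < y /\ forall k u v, (k < n)%nat ->
    x <= u <= x + 1 * s -> y <= v <= y + 1 * s -> INR k < Y (u, v)) 0 1) as (a & b & H); try lra.
  - intros n x y s Hs [Hy _].
    assert (Hq : exists z e, Cmod (z - (x + s / 2, y + s / 2)) < s / 4 /\ 0 < e /\
       forall z', Cmod (z' - z) < e -> upper z' -> INR n < Y z').
    { apply NNPP. intros Hc. apply Hno. exists (x + s / 2, y + s / 2), (INR n), (s / 4).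
      split; [unfold upper; simpl; lra|]. split; [lra|]. intros z Hz e He. apply NNPP. intros Hc'.
      apply Hc. exists z, e. split; [exact Hz|]. split; [exact He|]. intros z' Hz' Hu.
      apply Rnot_le_lt. intros Hl. apply Hc'. exists z'. auto. }
    destruct Hq as ([a b] & e & Hz & He & HY).
    assert (Ha := Rle_lt_trans _ _ _ (re_le_Cmod _) Hz).
    assert (Hb := Rle_lt_trans _ _ _ (im_le_Cmod _) Hz).
    simpl in Ha, Hb. apply Rabs_def2 in Ha. apply Rabs_def2 in Hb.
    set (s' := Rmin (s / 4) (e / 3)).
    assert (Hs' : 0 < s') by (apply Rmin_pos; lra).
    assert (Hs1 : s' <= s / 4) by apply Rmin_l. assert (Hs2 : s' <= e / 3) by apply Rmin_r.
    exists a, b, s'. repeat split; try lra. intros k u v Hk Hu Hv.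
    apply Rle_lt_trans with (INR n); [apply le_INR; lia|]. apply HY; [|unfold upper; simpl; lra].
    eapply Rle_lt_trans; [apply Cmod_le_Rabs|]. simpl. rewrite !Rabs_right by lra. lra.
  - split; [lra|]. intros k u v Hk. lia.
  - destruct (INR_unbounded (Y (a, b))) as [n Hn].
    destruct (H (S n)) as (x & y & s & _ & [_ HY] & Ha & Hb).
    specialize (HY n a b ltac:(lia) Ha Hb). lra.
Qed.

Definition swap (p : C * C) : C * C := (snd p, fst p).

Lemma near2_swap p (P : C * C -> Prop) : near2 p P -> near2 (swap p) (fun q => P (swap q)).
Proof.
  intros H. apply near2_bidisc in H. destruct H as [r [Hr H]]. apply near2_bidisc. exists r.
  split; [exact Hr|].
  intros q [H1 H2]. apply H. split; assumption.
Qed.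

Lemma swap_swap p : swap (swap p) = p.
Proof. destruct p. reflexivity. Qed.
Lemma hol2_swap F p : holomorphic2_at F p -> holomorphic2_at (fun q => F (swap q)) (swap p).
Proof.
  intros H. apply near2_swap in H. revert H. apply near2_imp. intros q Hq.
  apply (diff2_comp_pair F snd fst); [apply diff2_snd | apply diff2_fst | exact Hq].
Qed.

Lemma nonzero_germ_swap F p : nonzero_germ F p -> nonzero_germ (fun q => F (swap q)) (swap p).
Proof.
  intros H H0. apply H. apply near2_swap in H0. rewrite swap_swap in H0. revert H0.
  apply near2_imp. intros q. rewrite swap_swap. auto.
Qed.

Lemma agree_swap F F' p : agree F F' p ->
  agree (fun q => F (swap q)) (fun q => F' (swap q)) (swap p).
Proof.
  intros (B & HB & NB & EB). exists (fun q => B (swap q)). split; [apply hol2_swap, HB|].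
  split; [apply nonzero_germ_swap, NB|]. apply near2_swap in EB. exact EB.
Qed.

Lemma meromorphic2_swap F : meromorphic2 F -> meromorphic2 (fun q => F (swap q)).
Proof.
  intros H p [Hp1 Hp2]. destruct (H (swap p) (conj Hp2 Hp1)) as (A & B & HA & HB & NB & EB).
  exists (fun q => A (swap q)), (fun q => B (swap q)).
  apply hol2_swap in HA, HB. apply nonzero_germ_swap in NB. apply near2_swap in EB.
  rewrite swap_swap in *.
  auto.
Qed.

(** The height [Y] may depend on [z] in any way, so the hypothesis gives no open
    set where the functions agree; by the category argument it does give a
    bidisc with a dense set of such points. *)
Lemma agree_of_region F F' : meromorphic2 F -> meromorphic2 F' ->
  (forall z, upper z -> exists Y : R, forall t, upper t -> Y < Im t -> F (z, t) = F' (z, t)) ->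
  forall p, upper2 p -> agree F F' p.
Proof.
  intros HF HF' H p Hp.
  assert (H' : forall z, exists Y : R, upper z -> forall t, upper t -> Y < Im t ->
    F (z, t) = F' (z, t)).
  { intros z. destruct (classic (upper z)) as [Hz|Hz]; [|exists 0; tauto].
    destruct (H z Hz) as [Y HY]. exists Y. auto. }
  destruct (choice_function _ _ _ H') as [Y HY].
  destruct (sublevel_somewhere_dense Y) as (z1 & N & d & Hz1 & Hd & Hdense).
  set (p0 := (z1, (0, Rmax N 0 + 2)) : C * C).
  assert (M1 := Rmax_l N 0). assert (M2 := Rmax_r N 0).
  assert (Hp0 : upper2 p0) by (split; [exact Hz1 | unfold upper; simpl; lra]).
  apply (agree_everywhere F F' p0 p HF HF' Hp0 Hp).
  apply (agree_of_dense F F' p0 Hp0 HF HF').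
  exists (Rmin d 1). split; [apply Rmin_pos; lra|]. intros [z t] [Hz Ht] e He. simpl in Hz, Ht.
  assert (M3 := Rmin_l d 1). assert (M4 := Rmin_r d 1).
  destruct (Hdense z ltac:(lra) e He) as (z' & Hz' & Hu & HN).
  exists (z', t). split.
  { split; simpl; [exact Hz'|]. replace (t - t)%C with (RtoC 0) by ring. rewrite Cmod_0. exact He. }
  apply Im_near in Ht. simpl in Ht.
  apply (HY z' Hu); unfold upper; lra.
Qed.

Lemma agree_of_region_swap F F' : meromorphic2 F -> meromorphic2 F' ->
  (forall t, upper t -> exists Y : R, forall z, upper z -> Y < Im z -> F (z, t) = F' (z, t)) ->
  forall p, upper2 p -> agree F F' p.
Proof.
  intros HF HF' H p Hp.
  assert (A := agree_of_region _ _ (meromorphic2_swap F HF)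
    (meromorphic2_swap F' HF') H (swap p) (conj (proj2 Hp) (proj1 Hp))).
  apply agree_swap in A. rewrite swap_swap in A. destruct A as (B & HB & NB & EB).
  exists B. split; [exact HB|]. split; [exact NB|]. revert EB. apply near2_imp. intros q.
  rewrite !swap_swap. auto.
Qed.

Lemma meromorphic2_const a : meromorphic2 (fun _ => a).
Proof.
  intros p Hp. exists (fun _ => a), (fun _ => RtoC 1). split; [apply hol2_const|].
  split; [apply hol2_const|].
  split.
  - intros H. apply near2_at in H. exact (C1_nz H).
  - apply near2_bidisc. exists 1. split; [lra|]. intros q _ _. field.
Qed.

Lemma meromorphic2_plus F G : meromorphic2 F -> meromorphic2 G ->
  meromorphic2 (fun q => F q + G q)%C.
Proof.
  intros HF HG p Hp. destruct (HF p Hp) as (A & B & HA & HB & NB & EB).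
  destruct (HG p Hp) as (A' & B' & HA' & HB' & NB' & EB').
  exists (fun q => A q * B' q + A' q * B q)%C, (fun q => B q * B' q)%C.
  split; [apply hol2_plus; apply hol2_mult; assumption|]. split; [apply hol2_mult; assumption|].
  split; [apply nonzero_germ_mult; assumption|].
  generalize (near2_and _ _ _ EB EB'). apply near2_imp. intros q [E1 E2] Hn.
  assert (Hb : B q <> 0%C) by (intros X; apply Hn; rewrite X; ring).
  assert (Hb' : B' q <> 0%C) by (intros X; apply Hn; rewrite X; ring).
  rewrite E1, E2 by assumption. field. auto.
Qed.

Lemma meromorphic2_comp_fst F (a b phi : C -> C) : meromorphic2 F ->
  (forall z, upper z -> upper (a z) /\ cderivable a z /\ cderivable b (a z) /\ b (a z) = z) ->
  (forall z, upper z -> a (b z) = z) ->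
  (forall z, upper z -> cderivable phi z /\ phi z <> 0%C) ->
  meromorphic2 (fun q => / phi (fst q) * F (a (fst q), snd q))%C.
Proof.
  intros HF Ha Hb Hphi p [Hp1 Hp2].
  destruct (Ha (fst p) Hp1) as (Hap & Hda & Hdb & Hba).
  destruct (HF (a (fst p), snd p) (conj Hap Hp2)) as (A & B & HA & HB & NB & EB).
  set (m := fun q : C * C => (a (fst q), snd q)).
  assert (Hup : near2 p (fun q => upper (fst q))).
  { apply near2_bidisc. exists (Im (fst p)). split; [exact Hp1|]. intros q [H1 _].
    apply Im_near in H1. destruct H1 as [H1 _]. rewrite Rminus_diag in H1. exact H1. }
  assert (Hdm : forall E q, upper (fst q) -> diff2 E (m q) -> diff2 (fun x => E (m x)) q).
  { intros E q Hq HE.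
    apply (diff2_comp_pair E (fun x => a (fst x)) snd); [|apply diff2_snd | exact HE].
    apply diff2_comp; [apply diff2_fst | apply Ha, Hq]. }
  assert (Hm : forall P : C * C -> Prop, near2 (a (fst p), snd p) P -> near2 p (fun q => P (m q))).
  { intros P HP. apply near2_bidisc in HP. destruct HP as [r [Hr HP]].
    destruct (cderivable_continuous a (fst p) Hda r Hr) as [d [Hd H]].
    apply near2_bidisc. exists (Rmin d r). split; [apply Rmin_pos; lra|]. intros q [H1 H2].
    apply HP.
    assert (M1 := Rmin_l d r). assert (M2 := Rmin_r d r). split; simpl; [apply H; lra | lra]. }
  assert (Hcm : forall E, holomorphic2_at E (a (fst p), snd p) ->
    holomorphic2_at (fun q => E (m q)) p).
  { intros E HE. generalize (near2_and _ _ _ Hup (Hm _ HE)). apply near2_imp. intros q [H1 H2].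
    apply Hdm; assumption. }
  exists (fun q => A (m q)), (fun q => phi (fst q) * B (m q))%C.
  split; [apply Hcm, HA|]. split.
  { apply hol2_mult; [|apply Hcm, HB]. revert Hup. apply near2_imp. intros q Hq.
    apply diff2_comp; [apply diff2_fst | apply Hphi, Hq]. }
  split.
  - intros H0. apply NB.
    assert (H1 : near2 p (fun q => B (m q) = 0%C)).
    { generalize (near2_and _ _ _ Hup H0). apply near2_imp. intros q [Hq HE]. apply NNPP.
      intros Hne.
      apply (Cmult_neq_0 _ _ (proj2 (Hphi _ Hq)) Hne HE). }
    apply near2_bidisc in H1. destruct H1 as [r [Hr H1]].
    destruct (cderivable_continuous b (a (fst p)) Hdb r Hr) as [d [Hd H]].
    rewrite Hba in H.
    apply near2_bidisc. exists (Rmin (Rmin d r) (Im (a (fst p)))).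
    split; [repeat apply Rmin_pos; assumption|].
    intros [z t] [H2 H3]. simpl in H2, H3.
    assert (M0 := Rmin_l (Rmin d r) (Im (a (fst p)))).
    assert (M3 := Rmin_r (Rmin d r) (Im (a (fst p)))).
    assert (M1 := Rmin_l d r). assert (M2 := Rmin_r d r).
    assert (Hz : upper z).
    { apply Im_near in H2. unfold upper. lra. }
    specialize (H1 (b z, t)). unfold m in H1. simpl in H1. rewrite (Hb z Hz) in H1. apply H1.
    split; simpl; [apply H; lra | lra].
  - generalize (near2_and _ _ _ Hup (Hm _ EB)). apply near2_imp. intros q [Hq E] Hn.
    assert (Hbq : B (m q) <> 0%C) by (intros X; apply Hn; rewrite X; ring).
    change (a (fst q), snd q) with (m q). rewrite (E Hbq).
    assert (Hp := proj2 (Hphi _ Hq)). field. auto.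
Qed.

(** * Fractional power series in q *)

Definition is_cseries (a : nat -> C) (l : C) : Prop := @is_series C_AbsRing C_NormedModule a l.
Definition csum (a : nat -> C) (n : nat) : C := @sum_n C_AbelianGroup a n.

Lemma csum_S (a : nat -> C) n : csum a (S n) = (csum a n + a (S n))%C.
Proof. exact (sum_Sn a n). Qed.
Lemma csum_0 (a : nat -> C) : csum a 0 = a 0%nat.
Proof. exact (sum_O a). Qed.

Lemma is_cseries_eps (a : nat -> C) (l : C) :
  is_cseries a l <-> forall eps, 0 < eps -> exists N, forall n, (N <= n)%nat ->
    Cmod (csum a n - l) < eps.
Proof.
  split.
  - intros H eps He. destruct (H (fun w => Cmod (w - l) < eps)) as [N HN].
    { apply locally_C_disc. exists eps. split; [exact He | auto]. }
    exists N. exact HN.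
  - intros H P HP. apply locally_C_disc in HP. destruct HP as [d [Hd HP]].
    destruct (H d Hd) as [N HN]. exists N. intros n Hn. apply HP, HN, Hn.
Qed.

(** Inserting zeros between the terms, so that [u j] moves to [a + j M], does not
    change the sum. *)
Lemma cseries_gap (u v : nat -> C) (a M : nat) (l : C) : (0 < M)%nat ->
  (forall j, v (a + j * M)%nat = u j) ->
  (forall i, (forall j, i <> a + j * M)%nat -> v i = 0%C) ->
  (is_cseries u l <-> is_cseries v l).
Proof.
  intros HM Hv Hz.
  assert (HS : forall i, ((i < a)%nat -> csum v i = 0%C) /\ ((a <= i)%nat ->
    csum v i = csum u ((i - a) / M)%nat)).
  { induction i as [|i [IH1 IH2]].
    - rewrite csum_0. split; intros Hi.
      + apply Hz. intros j. lia.
      + replace a with 0%nat in * by lia. simpl. rewrite Nat.Div0.div_0_l, csum_0. apply (Hv 0%nat).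
    - rewrite csum_S. split; intros Hi.
      + rewrite IH1 by lia. rewrite Hz by (intros j; lia). ring.
      + destruct (Nat.eq_dec (S i) a) as [E|E].
        * rewrite IH1 by lia. replace (S i - a)%nat with 0%nat by lia.
          rewrite Nat.Div0.div_0_l, csum_0.
          rewrite <- (Hv 0%nat). replace (a + 0 * M)%nat with (S i) by lia. ring.
        * rewrite IH2 by lia. set (k := (i - a)%nat).
          replace (S i - a)%nat with (S k) by (unfold k; lia).
          assert (D := Nat.div_mod k M ltac:(lia)).
          assert (B := Nat.mod_upper_bound k M ltac:(lia)).
          destruct (Nat.eq_dec (S (k mod M)) M) as [Ek|Ek].
          -- assert (Eq : (S k / M = S (k / M))%nat).
             { symmetry. apply (Nat.div_unique _ _ _ 0); lia. }
             rewrite Eq, csum_S. f_equal. rewrite <- Hv. f_equal. unfold k in *. lia.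
          -- assert (Eq : (S k / M = k / M)%nat).
             { symmetry. apply (Nat.div_unique _ _ _ (S (k mod M))); lia. }
             rewrite Eq, Hz; [ring|]. intros j Hj.
             assert (Hk : (S k = j * M)%nat) by (unfold k; lia).
             assert (j = (S k / M)%nat) by (apply (Nat.div_unique _ _ _ 0); lia).
             subst j. rewrite Eq in Hk. lia. }
  rewrite !is_cseries_eps. split; intros H eps He; destruct (H eps He) as [N HN].
  - exists (a + N * M)%nat. intros n Hn. rewrite (proj2 (HS n)) by lia. apply HN.
    apply Nat.div_le_lower_bound; lia.
  - exists N. intros n Hn. specialize (HN (a + n * M)%nat ltac:(nia)).
    rewrite (proj2 (HS _)) in HN by lia.
    replace ((a + n * M - a) / M)%nat with n in HN; [exact HN|].
    replace (a + n * M - a)%nat with (n * M)%nat by lia. symmetry. apply Nat.div_mul. lia.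
Qed.

Lemma is_cseries_plus (u v : nat -> C) (k l : C) : is_cseries u k -> is_cseries v l ->
  is_cseries (fun n => u n + v n)%C (k + l)%C.
Proof. intros Hu Hv. exact (is_series_plus u v k l Hu Hv). Qed.
Lemma is_cseries_scal (a : C) (u : nat -> C) (l : C) : is_cseries u l ->
  is_cseries (fun n => a * u n)%C (a * l)%C.
Proof. intros Hu. exact (is_series_scal_l a u l Hu). Qed.
Lemma is_cseries_ext (u v : nat -> C) (l : C) : (forall n, u n = v n) -> is_cseries u l ->
  is_cseries v l.
Proof. exact (is_series_ext u v l). Qed.
Lemma is_cseries_unique (u : nat -> C) (k l : C) : is_cseries u k -> is_cseries u l -> k = l.
Proof.
  intros Hk Hl. rewrite is_cseries_eps in *. apply NNPP. intros Hne.
  assert (Hp : 0 < Cmod (k - l)).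
  { apply Cmod_gt_0. intros E. apply Hne. replace k with ((k - l) + l)%C by ring. rewrite E. ring. }
  destruct (Hk (Cmod (k - l) / 2) ltac:(lra)) as [N1 H1].
  destruct (Hl (Cmod (k - l) / 2) ltac:(lra)) as [N2 H2].
  specialize (H1 (N1 + N2)%nat ltac:(lia)). specialize (H2 (N1 + N2)%nat ltac:(lia)).
  set (s := csum u (N1 + N2)%nat) in *.
  assert (T := Cmod_triangle (s - l) (- (s - k))). rewrite Cmod_opp in T.
  replace (s - l + - (s - k))%C with (k - l)%C in T by ring. lra.
Qed.

Lemma is_cseries_bounded (u : nat -> C) (l : C) : is_cseries u l ->
  exists M, 0 < M /\ forall n, Cmod (u n) <= M.
Proof.
  intros H. rewrite is_cseries_eps in H. destruct (H 1 ltac:(lra)) as [N HN].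
  assert (Hfin : forall m, exists M, 0 < M /\ forall n, (n <= m)%nat -> Cmod (u n) <= M).
  { induction m as [|m [M [HM IH]]].
    - exists (Cmod (u 0%nat) + 1). split; [assert (X := Cmod_ge_0 (u 0%nat)); lra|]. intros n Hn.
      replace n with 0%nat by lia. lra.
    - exists (M + Cmod (u (S m))). assert (X := Cmod_ge_0 (u (S m))). split; [lra|]. intros n Hn.
      destruct (Nat.eq_dec n (S m)) as [->|Hne]; [lra|]. specialize (IH n ltac:(lia)). lra. }
  destruct (Hfin N) as [M [HM HB]]. exists (M + 2). split; [lra|]. intros n.
  destruct (Nat.le_gt_cases n N) as [L|L]; [specialize (HB n L); lra|].
  destruct n as [|n]; [lia|].
  assert (H1 := HN n ltac:(lia)). assert (H2 := HN (S n) ltac:(lia)). rewrite csum_S in H2.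
  assert (T := Cmod_triangle (csum u n + u (S n) - l) (- (csum u n - l))). rewrite Cmod_opp in T.
  replace (csum u n + u (S n) - l + - (csum u n - l))%C with (u (S n)) in T by ring. lra.
Qed.

(** The terms with [j > 0] add up to at most [M s / (1 - s)]: let [s] tend to 0. *)
Lemma power_series_zero (b : nat -> C) : (exists M, 0 < M /\ forall n, Cmod (b n) <= M) ->
  (forall s, 0 < s < 1 -> is_cseries (fun j => b j * RtoC (s ^ j))%C 0%C) -> b 0%nat = 0%C.
Proof.
  intros [M [HM HB]] H. apply NNPP. intros Hne. apply Cmod_gt_0 in Hne.
  set (m := Cmod (b 0%nat)) in *.
  set (s := Rmin (1/2) (m / (8 * M))).
  assert (Hs0 : 0 < s) by (apply Rmin_pos; [lra|]; apply Rdiv_lt_0_compat; lra).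
  assert (Hs1 : s <= 1/2) by apply Rmin_l.
  assert (Hs2 : M * s <= m / 8).
  { assert (X : s <= m / (8 * M)) by apply Rmin_r. apply (Rmult_le_compat_l M) in X; [|lra].
    replace (M * (m / (8 * M))) with (m / 8) in X by (field; lra). exact X. }
  assert (HP : forall n, Cmod (csum (fun j => b j * RtoC (s ^ j))%C n - b 0%nat) <= 2 * M * (s - s
    ^ (S n))).
  { induction n as [|n IH].
    - rewrite csum_0. simpl. replace (b 0%nat * 1 - b 0%nat)%C with (RtoC 0) by ring.
      rewrite Cmod_0.
      replace (s - s * 1) with 0 by ring. lra.
    - rewrite csum_S.
      replace (csum (fun j => b j * RtoC (s ^ j))%C n + b (S n) * RtoC (s ^ S n) - b 0%nat)%C with
       ((csum (fun j => b j * RtoC (s ^ j))%C n - b 0%nat) + b (S n) * RtoC (s ^ S n))%C by ring.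
      eapply Rle_trans; [apply Cmod_triangle|]. rewrite Cmod_mult, Cmod_R.
      assert (Hp := pow_lt s (S n) Hs0). rewrite (Rabs_right (s ^ S n)) by lra.
      specialize (HB (S n)).
      replace (s ^ S (S n)) with (s * s ^ S n) by reflexivity.
      set (p := s ^ S n) in *.
      assert (Cmod (b (S n)) * p <= M * p) by (apply Rmult_le_compat_r; lra).
      assert (s * p <= 1/2 * p) by (apply Rmult_le_compat_r; lra). nra. }
  specialize (H s ltac:(lra)). rewrite is_cseries_eps in H.
  destruct (H (m / 4) ltac:(lra)) as [N HN]. specialize (HN N (Nat.le_refl _)). specialize (HP N).
  set (S0 := csum (fun j => b j * RtoC (s ^ j))%C N) in *.
  assert (Hp := pow_lt s (S N) Hs0).
  assert (T := Cmod_triangle (S0 - 0) (- (S0 - b 0%nat))). rewrite Cmod_opp in T.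
  replace (S0 - 0 + - (S0 - b 0%nat))%C with (b 0%nat) in T by ring. fold m in T.
  assert (2 * M * (s - s ^ S N) <= 2 * (M * s)) by nra. lra.
Qed.

Definition e1 (x : R) : C := cexp (RtoC (2 * PI * x) * Ci).
Lemma e1_plus x y : e1 (x + y) = (e1 x * e1 y)%C.
Proof. unfold e1. rewrite <- cexp_plus. f_equal. rewrite !RtoC_mult, RtoC_plus. ring. Qed.
Lemma e1_0 : e1 0 = 1%C.
Proof. unfold e1. rewrite Rmult_0_r. replace (RtoC 0 * Ci)%C with (RtoC 0) by ring. apply cexp_0.
Qed.

Lemma e1_neq_0 x : e1 x <> 0%C.
Proof. apply cexp_neq_0. Qed.
Lemma e1_cos_sin x : e1 x = (cos (2 * PI * x), sin (2 * PI * x)).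
Proof.
  unfold e1, cexp. replace (RtoC (2 * PI * x) * Ci)%C with ((0, 2 * PI * x) : C).
  - simpl. rewrite exp_0. f_equal; ring.
  - unfold RtoC, Ci, Cmult; simpl. f_equal; ring.
Qed.

Lemma e1_opp x : e1 (- x) = (/ e1 x)%C.
Proof.
  assert (H : (e1 (- x) * e1 x = 1)%C) by (rewrite <- e1_plus, Rplus_opp_l; apply e1_0).
  replace (e1 (- x)) with (e1 (- x) * e1 x * / e1 x)%C by (field; apply e1_neq_0). rewrite H. ring.
Qed.

Lemma e1_nat n : e1 (INR n) = 1%C.
Proof.
  induction n as [|n IH]; [apply e1_0|].
  rewrite S_INR, e1_plus, IH, e1_cos_sin, Rmult_1_r, cos_2PI, sin_2PI.
  unfold RtoC, Cmult; simpl. f_equal; ring.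
Qed.

Lemma e1_int n : e1 (IZR n) = 1%C.
Proof.
  destruct (Z_le_gt_dec 0 n) as [H|H].
  - rewrite <- (Z2Nat.id n H), <- INR_IZR_INZ. apply e1_nat.
  - replace n with (- (- n))%Z by lia. rewrite opp_IZR, e1_opp, <- (Z2Nat.id (- n)) by lia.
    rewrite <- INR_IZR_INZ, e1_nat. field.
Qed.

Lemma e1_pow x n : Cpow (e1 x) n = e1 (INR n * x).
Proof.
  induction n as [|n IH].
  - simpl. rewrite Rmult_0_l, e1_0. reflexivity.
  - rewrite S_INR. simpl. rewrite IH, <- e1_plus. f_equal. ring.
Qed.

Lemma qpow_neq_0 r z : qpow r z <> 0%C.
Proof. apply cexp_neq_0. Qed.
Lemma qpow_affine r (al be : R) z : qpow r (RtoC al * z + RtoC be) =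
  (e1 (r * be)%R * qpow (al * r)%R z)%C.
Proof.
  unfold qpow, e1. rewrite <- cexp_plus. f_equal. rewrite !RtoC_mult. ring.
Qed.

(** The exponents [(n0 + j) / N] form the grid of denominator [N] starting at
    [n0 / N]. *)
Definition gterm (c : R -> C) (z : C) (N : nat) (n0 : Z) (j : nat) : C :=
  let r := (IZR n0 + INR j) / INR N in (c r * qpow r z)%C.
Definition on_grid (c : R -> C) (N : nat) (n0 : Z) : Prop :=
  (0 < N)%nat /\ forall r, c r <> 0%C -> exists j : nat, r = (IZR n0 + INR j) / INR N.

Lemma is_qsum_alt c z l : is_qsum c z l <-> exists N n0, on_grid c N n0 /\
  is_cseries (gterm c z N n0) l.
Proof.
  split.
  - intros (N & n0 & HN & Hs & H). exists N, n0. split; [split; assumption | exact H].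
  - intros (N & n0 & [HN Hs] & H). exists N, n0. split; [exact HN|]. split; [exact Hs | exact H].
Qed.

Lemma INR_gt_0 n : (0 < n)%nat -> 0 < INR n.
Proof. intros H. apply lt_0_INR. exact H. Qed.

Lemma refine_point (N M a j : nat) (n0 : Z) : (0 < N)%nat -> (0 < M)%nat ->
  (IZR (n0 * Z.of_nat M - Z.of_nat a) + INR (a + j * M)) / INR (N * M) = (IZR n0 + INR j) / INR N.
Proof.
  intros HN HM. apply INR_gt_0 in HN. apply INR_gt_0 in HM.
  rewrite minus_IZR, mult_IZR, <- !INR_IZR_INZ, plus_INR, !mult_INR. field. lra.
Qed.

(** [is_qsum] leaves the grid free; refining the grid and extending it to the
    left only inserts zeros, so any two grids can be replaced by a common one. *)
Lemma grid_refine c N n0 M a : on_grid c N n0 -> (0 < M)%nat ->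
  on_grid c (N * M) (n0 * Z.of_nat M - Z.of_nat a) /\
  forall z l, is_cseries (gterm c z N n0) l <-> is_cseries (gterm c z (N * M)
    (n0 * Z.of_nat M - Z.of_nat a)) l.
Proof.
  intros [HN Hs] HM. split.
  - split; [nia|]. intros r Hr. destruct (Hs r Hr) as [j ->]. exists (a + j * M)%nat. symmetry.
    apply refine_point; assumption.
  - intros z l. apply (cseries_gap _ _ a M).
    + exact HM.
    + intros j. unfold gterm; cbv beta zeta. rewrite refine_point by assumption. reflexivity.
    + intros i Hi. unfold gterm; cbv beta zeta.
      destruct (classic (c ((IZR (n0 * Z.of_nat M - Z.of_nat a) + INR i) / INR (N * M)) =
        0%C)) as [->|Hn]; [ring|].
      exfalso. destruct (Hs _ Hn) as [j Hj]. apply (Hi j).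
      rewrite <- (refine_point N M a j n0) in Hj by assumption.
      assert (X : 0 < INR (N * M)) by (apply INR_gt_0; nia).
      apply Rdiv_eq_reg_r in Hj; [|lra].
      apply INR_eq. lra.
Qed.

Lemma common_grid c1 N1 n1 c2 N2 n2 : on_grid c1 N1 n1 -> on_grid c2 N2 n2 ->
  exists N n, on_grid c1 N n /\ on_grid c2 N n /\
    (forall z l, is_cseries (gterm c1 z N1 n1) l <-> is_cseries (gterm c1 z N n) l) /\
    (forall z l, is_cseries (gterm c2 z N2 n2) l <-> is_cseries (gterm c2 z N n) l).
Proof.
  intros H1 H2. set (m := Z.min (n1 * Z.of_nat N2) (n2 * Z.of_nat N1)).
  exists (N1 * N2)%nat, m.
  destruct (grid_refine c1 N1 n1 N2 (Z.to_nat (n1 * Z.of_nat N2 - m)) H1 (proj1 H2)) as [A1 B1].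
  destruct (grid_refine c2 N2 n2 N1 (Z.to_nat (n2 * Z.of_nat N1 - m)) H2 (proj1 H1)) as [A2 B2].
  replace (n1 * Z.of_nat N2 - Z.of_nat (Z.to_nat (n1 * Z.of_nat N2 - m)))%Z with m in * by lia.
  replace (n2 * Z.of_nat N1 - Z.of_nat (Z.to_nat (n2 * Z.of_nat N1 - m)))%Z with m in * by lia.
  rewrite (Nat.mul_comm N2 N1) in *. auto.
Qed.

Lemma qsum_grid c z l N n0 : on_grid c N n0 -> is_qsum c z l -> is_cseries (gterm c z N n0) l.
Proof.
  intros Hg H. apply is_qsum_alt in H. destruct H as (N1 & n1 & Hg1 & H).
  destruct (common_grid c N n0 c N1 n1 Hg Hg1) as (N2 & n2 & _ & _ & E1 & E2).
  apply E1, E2, H.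
Qed.

Lemma qsum_unique c z k l : is_qsum c z k -> is_qsum c z l -> k = l.
Proof.
  intros H1 H2. assert (H := H1). apply is_qsum_alt in H. destruct H as (N & n & Hg & _).
  apply (is_cseries_unique (gterm c z N n)); apply qsum_grid; assumption.
Qed.

Lemma qsum_ext c c' z l : (forall r, c r = c' r) -> is_qsum c z l -> is_qsum c' z l.
Proof.
  intros E H. apply is_qsum_alt in H. destruct H as (N & n & [HN Hs] & H). apply is_qsum_alt.
  exists N, n.
  split.
  - split; [exact HN|]. intros r Hr. apply Hs. rewrite E. exact Hr.
  - revert H. apply is_cseries_ext. intros j. unfold gterm; cbv beta zeta. rewrite E. reflexivity.
Qed.

Lemma qsum_plus c1 c2 z l1 l2 : is_qsum c1 z l1 -> is_qsum c2 z l2 ->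
  is_qsum (fun r => c1 r + c2 r)%C z (l1 + l2)%C.
Proof.
  intros H1 H2. apply is_qsum_alt in H1. apply is_qsum_alt in H2.
  destruct H1 as (N1 & n1 & Hg1 & H1), H2 as (N2 & n2 & Hg2 & H2).
  destruct (common_grid _ _ _ _ _ _ Hg1 Hg2) as (N & n & Ha & Hb & E1 & E2).
  apply E1 in H1. apply E2 in H2. apply is_qsum_alt. exists N, n. split.
  - split; [apply Ha|]. intros r Hr. destruct (classic (c1 r = 0%C)) as [E|E].
    + apply Hb. intros E'. apply Hr. rewrite E, E'. ring.
    + apply Ha, E.
  - generalize (is_cseries_plus _ _ _ _ H1 H2). apply is_cseries_ext. intros j.
    unfold gterm; cbv beta zeta. ring.
Qed.

Lemma qsum_scal a c z l : is_qsum c z l -> is_qsum (fun r => a * c r)%C z (a * l)%C.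
Proof.
  intros H. apply is_qsum_alt in H. destruct H as (N & n & [HN Hs] & H). apply is_qsum_alt.
  exists N, n. split.
  - split; [exact HN|]. intros r Hr. apply Hs. intros E. apply Hr. rewrite E. ring.
  - generalize (is_cseries_scal a _ _ H). apply is_cseries_ext. intros j.
    unfold gterm; cbv beta zeta. ring.
Qed.

Lemma qsum_zero z : is_qsum (fun _ => 0%C) z 0%C.
Proof.
  apply is_qsum_alt. exists 1%nat, 0%Z. split.
  - split; [lia|]. intros r Hr. exfalso. apply Hr. reflexivity.
  - apply is_cseries_eps. intros eps He. exists 0%nat. intros n _.
    assert (E : csum (gterm (fun _ => 0%C) z 1 0) n = 0%C).
    { induction n as [|n IH]; [rewrite csum_0 | rewrite csum_S, IH]; unfold gterm; ring. }
    rewrite E. replace (0 - 0)%C with (RtoC 0) by ring. rewrite Cmod_0. exact He.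
Qed.

(** Substituting [al z + be] with [al = p / q] maps the grid of denominator [N]
    into that of denominator [N q]. *)
Lemma qsum_affine c z l (al be : R) (p q : nat) : (0 < p)%nat -> (0 < q)%nat ->
  al = INR p / INR q ->
  is_qsum c (RtoC al * z + RtoC be)%C l ->
    is_qsum (fun r => c (r / al)%R * e1 (r / al * be)%R)%C z l.
Proof.
  intros Hp Hq Hal H. apply is_qsum_alt in H. destruct H as (N & n & [HN Hs] & H).
  apply is_qsum_alt.
  assert (Hp' := INR_gt_0 p Hp). assert (Hq' := INR_gt_0 q Hq). assert (HN' := INR_gt_0 N HN).
  assert (Hal0 : al <> 0) by (rewrite Hal; apply Rgt_not_eq; apply Rdiv_lt_0_compat; lra).
  assert (Hpt : forall j, (IZR (n * Z.of_nat p) + INR (0 + j * p)) / INR (N * q) =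
    al * ((IZR n + INR j) / INR N)).
  { intros j. rewrite Hal, mult_IZR, <- INR_IZR_INZ, plus_INR, !mult_INR. simpl (INR 0). field.
    lra. }
  exists (N * q)%nat, (n * Z.of_nat p)%Z.
  assert (Hs' : forall r, (c (r / al)%R * e1 (r / al * be)%R)%C <> 0%C ->
    exists j, r = al * ((IZR n + INR j) / INR N)).
  { intros r Hr. destruct (Hs (r / al)) as [j Hj].
    - intros E. apply Hr. rewrite E. ring.
    - exists j. rewrite <- Hj. field. exact Hal0. }
  split.
  - split; [nia|]. intros r Hr. destruct (Hs' r Hr) as [j ->]. exists (0 + j * p)%nat. symmetry.
    apply Hpt.
  - revert H.
    apply (cseries_gap (gterm c (RtoC al * z + RtoC be)%C N n)
      (gterm (fun r => c (r / al)%R * e1 (r / al * be)%R)%C z (N * q) (n * Z.of_nat p)) 0 p _ Hp).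
    + intros j. unfold gterm; cbv beta zeta. rewrite Hpt, qpow_affine.
      replace (al * ((IZR n + INR j) / INR N) / al) with ((IZR n + INR j) / INR N) by (field; lra).
      ring.
    + intros i Hi. unfold gterm; cbv beta zeta.
      match goal with |- (?x * _)%C = _ => destruct (classic (x = 0%C)) as [->|Hn]; [ring|] end.
      exfalso. destruct (Hs' _ Hn) as [j Hj]. apply (Hi j). rewrite <- Hpt in Hj.
      assert (X : 0 < INR (N * q)) by (apply INR_gt_0; nia).
      apply Rdiv_eq_reg_r in Hj; [|lra].
      apply INR_eq. lra.
Qed.

Lemma has_qexp_ext f g c : (forall z, upper z -> f z = g z) -> has_qexp f c -> has_qexp g c.
Proof. intros E H z Hz. rewrite <- E by exact Hz. apply H, Hz. Qed.
Lemma has_qexp_plus f g c d : has_qexp f c -> has_qexp g d ->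
  has_qexp (fun z => f z + g z)%C (fun r => c r + d r)%C.
Proof. intros Hf Hg z Hz. apply qsum_plus; auto. Qed.
Lemma has_qexp_scal a f c : has_qexp f c -> has_qexp (fun z => a * f z)%C (fun r => a * c r)%C.
Proof. intros Hf z Hz. apply qsum_scal; auto. Qed.

Lemma upper_affine (al be : R) z : 0 < al -> upper z -> upper (RtoC al * z + RtoC be)%C.
Proof. intros Ha Hz. destruct z as [x y]. unfold upper, Im, RtoC, Cplus, Cmult in *; simpl in *.
nra. Qed.

Lemma has_qexp_affine f c (al be : R) (p q : nat) : (0 < p)%nat -> (0 < q)%nat ->
  al = INR p / INR q ->
  has_qexp f c -> has_qexp (fun z => f (RtoC al * z + RtoC be)%C)
    (fun r => c (r / al)%R * e1 (r / al * be)%R)%C.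
Proof.
  intros Hp Hq Hal Hf z Hz. apply (qsum_affine c z _ al be p q Hp Hq Hal). apply Hf.
  apply upper_affine; [|exact Hz]. rewrite Hal. apply Rdiv_lt_0_compat; apply INR_gt_0; assumption.
Qed.

Lemma qpow_imag r T : qpow r (0, T) = RtoC (exp (- (2 * PI * r * T))%R).
Proof.
  unfold qpow. replace (RtoC (2 * PI * r) * Ci * (0, T))%C with (RtoC (- (2 * PI * r * T))%R).
  - unfold cexp, RtoC; simpl. rewrite cos_0, sin_0. f_equal; ring.
  - unfold RtoC, Ci, Cmult; simpl. f_equal; ring.
Qed.

(** On the imaginary axis, divided by [q^x], the expansion is a power series in a
    parameter that tends to 0. *)
Lemma leading_coefficient_zero f c x : has_qexp f c -> (forall z, upper z -> f z = 0%C) ->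
  (forall r, r < x -> c r = 0%C) -> c x = 0%C.
Proof.
  intros Hf Hz Hx. apply NNPP. intros Hne.
  assert (Hi : upper (0, 1)) by (unfold upper; simpl; lra).
  assert (H0 := Hf _ Hi). apply is_qsum_alt in H0. destruct H0 as (N & n0 & [HN Hs] & _).
  assert (HN' := INR_gt_0 N HN).
  destruct (Hs x Hne) as [j0 Hj0].
  assert (Hg : on_grid c N (n0 + Z.of_nat j0)).
  { split; [exact HN|]. intros r Hr. destruct (Hs r Hr) as [j Hj].
    assert (Hrx : x <= r) by (apply Rnot_lt_le; intros Hl; apply Hr, Hx, Hl).
    assert (Hjj : (j0 <= j)%nat).
    { apply INR_le. rewrite Hj, Hj0 in Hrx.
      apply Rmult_le_reg_r in Hrx; [lra | apply Rinv_0_lt_compat, HN']. }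
    exists (j - j0)%nat. rewrite plus_IZR, <- INR_IZR_INZ, minus_INR by exact Hjj. rewrite Hj.
    f_equal. ring. }
  assert (Hex : forall j, (IZR (n0 + Z.of_nat j0) + INR j) / INR N = x + INR j / INR N).
  { intros j. rewrite plus_IZR, <- INR_IZR_INZ, Hj0. field. lra. }
  set (b := gterm c (0, 1) N (n0 + Z.of_nat j0)).
  assert (Hb0 : b 0%nat = (c x * qpow x (0, 1%R))%C).
  { unfold b, gterm. rewrite Hex. simpl (INR 0). replace (x + 0 / INR N) with x by (field; lra).
    reflexivity. }
  assert (E : b 0%nat = 0%C).
  { apply power_series_zero.
    - apply (is_cseries_bounded b (f (0, 1))). apply qsum_grid; auto.
    - intros s Hs'.
      (* s = exp (- 2 pi T / N) *)
      set (T := - (ln s * INR N / (2 * PI))).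
      assert (P := PI_RGT_0).
      assert (HT : 0 < T).
      { unfold T. assert (ln s < 0) by (rewrite <- ln_1; apply ln_increasing; lra).
        assert (0 < - ln s * INR N / (2 * PI)); [|unfold Rdiv in *; lra].
        apply Rdiv_lt_0_compat; [|lra].
        apply Rmult_lt_0_compat; lra. }
      assert (Hu : upper (0, 1 + T)) by (unfold upper; simpl; lra).
      assert (Q := qsum_grid _ _ _ _ _ Hg (Hf _ Hu)). rewrite (Hz _ Hu) in Q.
      assert (Q' := is_cseries_scal (RtoC (exp (2 * PI * x * T))) _ _ Q).
      replace (RtoC (exp (2 * PI * x * T))%R * 0)%C with (RtoC 0) in Q' by ring.
      revert Q'. apply is_cseries_ext. intros j. unfold b, gterm. rewrite Hex.
      set (r := x + INR j / INR N). rewrite !qpow_imag.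
      replace (s ^ j) with (exp (2 * PI * x * T) * exp (- (2 * PI * r * T))).
      { replace (- (2 * PI * r * (1 + T))) with (- (2 * PI * r * 1) + - (2 * PI * r * T)) by ring.
        rewrite exp_plus, !RtoC_mult. ring. }
      rewrite <- exp_plus. rewrite <- (exp_ln s) at 1 by lra.
      rewrite <- Rpower_pow by apply exp_pos. unfold Rpower. rewrite ln_exp. f_equal.
      unfold r, T. field. lra. }
  rewrite Hb0 in E. apply (Cmult_neq_0 _ _ Hne (qpow_neq_0 x (0, 1)) E).
Qed.

(** * Automorphy factors *)
Lemma mdet_mmul g h : mdet (mmul g h) = mdet g * mdet h.
Proof. destruct g, h. unfold mdet, mmul; simpl. ring. Qed.
Lemma minv_det1 g : mdet g = 1 -> minv g = Mat2 (md g) (- mb g) (- mc g) (ma g).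
Proof. intros H. unfold minv. rewrite H. f_equal; field. Qed.
Lemma mdet_minv g : mdet g = 1 -> mdet (minv g) = 1.
Proof. intros H. rewrite minv_det1 by exact H. rewrite <- H. destruct g. unfold mdet; simpl. ring.
Qed.

Lemma mdet_mopp g : mdet (mopp g) = mdet g.
Proof. destruct g. unfold mdet, mopp; simpl. ring. Qed.
Lemma mdet_mone : mdet mone = 1.
Proof. unfold mdet, mone; simpl. ring. Qed.
Lemma mmul_assoc g h k : mmul (mmul g h) k = mmul g (mmul h k).
Proof. destruct g, h, k. unfold mmul; simpl. f_equal; ring. Qed.
Lemma mmul_1_l g : mmul mone g = g.
Proof. destruct g. unfold mmul, mone; simpl. f_equal; ring. Qed.
Lemma mmul_1_r g : mmul g mone = g.
Proof. destruct g. unfold mmul, mone; simpl. f_equal; ring. Qed.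
Lemma mmul_minv_r g : mdet g = 1 -> mmul g (minv g) = mone.
Proof. intros H. rewrite minv_det1 by exact H. destruct g. unfold mdet in H.
unfold mmul, mone; simpl in *. f_equal; lra. Qed.
Lemma mmul_minv_l g : mdet g = 1 -> mmul (minv g) g = mone.
Proof. intros H. rewrite minv_det1 by exact H. destruct g. unfold mdet in H.
unfold mmul, mone; simpl in *. f_equal; lra. Qed.
Lemma mmul_mopp_l g h : mmul (mopp g) h = mopp (mmul g h).
Proof. destruct g, h. unfold mmul, mopp; simpl. f_equal; ring. Qed.
Lemma mmul_mopp_r g h : mmul g (mopp h) = mopp (mmul g h).
Proof. destruct g, h. unfold mmul, mopp; simpl. f_equal; ring. Qed.
Lemma mopp_mopp g : mopp (mopp g) = g.
Proof. destruct g. unfold mopp; simpl. f_equal; ring. Qed.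
Lemma minv_unique g h : mdet g = 1 -> mmul g h = mone -> h = minv g.
Proof.
  intros Hg H. rewrite <- (mmul_1_l h), <- (mmul_minv_l g Hg), mmul_assoc, H, mmul_1_r. reflexivity.
Qed.

Lemma minv_minv g : mdet g = 1 -> minv (minv g) = g.
Proof. intros H. symmetry. apply minv_unique; [apply mdet_minv, H | apply mmul_minv_l, H]. Qed.
Lemma minv_mmul g h : mdet g = 1 -> mdet h = 1 -> minv (mmul g h) = mmul (minv h) (minv g).
Proof.
  intros Hg Hh. symmetry. apply minv_unique; [rewrite mdet_mmul, Hg, Hh; ring|].
  rewrite mmul_assoc, <- (mmul_assoc h), mmul_minv_r, mmul_1_l by exact Hh. apply mmul_minv_r, Hg.
Qed.

Lemma mmul_minvK g h : mdet h = 1 -> mmul (mmul g h) (minv h) = g.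
Proof. intros H. rewrite mmul_assoc, mmul_minv_r, mmul_1_r by exact H. reflexivity. Qed.
Lemma mmul_minvK' g h : mdet h = 1 -> mmul (mmul g (minv h)) h = g.
Proof. intros H. rewrite mmul_assoc, mmul_minv_l, mmul_1_r by exact H. reflexivity. Qed.

Definition denom (g : mat2) (z : C) : C := (RtoC (mc g) * z + RtoC (md g))%C.

Lemma denom_neq_0 g z : mdet g = 1 -> upper z -> denom g z <> 0%C.
Proof.
  intros Hg Hz E. destruct g as [a b c d], z as [x y].
  unfold denom, mdet, upper, Im, RtoC, Cplus, Cmult in *. simpl in *.
  injection E. intros E1 E2. assert (c * y = 0) by lra.
  assert (c = 0) by (apply Rmult_integral in H; destruct H; lra). subst c.
  assert (d = 0) by lra. subst d. lra.
Qed.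

Lemma mobius_Im g z : mdet g = 1 -> upper z -> Im (mobius g z) = Im z / Cmod (denom g z) ^ 2.
Proof.
  intros Hg Hz. assert (Hd := denom_neq_0 g z Hg Hz).
  rewrite Cmod2_alt.
  assert (Hp : Re (denom g z) ^ 2 + Im (denom g z) ^ 2 <> 0).
  { rewrite <- Cmod2_alt. apply pow_nonzero. intros E. apply Hd, Cmod_eq_0, E. }
  destruct g as [a b c d], z as [x y].
  unfold mobius, denom, mdet, Re, Im, RtoC, Cdiv, Cinv, Cplus, Cmult in *. simpl in *.
  match goal with |- ?L = y / ?D => transitivity ((a * d - b * c) * y / D) end.
  2: rewrite Hg, Rmult_1_l; reflexivity.
  field. intros E. apply Hp. eapply eq_trans; [|exact E]. ring.
Qed.

Lemma mobius_upper g z : mdet g = 1 -> upper z -> upper (mobius g z).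
Proof.
  intros Hg Hz. unfold upper. rewrite mobius_Im by assumption. apply Rdiv_lt_0_compat; [exact Hz|].
  apply pow_lt. apply Cmod_gt_0, denom_neq_0; assumption.
Qed.

Lemma denom_mmul g h z : mdet h = 1 -> upper z ->
  denom (mmul g h) z = (denom g (mobius h z) * denom h z)%C.
Proof.
  intros Hh Hz. assert (Hd := denom_neq_0 h z Hh Hz). unfold mobius. fold (denom h z).
  unfold denom at 2.
  replace (RtoC (mc g) * ((RtoC (ma h) * z + RtoC (mb h)) / denom h z) + RtoC (md g))%C
   with ((RtoC (mc g) * (RtoC (ma h) * z + RtoC (mb h)) + RtoC (md g) * denom h z) / denom h z)%C
     by (field; exact Hd).
  replace ((RtoC (mc g) * (RtoC (ma h) * z + RtoC (mb h)) + RtoC (md g) * denom h z) / denom h z *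
    denom h z)%C
    with (RtoC (mc g) * (RtoC (ma h) * z + RtoC (mb h)) + RtoC (md g) * denom h z)%C by (field;
      exact Hd).
  unfold denom, mmul; simpl. rewrite !RtoC_plus, !RtoC_mult. ring.
Qed.

Lemma mobius_mmul g h z : mdet g = 1 -> mdet h = 1 -> upper z ->
  mobius (mmul g h) z = mobius g (mobius h z).
Proof.
  intros Hg Hh Hz. assert (Hd := denom_neq_0 h z Hh Hz).
  assert (Hd2 := denom_neq_0 g _ Hg (mobius_upper h z Hh Hz)).
  unfold mobius at 1. fold (denom (mmul g h) z). rewrite denom_mmul by assumption.
  unfold mobius at 2. fold (denom g (mobius h z)).
  replace (RtoC (ma (mmul g h)) * z + RtoC (mb (mmul g h)))%C
   with ((RtoC (ma g) * mobius h z + RtoC (mb g)) * denom h z)%C; [field; auto|].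
  unfold mobius. fold (denom h z).
  replace ((RtoC (ma g) * ((RtoC (ma h) * z + RtoC (mb h)) / denom h z) + RtoC (mb g)) * denom h
    z)%C
   with (RtoC (ma g) * (RtoC (ma h) * z + RtoC (mb h)) + RtoC (mb g) * denom h z)%C by (field;
     exact Hd).
  unfold denom, mmul; simpl. rewrite !RtoC_plus, !RtoC_mult. ring.
Qed.

Lemma mobius_mone z : mobius mone z = z.
Proof. unfold mobius, mone; simpl. field. Qed.
Lemma mobius_mopp g z : mdet g = 1 -> upper z -> mobius (mopp g) z = mobius g z.
Proof.
  intros Hg Hz. assert (Hd := denom_neq_0 g z Hg Hz). unfold denom in Hd.
  unfold mobius, mopp; simpl.
  rewrite !RtoC_opp. field. split; [exact Hd|]. intros E. apply Hd.
  replace (RtoC (mc g) * z + RtoC (md g))%C with (- (- RtoC (mc g) * z + - RtoC (md g)))%C by ring.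
  rewrite E. ring.
Qed.

Lemma mobius_minv_l g z : mdet g = 1 -> upper z -> mobius (minv g) (mobius g z) = z.
Proof.
  intros Hg Hz. rewrite <- mobius_mmul by (auto using mdet_minv). rewrite mmul_minv_l by exact Hg.
  apply mobius_mone.
Qed.

Lemma mobius_minv_r g z : mdet g = 1 -> upper z -> mobius g (mobius (minv g) z) = z.
Proof.
  intros Hg Hz. rewrite <- mobius_mmul by (auto using mdet_minv). rewrite mmul_minv_r by exact Hg.
  apply mobius_mone.
Qed.

Lemma cderivable_mobius g z : mdet g = 1 -> upper z -> cderivable (mobius g) z.
Proof.
  intros Hg Hz. apply (cderivable_div (fun w => RtoC (ma g) * w + RtoC (mb g))%C (denom g)).
  - apply cderivable_affine. - apply cderivable_affine. - apply denom_neq_0; assumption.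
Qed.

Lemma jfac_det1 g z : mdet g = 1 -> jfac g z = denom g z.
Proof. intros H. unfold jfac, denom. rewrite H, sqrt_1, Rinv_1. ring. Qed.

Lemma csqrt_sqr z : (csqrt z * csqrt z = z)%C.
Proof.
  assert (Hr := re_le_Cmod z). assert (Hp := Rle_abs (Re z)). assert (Hm := Rle_abs (- Re z)).
  rewrite Rabs_Ropp in Hm.
  assert (H2 := Cmod2_alt z).
  assert (S1 : sqrt ((Cmod z + Re z) / 2) * sqrt ((Cmod z + Re z) / 2) =
    (Cmod z + Re z) / 2) by (apply sqrt_sqrt; lra).
  assert (S2 : sqrt ((Cmod z - Re z) / 2) * sqrt ((Cmod z - Re z) / 2) =
    (Cmod z - Re z) / 2) by (apply sqrt_sqrt; lra).
  assert (S3 : sqrt ((Cmod z + Re z) / 2) * sqrt ((Cmod z - Re z) / 2) = Rabs (Im z) / 2).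
  { rewrite <- sqrt_mult by lra.
    replace ((Cmod z + Re z) / 2 * ((Cmod z - Re z) / 2)) with ((Im z / 2)²).
    - rewrite sqrt_Rsqr_abs. unfold Rdiv. rewrite Rabs_mult, (Rabs_right (/ 2)) by lra. reflexivity.
    - unfold Rsqr. nra. }
  unfold csqrt. set (A := sqrt ((Cmod z + Re z) / 2)) in *.
  set (B := sqrt ((Cmod z - Re z) / 2)) in *.
  destruct z as [x y]. unfold Cmult, Re, Im in *; simpl in *.
  destruct (Rle_dec 0 y) as [H|H].
  - rewrite Rabs_right in S3 by lra. f_equal; nra.
  - rewrite Rabs_left in S3 by lra. f_equal; nra.
Qed.

Lemma csqrt_1 : csqrt 1 = 1%C.
Proof.
  unfold csqrt. rewrite Cmod_1. simpl. replace ((1 + 1) / 2) with 1 by field.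
  replace ((1 - 1) / 2) with 0 by field.
  rewrite sqrt_1, sqrt_0. unfold RtoC. f_equal. ring.
Qed.

Lemma csqrt_neq_0 (z : C) : z <> 0%C -> csqrt z <> 0%C.
Proof. intros H E. apply H. rewrite <- (csqrt_sqr z), E. ring. Qed.

Lemma Cinv_neq_0 (z : C) : z <> 0%C -> (/ z)%C <> 0%C.
Proof. intros H. apply Cmod_gt_0. rewrite Cmod_inv by exact H.
apply Rinv_0_lt_compat, Cmod_gt_0, H. Qed.
Lemma Czpow_neq_0 (z : C) n : z <> 0%C -> Czpow z n <> 0%C.
Proof.
  intros H. destruct n; simpl.
  - apply C1_nz. - apply Cpow_nz, H. - apply Cinv_neq_0, Cpow_nz, H.
Qed.

Lemma Czpow_mult (a b : C) n : a <> 0%C -> b <> 0%C -> Czpow (a * b) n = (Czpow a n * Czpow b n)%C.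
Proof.
  intros Ha Hb. destruct n; unfold Czpow.
  - ring.
  - apply Cpow_mult_l.
  - rewrite Cpow_mult_l. field. split; apply Cpow_nz; assumption.
Qed.

Lemma Czpow_succ (z : C) n : z <> 0%C -> Czpow z (Z.succ n) = (z * Czpow z n)%C.
Proof.
  intros H. destruct (Z_le_gt_dec 0 n) as [Hn|Hn].
  - rewrite <- (Z2Nat.id n Hn). generalize (Z.to_nat n). intros m.
    assert (E : forall k, Czpow z (Z.of_nat k) = Cpow z k).
    { intros [|k]; [reflexivity|]. simpl. rewrite SuccNat2Pos.id_succ. reflexivity. }
    rewrite <- Nat2Z.inj_succ, !E. reflexivity.
  - assert (E : forall k, Czpow z (- Z.of_nat k) = (/ Cpow z k)%C).
    { intros [|k]; [simpl; field|]. simpl. rewrite SuccNat2Pos.id_succ. reflexivity. }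
    replace n with (- Z.of_nat (S (Z.to_nat (- n - 1))))%Z by lia.
    replace (Z.succ (- Z.of_nat (S (Z.to_nat (- n - 1)))))%Z with (- Z.of_nat (Z.to_nat (- n
      - 1)))%Z by lia.
    rewrite !E. simpl. field. split; [apply Cpow_nz|]; exact H.
Qed.

Lemma Czpow_opp (z : C) n : z <> 0%C -> Czpow z (- n) = (/ Czpow z n)%C.
Proof.
  intros H. destruct n; simpl; [field | reflexivity | field; apply Cpow_nz, H].
Qed.

Lemma Czpow_1 n : Czpow 1 n = 1%C.
Proof.
  assert (E1 : forall n, Cpow (RtoC 1) n = RtoC 1) by (intros m; rewrite <- RtoC_pow,
    pow1; reflexivity).
  destruct n; simpl; rewrite ?E1; field.
Qed.

Lemma Cmod_Czpow (z : C) n : z <> 0%C -> Cmod (Czpow z n) = powerRZ (Cmod z) n.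
Proof.
  intros H. destruct n; simpl.
  - apply Cmod_1. - apply Cmod_pow. - rewrite Cmod_inv by (apply Cpow_nz, H). rewrite Cmod_pow.
    reflexivity.
Qed.

Lemma jpow_sqr K g z : mdet g = 1 -> upper z -> (jpow K g z * jpow K g z)%C = Czpow (denom g z) K.
Proof.
  intros Hg Hz. unfold jpow. assert (Hd := denom_neq_0 g z Hg Hz). rewrite jfac_det1 by exact Hg.
  rewrite <- Czpow_mult by (apply csqrt_neq_0, Hd). rewrite csqrt_sqr. reflexivity.
Qed.

Lemma jpow_neq_0 K g z : mdet g = 1 -> upper z -> jpow K g z <> 0%C.
Proof.
  intros Hg Hz. unfold jpow. apply Czpow_neq_0, csqrt_neq_0. rewrite jfac_det1 by exact Hg.
  apply denom_neq_0; assumption.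
Qed.

Lemma jpow_dual K g z : mdet g = 1 -> upper z ->
  jpow (4 - K) g z = (denom g z * denom g z / jpow K g z)%C.
Proof.
  intros Hg Hz. assert (Hd := denom_neq_0 g z Hg Hz). unfold jpow. rewrite jfac_det1 by exact Hg.
  assert (Hs := csqrt_neq_0 _ Hd). set (s := csqrt (denom g z)) in *.
  replace (4 - K)%Z with (Z.succ (Z.succ (Z.succ (Z.succ (- K)))))%Z by lia.
  rewrite !Czpow_succ, Czpow_opp by exact Hs.
  replace (denom g z) with (s * s)%C by apply csqrt_sqr. field. apply Czpow_neq_0, Hs.
Qed.

Definition factor (K : Z) (nu : mat2 -> C) (g : mat2) (z : C) : C := (nu g * jpow K g z)%C.

(** The properties of [nu(g) j(g, z)^k] that the weights [k] and [2 - k] share. *)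
Record automorphy_factor (K : Z) (G : mat2 -> Prop) (nu : mat2 -> C) : Prop := {
  factor_neq_0 : forall g z, G g -> upper z -> factor K nu g z <> 0%C;
  factor_mmul : forall g h z, G g -> G h -> upper z ->
    factor K nu (mmul g h) z = (factor K nu g (mobius h z) * factor K nu h z)%C;
  factor_holomorphic : forall g, G g -> holomorphic_upper (factor K nu g);
  factor_scalar : forall g z, G g -> mscalar g -> upper z -> factor K nu g z = 1%C }.

Arguments factor_neq_0 {K G nu}.
Arguments factor_mmul {K G nu}.
Arguments factor_holomorphic {K G nu}.
Arguments factor_scalar {K G nu}.

Lemma consistent_factor K G nu : subgroup_SL2R G -> consistent_multiplier K G nu ->
  automorphy_factor K G nu.
Proof.
  intros (Hdet & _) (Hnz & (Hin & _ & Hmul & _) & Hsc).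
  assert (HL : forall g, G g -> multiplier_lift K G nu (g, factor K nu g)).
  { intros g Hg. split; [exact Hg|]. intros z Hz. reflexivity. }
  split.
  - intros g z Hg Hz. apply Cmult_neq_0; [auto | apply jpow_neq_0; auto].
  - intros g h z Hg Hh Hz. destruct (Hmul _ _ (HL g Hg) (HL h Hh)) as [_ H]. specialize (H z Hz).
    simpl in H.
    symmetry. exact H.
  - intros g Hg. apply (Hin _ (HL g Hg)).
  - intros g z Hg Hs Hz. apply Hsc; assumption.
Qed.

(** Both the factor and [j^k] have modulus [|c z + d|^k]. *)
Lemma multiplier_unitary K G nu g : subgroup_SL2R G -> consistent_multiplier K G nu -> G g ->
  Cmod (nu g) = 1.
Proof.
  intros (Hdet & _) (Hnz & (Hin & _ & _ & _) & _) Hg.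
  assert (HL : multiplier_lift K G nu (g, factor K nu g)).
  { split; [exact Hg|]. intros z Hz. reflexivity. }
  destruct (Hin _ HL) as (_ & _ & H).
  assert (Hi : upper Ci) by (unfold upper; simpl; lra).
  specialize (H Ci Hi). rewrite (Hdet g Hg) in H. fold (denom g Ci) in H.
  assert (Hd := denom_neq_0 g Ci (Hdet g Hg) Hi). assert (Hm := proj1 (Cmod_gt_0 _) Hd).
  unfold Rpower at 1 in H. rewrite ln_1, Rmult_0_r, exp_0, Rmult_1_l in H.
  assert (H2 : Cmod (factor K nu g Ci * factor K nu g Ci) = powerRZ (Cmod (denom g Ci)) K).
  { rewrite Cmod_mult, H, <- Rpower_plus, powerRZ_Rpower by exact Hm. f_equal. field. }
  unfold factor in H2.
  replace (nu g * jpow K g Ci * (nu g * jpow K g Ci))%C with (nu g * nu g * (jpow K g Ci * jpow K g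
    Ci))%C in H2 by ring.
  rewrite jpow_sqr, !Cmod_mult, Cmod_Czpow in H2 by auto.
  assert (Hpz : powerRZ (Cmod (denom g Ci)) K <> 0) by (apply powerRZ_NOR; lra).
  assert (Hn := Cmod_ge_0 (nu g)).
  assert (Cmod (nu g) * Cmod (nu g) = 1); [|nra].
  apply Rmult_eq_reg_r with (powerRZ (Cmod (denom g Ci)) K); [lra | exact Hpz].
Qed.

Lemma Cconj_unitary x : Cmod x = 1 -> Cconj x = (/ x)%C.
Proof.
  intros H. assert (E := Cmod2_conj x). rewrite H in E.
  assert (Hx : x <> 0%C) by (apply Cmod_gt_0; lra).
  replace (Cconj x) with (x * Cconj x * / x)%C by (field; exact Hx). rewrite <- E.
  replace (1 ^ 2) with 1 by ring. ring.
Qed.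

(** As [nu] is unitary, the factor of weight [2 - k] for its conjugate is [j^2]
    divided by the one of weight [k] for [nu]. *)
Lemma dual_factor K G nu : subgroup_SL2R G -> consistent_multiplier K G nu ->
  automorphy_factor (4 - K) G (conj_mult nu).
Proof.
  intros HG Hc. assert (HF := consistent_factor K G nu HG Hc). assert (Hdet := proj1 HG).
  assert (E : forall g z, G g -> upper z ->
    factor (4 - K) (conj_mult nu) g z = (denom g z * denom g z / factor K nu g z)%C).
  { intros g z Hg Hz. unfold factor, conj_mult.
    rewrite (Cconj_unitary _ (multiplier_unitary K G nu g HG Hc Hg)).
    rewrite jpow_dual by auto. field. split; [apply jpow_neq_0; auto | apply (proj1 Hc); exact Hg].
    }
  assert (Hmul : forall g h, G g -> G h -> G (mmul g h)) by apply HG.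
  split.
  - intros g z Hg Hz. rewrite E by assumption. assert (Hd := denom_neq_0 g z (Hdet g Hg) Hz).
    repeat apply Cmult_neq_0; auto. apply Cinv_neq_0, (factor_neq_0 HF); assumption.
  - intros g h z Hg Hh Hz. assert (Hhz := mobius_upper h z (Hdet h Hh) Hz). rewrite !E by auto.
    rewrite denom_mmul by auto. rewrite (factor_mmul HF) by assumption. field.
    split; apply (factor_neq_0 HF); assumption.
  - intros g Hg z Hz.
    apply (cderivable_ext_loc (fun z => denom g z * denom g z / factor K nu g z)%C).
    + exists (Im z). split; [exact Hz|]. intros w Hw. symmetry. apply E; [exact Hg|].
      assert (H1 := Rle_lt_trans _ _ _ (im_le_Cmod _) Hw). apply Rabs_def2 in H1.
      destruct z, w. unfold upper. simpl in *. lra.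
    + apply cderivable_div; [| apply (factor_holomorphic HF); assumption | apply (factor_neq_0 HF);
        assumption].
      apply cderivable_mult; apply cderivable_affine.
  - intros g z Hg Hs Hz. rewrite E by assumption. rewrite (factor_scalar HF) by assumption.
    destruct Hs as (Hb & Hcc & Had). assert (Hd := Hdet g Hg). unfold mdet in Hd. unfold denom.
    rewrite Hb, Hcc, Had in *. assert (Hdd : md g * md g = 1) by lra.
    replace ((RtoC 0 * z + RtoC (md g)) * (RtoC 0 * z + RtoC (md g)) / 1)%C with (RtoC (md g) *
      RtoC (md g))%C by field.
    rewrite <- RtoC_mult, Hdd. reflexivity.
Qed.

(** * Sums over cosets and the trace *)
Definition sum_over {A : Type} (l : list A) (f : A -> C) : C := fold_right Cplus (RtoC 0) (map f l).

Lemma sum_over_app A (l1 l2 : list A) f : sum_over (l1 ++ l2) f = (sum_over l1 f + sum_over l2 f)%C.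
Proof.
  induction l1 as [|x l1 IH]; unfold sum_over in *; simpl; [ring|]. rewrite IH. ring.
Qed.

Lemma sum_over_map A B (l : list A) (h : A ->
  B) f : sum_over (map h l) f = sum_over l (fun x => f (h x)).
Proof. unfold sum_over. rewrite map_map. reflexivity. Qed.
Lemma sum_over_ext A (l : list A) f g : (forall x, In x l -> f x = g x) ->
  sum_over l f = sum_over l g.
Proof. intros H. unfold sum_over. f_equal. apply map_ext_in, H. Qed.
Lemma sum_over_scal A (l : list A) a f : sum_over l (fun x => a * f x)%C = (a * sum_over l f)%C.
Proof. unfold sum_over. induction l as [|x l IH]; simpl; [ring|]. rewrite IH. ring. Qed.
Lemma sum_over_perm A (l1 l2 : list A) f : Permutation l1 l2 -> sum_over l1 f = sum_over l2 f.
Proof.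
  unfold sum_over.
  induction 1 as [|x l1 l2 _ IH|x y l|l1 l2 l3 _ IH1 _ IH2]; simpl; [ring | rewrite IH; ring | ring
    |].
  rewrite IH1. exact IH2.
Qed.

Lemma sum_over_closed X A (Q : (X -> C) -> Prop) (l : list A) (F : X -> A -> C) :
  Q (fun _ => RtoC 0) -> (forall f g, Q f -> Q g -> Q (fun z => f z + g z)%C) ->
  (forall x, In x l -> Q (fun z => F z x)) -> Q (fun z => sum_over l (F z)).
Proof.
  intros H0 Hplus. induction l as [|x l IH]; intros H; [exact H0|].
  apply (Hplus (fun z => F z x) (fun z => sum_over l (F z))).
  - apply H. left. reflexivity.
  - apply IH. intros y Hy. apply H. right. exact Hy.
Qed.

Lemma NoDup_map_in A B (f : A -> B) l : NoDup l ->
  (forall x y, In x l -> In y l -> f x = f y -> x = y) -> NoDup (map f l).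
Proof.
  intros ND Hinj. induction ND as [|x l Hx ND IH]; simpl; constructor.
  - intros Hin. apply in_map_iff in Hin. destruct Hin as [y [Hy1 Hy2]]. apply Hx.
    rewrite (Hinj x y); [exact Hy2 | left; reflexivity | right; exact Hy2 | auto].
  - apply IH. intros; apply Hinj; auto; right; assumption.
Qed.

(** The subgroup generated by [G] and [-1]. *)
Definition pm (G : mat2 -> Prop) (g : mat2) : Prop := G g \/ G (mopp g).

Lemma pm_subgroup G : subgroup_SL2R G -> subgroup_SL2R (pm G).
Proof.
  intros (Hd & H1 & Hm & Hi). split; [|split; [|split]].
  - intros g [H|H]; [auto|]. rewrite <- mdet_mopp. auto.
  - left. exact H1.
  - intros g h [Hg|Hg] [Hh|Hh].
    + left. auto.
    + right. rewrite <- mmul_mopp_r. auto.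
    + right. rewrite <- mmul_mopp_l. auto.
    + left. rewrite <- (mopp_mopp (mmul g h)), <- mmul_mopp_r, <- mmul_mopp_l. auto.
  - intros g [Hg|Hg]; [left; auto|]. right.
    assert (Hdg : mdet g = 1) by (rewrite <- mdet_mopp; auto).
    replace (mopp (minv g)) with (minv (mopp g)); [auto|]. symmetry. apply minv_unique; [auto|].
    rewrite mmul_mopp_l, mmul_mopp_r, mopp_mopp. apply mmul_minv_r, Hdg.
Qed.

Section Cosets.
Variables (G G' : mat2 -> Prop).
Hypothesis (HG : subgroup_SL2R G) (HG' : subgroup_SL2R G').

Definition same_coset (g r : mat2) : Prop := pm G (mmul g (minv r)).

Lemma same_coset_sym g r : G' g -> G' r -> same_coset g r -> same_coset r g.
Proof.
  intros Hg Hr H. unfold same_coset. replace (mmul r (minv g)) with (minv (mmul g (minv r))).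
  - apply (pm_subgroup G HG), H.
  - rewrite minv_mmul, minv_minv; [reflexivity | | |]; try apply mdet_minv; apply HG'; assumption.
Qed.

Lemma same_coset_trans g h k : G' h -> same_coset g h -> same_coset h k -> same_coset g k.
Proof.
  intros Hh H1 H2. unfold same_coset.
  replace (mmul g (minv k)) with (mmul (mmul g (minv h)) (mmul h (minv k))).
  - apply (pm_subgroup G HG); assumption.
  - rewrite <- mmul_assoc, mmul_minvK'; [reflexivity | apply HG', Hh].
Qed.

Lemma same_coset_refl g : G' g -> same_coset g g.
Proof. intros Hg. unfold same_coset. rewrite mmul_minv_r by (apply HG', Hg). left. apply HG. Qed.

Lemma coset_reps_unique l g x y : coset_reps G G' l -> G' g -> In x l -> In y l ->
  same_coset g x -> same_coset g y -> x = y.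
Proof.
  intros (_ & _ & H) Hg Hx Hy Hgx Hgy. destruct (H g Hg) as [r [_ Hu]].
  rewrite <- (Hu x (conj Hx Hgx)). apply Hu. split; assumption.
Qed.

(** Sending an element of one system of representatives to that of the other in
    its coset is a bijection. *)
Lemma coset_sum_unique l1 l2 (psi : mat2 -> C) : coset_reps G G' l1 -> coset_reps G G' l2 ->
  (forall g r, G' g -> G' r -> same_coset g r -> psi g = psi r) ->
  sum_over l1 psi = sum_over l2 psi.
Proof.
  intros C1 C2 Hpsi.
  assert (Hch : forall x : mat2, exists r, G' x -> In r l1 /\ same_coset x r).
  { intros x. destruct (classic (G' x)) as [Hx|Hx]; [|exists x; tauto].
    destruct (proj2 (proj2 C1) x Hx) as [r [Hr _]]. exists r. auto. }
  destruct (choice_function _ _ _ Hch) as [f Hf].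
  assert (G1 := proj1 (proj2 C1)). assert (G2 := proj1 (proj2 C2)).
  transitivity (sum_over (map f l2) psi).
  - apply sum_over_perm, NoDup_Permutation; [apply C1| |].
    + apply NoDup_map_in; [apply C2|]. intros x y Hx Hy E.
      destruct (Hf x (G2 x Hx)) as [Hx1 Hx2]. destruct (Hf y (G2 y Hy)) as [Hy1 Hy2].
      apply (coset_reps_unique l2 (f x)); auto.
      * apply same_coset_sym; auto.
      * rewrite E. apply same_coset_sym; auto.
    + intros r. split.
      * intros Hr. destruct (proj2 (proj2 C2) r (G1 r Hr)) as [x [[Hx Hrx] _]].
        apply in_map_iff. exists x. split; [|exact Hx]. destruct (Hf x (G2 x Hx)) as [H1 H2].
        apply (coset_reps_unique l1 x); auto. apply same_coset_sym; auto.
      * intros Hr. apply in_map_iff in Hr. destruct Hr as [x [<- Hx]]. apply Hf, G2, Hx.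
  - rewrite sum_over_map. apply sum_over_ext. intros x Hx. symmetry.
    destruct (Hf x (G2 x Hx)) as [H1 H2]. apply Hpsi; auto.
Qed.

Lemma coset_reps_translate l d : G' d -> coset_reps G G' l ->
  coset_reps G G' (map (fun x => mmul x d) l).
Proof.
  intros Hd (ND & Hin & H).
  assert (Hdd : mdet d = 1) by (apply HG', Hd).
  assert (Hinj : forall x y, mmul x d = mmul y d -> x = y).
  { intros x y E. rewrite <- (mmul_minvK x d Hdd), E. apply mmul_minvK, Hdd. }
  split; [|split].
  - apply FinFun.Injective_map_NoDup; assumption.
  - intros r Hr. apply in_map_iff in Hr. destruct Hr as [x [<- Hx]]. apply HG'; auto.
  - intros g Hg.
    assert (Hg' : G' (mmul g (minv d))) by (apply HG'; [exact Hg | apply HG', Hd]).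
    assert (E : forall x, G' x -> mmul g (minv (mmul x d)) = mmul (mmul g (minv d)) (minv x)).
    { intros x Hx. rewrite minv_mmul by (auto; apply HG', Hx). rewrite mmul_assoc. reflexivity. }
    destruct (H _ Hg') as [r [[Hr1 Hr2] Hu]]. exists (mmul r d). split.
    + split; [apply in_map_iff; exists r; auto|]. rewrite E by auto. exact Hr2.
    + intros y [Hy1 Hy2]. apply in_map_iff in Hy1. destruct Hy1 as [x [<- Hx]]. f_equal. apply Hu.
      rewrite E in Hy2 by auto. auto.
Qed.
End Cosets.

Definition trace_term (K : Z) (nu : mat2 -> C) (f : C -> C) (z : C) (g : mat2) : C :=
  (/ factor K nu g z * f (mobius g z))%C.

Lemma trace_sum_over K (nu : mat2 -> C) reps f z :
  (forall g, In g reps -> nu g <> 0%C /\ mdet g = 1) -> upper z ->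
  trace K nu reps f z = sum_over reps (trace_term K nu f z).
Proof.
  intros H Hz. unfold trace, sum_over. f_equal. apply map_ext_in. intros g Hg.
  destruct (H g Hg) as [Hn Hd].
  unfold trace_term, factor, slash. field. split; [apply jpow_neq_0; assumption | exact Hn].
Qed.

Section Trace.
Variables (K : Z) (G G' : mat2 -> Prop) (nu nu' : mat2 -> C).
Hypotheses (HG : subgroup_SL2R G) (HG' : subgroup_SL2R G') (Hsub : subset G G').
Hypothesis (HF : automorphy_factor K G' nu').
Hypothesis (Hext : forall g, G g -> nu' g = nu g).

Lemma factor_mopp g z : G' g -> G' (mopp g) -> upper z ->
  factor K nu' (mopp g) z = factor K nu' g z.
Proof.
  intros Hg Hmg Hz. assert (Hd : mdet g = 1) by (apply HG', Hg).
  assert (H1 : G' (mopp mone)).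
  { rewrite <- (mmul_minv_r g Hd), <- mmul_mopp_l. apply HG'; [exact Hmg | apply HG', Hg]. }
  rewrite <- (mmul_1_l g) at 1. rewrite <- mmul_mopp_l, (factor_mmul HF) by assumption.
  rewrite (factor_scalar HF); [ring | exact H1 | | apply mobius_upper; assumption].
  unfold mscalar, mopp, mone; simpl. repeat split; lra.
Qed.

Lemma trace_term_mopp f z g : G' g -> G' (mopp g) -> upper z ->
  trace_term K nu' f z (mopp g) = trace_term K nu' f z g.
Proof.
  intros Hg Hmg Hz. unfold trace_term. rewrite factor_mopp, mobius_mopp by (auto; apply HG', Hg).
  reflexivity.
Qed.

Lemma trace_term_mul f z h g : modular K G nu f -> G h -> G' g -> upper z ->
  trace_term K nu' f z (mmul h g) = trace_term K nu' f z g.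
Proof.
  intros Hf Hh Hg Hz. assert (Hdh : mdet h = 1) by (apply HG, Hh).
  assert (Hdg : mdet g = 1) by (apply HG', Hg).
  assert (Hgz := mobius_upper g z Hdg Hz).
  unfold trace_term. rewrite (factor_mmul HF), mobius_mmul by auto.
  rewrite (Hf h _ Hh Hgz).
  assert (E : factor K nu' h (mobius g z) = (nu h * jpow K h (mobius g z))%C).
  { unfold factor. rewrite Hext by exact Hh. reflexivity. }
  rewrite <- E. field. split; apply (factor_neq_0 HF); auto.
Qed.

(** The term of [g] depends on the coset of [g] only; when [G'] contains [-1], this
    includes the sign, as the factor of [-1] is 1. *)
Lemma trace_term_coset f z g r : modular K G nu f -> upper z -> G' g -> G' r -> same_coset G g r ->
  trace_term K nu' f z g = trace_term K nu' f z r.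
Proof.
  intros Hf Hz Hg Hr [H|H]; assert (Hdr : mdet r = 1) by (apply HG', Hr).
  - rewrite <- (mmul_minvK' g r Hdr). apply trace_term_mul; assumption.
  - assert (E : mopp g = mmul (mopp (mmul g (minv r))) r).
    { rewrite mmul_mopp_l, mmul_minvK' by exact Hdr. reflexivity. }
    assert (Hmg : G' (mopp g)) by (rewrite E; apply HG'; auto).
    rewrite <- trace_term_mopp by assumption. rewrite E. apply trace_term_mul; assumption.
Qed.

Lemma trace_term_translate f z d g : G' d -> G' g -> upper z ->
  trace_term K nu' f (mobius d z) g = (factor K nu' d z * trace_term K nu' f z (mmul g d))%C.
Proof.
  intros Hd Hg Hz. assert (Hdd : mdet d = 1) by (apply HG', Hd).
  assert (Hdg : mdet g = 1) by (apply HG', Hg).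
  unfold trace_term. rewrite (factor_mmul HF), mobius_mmul by auto. field.
  split; apply (factor_neq_0 HF); auto. apply mobius_upper; assumption.
Qed.

(** Right translation by [d] permutes the cosets. *)
Lemma trace_modular f reps : modular K G nu f -> coset_reps G G' reps ->
  modular K G' nu' (fun z => sum_over reps (trace_term K nu' f z)).
Proof.
  intros Hf HR d z Hd Hz. fold (factor K nu' d z).
  rewrite (sum_over_ext _ _ _ (fun x => factor K nu' d z * trace_term K nu' f z (mmul x d))%C).
  - rewrite sum_over_scal. f_equal.
    rewrite <- (sum_over_map _ _ reps (fun x => mmul x d) (trace_term K nu' f z)).
    apply (coset_sum_unique G G' HG HG').
    + apply coset_reps_translate; assumption.
    + exact HR.
    + intros g r Hg Hr. apply trace_term_coset; assumption.
  - intros x Hx. apply trace_term_translate; try assumption. apply HR, Hx.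
Qed.

Lemma trace_term_holomorphic f g : holomorphic_upper f -> G' g ->
  holomorphic_upper (fun z => trace_term K nu' f z g).
Proof.
  intros Hf Hg z Hz. assert (Hdg : mdet g = 1) by (apply HG', Hg). unfold trace_term.
  apply cderivable_mult.
  - apply (cderivable_comp Cinv (factor K nu' g)).
    + apply (factor_holomorphic HF); assumption.
    + apply cderivable_inv, (factor_neq_0 HF); assumption.
  - apply (cderivable_comp f (mobius g)); [apply cderivable_mobius; assumption|].
    apply Hf, mobius_upper; assumption.
Qed.

End Trace.

(** * Cusps of commensurable groups *)
Definition mpow (h : mat2) (n : nat) : mat2 := Nat.iter n (mmul h) mone.
Lemma mpow_add h n m : mpow h (n + m) = mmul (mpow h n) (mpow h m).
Proof.
  induction n as [|n IH]; [symmetry; apply mmul_1_l|].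
  change (mpow h (S n + m)) with (mmul h (mpow h (n + m))). rewrite IH. symmetry. apply mmul_assoc.
Qed.

Lemma mpow_in G h n : subgroup_SL2R G -> G h -> G (mpow h n).
Proof.
  intros HG Hh. induction n as [|n IH]; [apply HG|].
  change (G (mmul h (mpow h n))). apply HG; assumption.
Qed.

(** Pigeonhole: two powers of [h] lie in the same coset. *)
Lemma power_in_finite_index D G h : subgroup_SL2R D -> subgroup_SL2R G -> finite_index D G -> G h ->
  exists n, (0 < n)%nat /\ D (mpow h n).
Proof.
  intros HD HG [l Hl] Hh.
  assert (Hch : forall i, exists r, In r l /\ G r /\ D (mmul (mpow h i) (minv r))).
  { intros i. apply Hl, mpow_in; assumption. }
  destruct (choice_function _ _ _ Hch) as [f Hf].
  apply NNPP. intros Hno.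
  assert (ND : NoDup (map f (seq 0 (S (length l))))).
  { apply NoDup_map_in; [apply seq_NoDup|].
    assert (Hlt : forall i j, (i < j)%nat -> f i = f j -> False).
    { intros i j Hij E. apply Hno. exists (j - i)%nat. split; [lia|].
      destruct (Hf i) as (_ & Hr & H1). destruct (Hf j) as (_ & _ & H2). rewrite <- E in H2.
      assert (Hdr : mdet (f i) = 1) by (apply HG, Hr).
      assert (Hdi : mdet (mpow h i) = 1) by (apply HG, mpow_in; assumption).
      assert (H3 : D (mmul (mmul (mpow h j) (minv (f i))) (minv (mmul (mpow h i) (minv (f i)))))).
      { apply HD; [exact H2 | apply HD; exact H1]. }
      rewrite minv_mmul, minv_minv in H3 by auto using mdet_minv.
      rewrite <- mmul_assoc, mmul_minvK' in H3 by exact Hdr.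
      replace (mpow h j) with (mmul (mpow h (j - i)) (mpow h i)) in H3
        by (rewrite <- mpow_add; f_equal; lia).
      rewrite mmul_minvK in H3 by exact Hdi. exact H3. }
    intros i j _ _ E.
    destruct (Nat.lt_total i j) as [L|[L|L]]; [exfalso; eauto | exact L | exfalso; eauto]. }
  apply NoDup_incl_length with (l' := l) in ND.
  - rewrite length_map, length_seq in ND. lia.
  - intros r Hr. apply in_map_iff in Hr. destruct Hr as [i [<- _]]. apply Hf.
Qed.

Lemma SL2Z_subgroup : subgroup_SL2R SL2Z.
Proof.
  split; [|split; [|split]].
  - intros g H. apply H.
  - split; [apply mdet_mone|]. exists 1%Z, 0%Z, 0%Z, 1%Z. reflexivity.
  - intros g h [Hg (a & b & c & d & ->)] [Hh (a' & b' & c' & d' & ->)]. split.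
    + rewrite mdet_mmul, Hg, Hh. ring.
    + exists (a * a' + b * c')%Z, (a * b' + b * d')%Z, (c * a' + d * c')%Z, (c * b' + d * d')%Z.
      unfold mmul; simpl. rewrite !plus_IZR, !mult_IZR. reflexivity.
  - intros g [Hg (a & b & c & d & ->)]. split; [apply mdet_minv, Hg|].
    rewrite minv_det1 by exact Hg.
    exists d, (- b)%Z, (- c)%Z, a. simpl. rewrite !opp_IZR. reflexivity.
Qed.

Lemma subgroup_inter G H : subgroup_SL2R G -> subgroup_SL2R H ->
  subgroup_SL2R (fun g => G g /\ H g).
Proof.
  intros (A1 & A2 & A3 & A4) (B1 & B2 & B3 & B4). split; [|split; [|split]].
  - intros g [Hg _]. auto.
  - split; assumption.
  - intros g h [] []. split; auto.
  - intros g []. split; auto.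
Qed.

(** The unipotent matrices that fix the vector [(x, y)]. *)
Definition unipotent (k x y : R) : mat2 := Mat2 (1 - k * x * y) (k * x * x) (- (k * y * y))
  (1 + k * x * y).
Lemma unipotent_conj g k : mdet g = 1 ->
  mmul (mmul g (mtrans k)) (minv g) = unipotent k (ma g) (mc g).
Proof.
  intros H. rewrite minv_det1 by exact H. destruct g as [a b c d]. unfold mdet in H; simpl in H.
  unfold mmul, mtrans, unipotent; simpl. f_equal; lra.
Qed.

Lemma mpow_unipotent k x y n : mpow (unipotent k x y) n = unipotent (INR n * k) x y.
Proof.
  induction n as [|n IH].
  - unfold mpow, mone, unipotent; simpl. f_equal; ring.
  - rewrite S_INR.
    change (mmul (unipotent k x y) (mpow (unipotent k x y) n) = unipotent ((INR n + 1) * k) x y).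
    rewrite IH. unfold mmul, unipotent; simpl. f_equal; ring.
Qed.

(** A power of [s T s^-1] lies in [G]; conjugating it by [g] and taking a power
    gives an integral unipotent matrix that fixes the cusp [g s oo]. *)
Lemma unipotent_integral G g s : commensurable G -> G g -> SL2Z s ->
  exists k : nat, (0 < k)%nat /\ SL2Z (unipotent (INR k) (ma (mmul g s)) (mc (mmul g s))).
Proof.
  intros (HG & F1 & F2) Hg Hs.
  assert (HD := subgroup_inter G SL2Z HG SL2Z_subgroup).
  assert (Hds : mdet s = 1) by apply Hs. assert (Hdg : mdet g = 1) by (apply HG, Hg).
  assert (HT : SL2Z (unipotent 1 (ma s) (mc s))).
  { rewrite <- unipotent_conj by exact Hds. apply SL2Z_subgroup; [|apply SL2Z_subgroup; exact Hs].
    apply SL2Z_subgroup; [exact Hs|]. split; [unfold mdet, mtrans; simpl; ring|].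
    exists 1%Z, 1%Z, 0%Z, 1%Z. reflexivity. }
  destruct (power_in_finite_index _ _ _ HD SL2Z_subgroup F2 HT) as [n [Hn [HGn _]]].
  rewrite mpow_unipotent, Rmult_1_r in HGn.
  assert (HU : G (unipotent (INR n) (ma (mmul g s)) (mc (mmul g s)))).
  { rewrite <- unipotent_conj by (rewrite mdet_mmul, Hdg, Hds; ring).
    rewrite minv_mmul by assumption.
    replace (mmul (mmul (mmul g s) (mtrans (INR n))) (mmul (minv s) (minv g))) with
      (mmul (mmul g (mmul (mmul s (mtrans (INR n))) (minv s)))
        (minv g)) by (rewrite !mmul_assoc; reflexivity).
    rewrite unipotent_conj by exact Hds. apply HG; [|apply HG; exact Hg]. apply HG; assumption. }
  destruct (power_in_finite_index _ _ _ HD HG F1 HU) as [m [Hm [_ Hz]]].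
  rewrite mpow_unipotent, <- mult_INR in Hz. exists (m * n)%nat. split; [nia | exact Hz].
Qed.

(** The entries [k x^2], [k x y], [k y^2] of an integral unipotent matrix are
    integers, so the cusp [x / y] that it fixes is rational; Bezout completes its
    primitive vector to an element of [SL_2(Z)]. *)
Lemma cusp_image G g s : commensurable G -> G g -> SL2Z s ->
  exists s', SL2Z s' /\ mc (mmul (minv s') (mmul g s)) = 0.
Proof.
  intros HG Hg Hs.
  destruct (unipotent_integral G g s HG Hg Hs) as (k & Hk & Hd & (a & b & c & d & Hu)).
  set (h := mmul g s) in *. clearbody h.
  set (x := ma h) in *. set (y := mc h) in *. unfold unipotent in Hu.
  injection Hu. intros E4 E3 E2 E1. clear Hu.
  destruct (Req_dec y 0) as [Hy|Hy].
  { exists mone. split; [apply SL2Z_subgroup|]. rewrite minv_det1 by apply mdet_mone.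
    unfold mmul, mone; simpl.
    fold x y. rewrite Hy. ring. }
  assert (Hk' : 0 < INR k) by (apply lt_0_INR, Hk).
  set (A := (d - 1)%Z). set (B := (- c)%Z).
  assert (EA : IZR A = INR k * x * y) by (unfold A; rewrite minus_IZR; lra).
  assert (EB : IZR B = INR k * y * y) by (unfold B; rewrite opp_IZR; lra).
  assert (HB : B <> 0%Z).
  { intros E. rewrite E in EB. assert (0 < y * y) by nra. nra. }
  destruct (Z.gcd_bezout A B (Z.gcd A B) eq_refl) as (u & v & Huv).
  destruct (Z.gcd_divide_l A B) as [p Hp]. destruct (Z.gcd_divide_r A B) as [q Hq].
  set (e := Z.gcd A B) in *.
  assert (He : e <> 0%Z) by (intros E; rewrite E in Hq; lia).
  assert (Hpq : (u * p + v * q = 1)%Z).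
  { apply (Z.mul_reg_r _ _ e He). transitivity (u * A + v * B)%Z; [rewrite Hp, Hq; ring | lia]. }
  assert (Hdet : IZR p * IZR u - IZR (- v) * IZR q = 1).
  { rewrite opp_IZR. apply (f_equal IZR) in Hpq. rewrite plus_IZR, !mult_IZR in Hpq. lra. }
  exists (Mat2 (IZR p) (IZR (- v)) (IZR q) (IZR u)). split.
  - split; [exact Hdet|]. exists p, (- v)%Z, q, u. reflexivity.
  - rewrite minv_det1 by exact Hdet. unfold mmul; simpl. fold x y.
    apply Rmult_eq_reg_r with (IZR e); [|apply not_0_IZR, He].
    replace ((- IZR q * x + IZR p * y) * IZR e) with (- (IZR q * IZR e) * x + (IZR p * IZR e) * y)
      by ring.
    assert (EA' : IZR p * IZR e = IZR A) by (rewrite <- mult_IZR; f_equal; symmetry; exact Hp).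
    assert (EB' : IZR q * IZR e = IZR B) by (rewrite <- mult_IZR; f_equal; symmetry; exact Hq).
    rewrite EA', EB', EA, EB. ring.
Qed.

(** The change of variable [z -> a^2 z + a b] between the expansions at two cusps
    preserves rationality of the exponents, for the same reason. *)
Lemma cusp_scaling_rational G g s s' : commensurable G -> G g -> SL2Z s -> SL2Z s' ->
  mc (mmul (minv s') (mmul g s)) = 0 ->
  exists p q : nat, (0 < p)%nat /\ (0 < q)%nat /\
    ma (mmul (minv s') (mmul g s)) * ma (mmul (minv s') (mmul g s)) = INR p / INR q.
Proof.
  intros HG Hg Hs Hs' H0.
  destruct (unipotent_integral G g s HG Hg Hs) as (k & Hk & _ & (a & b & c & d & Hu)).
  assert (Hds : mdet s = 1) by apply Hs. assert (Hdg : mdet g = 1) by (apply HG, Hg).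
  assert (Hds' : mdet s' = 1) by apply Hs'.
  set (t := mmul (minv s') (mmul g s)) in *.
  assert (Hdt : mdet t = 1) by (unfold t; rewrite !mdet_mmul, mdet_minv, Hds,
    Hdg by assumption; ring).
  assert (Et : mmul g s = mmul s' t) by (unfold t; rewrite <- mmul_assoc, mmul_minv_r,
    mmul_1_l by assumption; reflexivity).
  clearbody t. rewrite Et in Hu. destruct Hs' as [_ (a' & b' & c' & d' & Es')]. subst s'.
  unfold mdet in Hdt, Hds'. simpl in Hds'. rewrite H0 in Hdt.
  unfold unipotent in Hu. injection Hu. intros _ E3 E2 _. clear Hu. simpl in E2, E3.
  rewrite H0 in E2, E3.
  set (al := ma t) in *.
  assert (Hal : 0 < al * al) by nra.
  assert (Hk' := lt_0_INR k Hk).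
  assert (Hgen : forall m j : Z, m <> 0%Z -> INR k * (IZR m * IZR m) * (al * al) = IZR j ->
    exists p q : nat, (0 < p)%nat /\ (0 < q)%nat /\ al * al = INR p / INR q).
  { intros m j Hm E. assert (Hm' : 0 < IZR m * IZR m) by (apply not_0_IZR in Hm; nra).
    assert (Hq : 0 < INR k * (IZR m * IZR m)) by (apply Rmult_lt_0_compat; assumption).
    assert (Hj : 0 < IZR j) by (rewrite <- E; apply Rmult_lt_0_compat; assumption).
    apply lt_IZR in Hj.
    exists (Z.to_nat j), (k * Z.to_nat (m * m))%nat. split; [lia|]. split; [nia|].
    rewrite mult_INR, !INR_IZR_INZ, !Z2Nat.id by nia. rewrite <- E, mult_IZR, <- INR_IZR_INZ. field.
    split; [apply not_0_IZR, Hm | lra]. }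
  destruct (Z.eq_dec a' 0) as [Ha|Ha].
  - apply (Hgen c' (- c)%Z).
    + intros Hc. subst. lra.
    + rewrite opp_IZR. lra.
  - apply (Hgen a' b); [exact Ha | lra].
Qed.

Lemma mtrans_mul r s : mmul (mtrans r) (mtrans s) = mtrans (r + s).
Proof. unfold mmul, mtrans; simpl. f_equal; ring. Qed.
Lemma mdet_mtrans r : mdet (mtrans r) = 1.
Proof. unfold mdet, mtrans; simpl. ring. Qed.
Lemma mtrans_minv r : minv (mtrans r) = mtrans (- r).
Proof. rewrite minv_det1 by apply mdet_mtrans. unfold mtrans; simpl. f_equal; ring. Qed.

(** The upper triangular elements normalise the translations, a discrete group with
    generator [w]: hence both [a^2] and [a^-2] are integers. *)
Lemma stabiliser_infinity G w u : subgroup_SL2R G -> is_width G w -> G u -> mc u = 0 ->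
  exists n : Z, u = mtrans (IZR n * w) \/ u = mopp (mtrans (IZR n * w)).
Proof.
  intros HG [Hw Hr] Hu H0.
  assert (HP := pm_subgroup G HG).
  assert (HT : pm G (mtrans w)) by (apply Hr; exists 1%Z; ring).
  assert (Hsq : forall v, G v -> mc v = 0 -> exists n : Z, ma v * ma v = IZR n).
  { intros v Hv Hv0. assert (Hdv : mdet v = 1) by (apply HG, Hv).
    assert (Hc : pm G (mmul (mmul v (mtrans w)) (minv v))).
    { apply HP; [|apply HP; left; exact Hv]. apply HP; [left; exact Hv | exact HT]. }
    assert (E : mmul (mmul v (mtrans w)) (minv v) = mtrans (ma v * ma v * w)).
    { rewrite unipotent_conj by exact Hdv. unfold unipotent, mtrans. rewrite Hv0. f_equal; ring. }
    rewrite E in Hc. apply Hr in Hc. destruct Hc as [n Hn]. exists n.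
    apply Rmult_eq_reg_r in Hn; [exact Hn | lra]. }
  assert (Hdu : mdet u = 1) by (apply HG, Hu).
  destruct (Hsq u Hu H0) as [n Hn].
  destruct (Hsq (minv u)) as [m Hm].
  { apply HG, Hu. }
  { rewrite minv_det1 by exact Hdu. simpl. rewrite H0. ring. }
  rewrite minv_det1 in Hm by exact Hdu. simpl in Hm.
  assert (Hdu' := Hdu). unfold mdet in Hdu'. rewrite H0 in Hdu'.
  assert (Hnm : (n * m = 1)%Z).
  { apply eq_IZR. rewrite mult_IZR, <- Hn, <- Hm.
    replace (ma u * ma u * (md u * md u)) with ((ma u * md u) * (ma u * md u)) by ring.
    replace (ma u * md u) with 1 by lra. ring. }
  assert (Hn0 : 0 <= IZR n) by (rewrite <- Hn; nra). apply le_IZR in Hn0.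
  assert (n = 1%Z) as -> by (destruct (Z.mul_eq_1 n m Hnm); lia).
  assert (Ha : ma u = 1 \/ ma u = -1).
  { assert (X : (ma u - 1) * (ma u + 1) = 0) by lra. apply Rmult_integral in X.
    destruct X; [left | right]; lra. }
  destruct u as [a b c d]. simpl in *. subst c.
  destruct Ha as [-> | ->].
  - assert (d = 1) as -> by lra.
    assert (Hb : G (mtrans b) \/ G (mopp (mtrans b))) by (left; exact Hu).
    apply Hr in Hb. destruct Hb as [j Hj]. exists j. left. rewrite <- Hj. reflexivity.
  - assert (d = -1) as -> by lra.
    assert (E : Mat2 (-1) b 0 (-1) = mopp (mtrans (- b))) by (unfold mopp,
      mtrans; simpl; f_equal; ring).
    assert (Hb : G (mtrans (- b)) \/ G (mopp (mtrans (- b)))) by (right; rewrite <- E; exact Hu).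
    apply Hr in Hb. destruct Hb as [j Hj]. exists j. right. rewrite <- Hj. exact E.
Qed.

(** * Expansions at the cusps *)

Lemma ccontinuous_comp (f g : C -> C) z : ccontinuous g z -> ccontinuous f (g z) ->
  ccontinuous (fun w => f (g w)) z.
Proof.
  intros Hg Hf eps He. destruct (Hf eps He) as [d [Hd H]]. destruct (Hg d Hd) as [d' [Hd' H']].
  exists d'. split; [exact Hd'|]. intros w Hw. apply H, H', Hw.
Qed.

Lemma ccontinuous_mult (f g : C -> C) z :
  ccontinuous f z -> ccontinuous g z -> ccontinuous (fun w => f w * g w)%C z.
Proof.
  intros Hf Hg eps He.
  assert (H := diff2_continuous _ (f z, g z) (diff2_mult fst snd _ (diff2_fst _)
    (diff2_snd _)) eps He).
  apply near2_bidisc in H. destruct H as [r [Hr H]].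
  destruct (Hf r Hr) as [d1 [Hd1 H1]]. destruct (Hg r Hr) as [d2 [Hd2 H2]].
  exists (Rmin d1 d2). split; [apply Rmin_pos; assumption|].
  intros w Hw. destruct (Rmin_Rgt_l _ _ _ Hw). apply (H (f w, g w)).
  split; [apply H1 | apply H2]; assumption.
Qed.

(** The principal root has nonnegative real part, so near a point whose root has
    positive real part the roots cannot jump to the other branch. *)
Lemma ccontinuous_csqrt (w : C) : Im w <> 0 -> ccontinuous csqrt w.
Proof.
  intros Hw. assert (Hre : forall v, 0 <= Re (csqrt v)) by (intros v; apply sqrt_pos).
  assert (Hpos : 0 < Re (csqrt w)).
  { unfold csqrt; simpl. apply sqrt_lt_R0. assert (H2 := Cmod2_alt w).
    assert (Hm := Cmod_ge_0 w). assert (0 < Im w ^ 2) by (simpl; nra).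
    assert (Hx : - Re w < Cmod w); [|lra]. simpl in *. nra. }
  intros eps He. exists (Re (csqrt w) * eps). split; [apply Rmult_lt_0_compat; assumption|].
  intros v Hv.
  assert (E : (v - w)%C = ((csqrt v - csqrt w) * (csqrt v + csqrt w))%C).
  { rewrite <- (csqrt_sqr v), <- (csqrt_sqr w) at 1. ring. }
  rewrite E, Cmod_mult in Hv.
  assert (L : Re (csqrt w) <= Cmod (csqrt v + csqrt w)).
  { assert (X := re_le_Cmod (csqrt v + csqrt w)). assert (Y := Rle_abs (Re (csqrt v + csqrt w))).
    change (Re (csqrt v + csqrt w)) with (Re (csqrt v) + Re (csqrt w)) in *. specialize (Hre v).
    lra. }
  assert (X := Cmod_ge_0 (csqrt v - csqrt w)).
  apply Rnot_le_lt. intros Hle. nra.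
Qed.

Lemma ccontinuous_jpow K g z : mdet g = 1 -> upper z -> ccontinuous (jpow K g) z.
Proof.
  intros Hg Hz.
  assert (Hd := denom_neq_0 g z Hg Hz).
  assert (Hroot : ccontinuous (fun z => csqrt (denom g z)) z).
  { destruct (Req_dec (mc g) 0) as [Hc|Hc].
    - intros eps He. exists 1. split; [lra|]. intros w _. unfold denom. rewrite Hc.
      replace (RtoC 0 * w + RtoC (md g))%C with (RtoC 0 * z + RtoC (md g))%C by ring.
      match goal with |- Cmod (?x - ?x) < _ => replace (x - x)%C with (RtoC 0) by ring end.
      rewrite Cmod_0. exact He.
    - apply (ccontinuous_comp csqrt (denom g)).
      + apply cderivable_continuous, cderivable_affine.
      + apply ccontinuous_csqrt. unfold denom. destruct z as [x y]. unfold upper in Hz. simpl in *.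
        intros E. assert (E' : mc g * y = 0) by lra. apply Rmult_integral in E'. destruct E'; lra. }
  assert (Hpow : ccontinuous (fun s => Czpow s K) (csqrt (denom g z))).
  { apply cderivable_continuous. assert (Hs := csqrt_neq_0 _ Hd). destruct K as [|p|p]; simpl.
    - apply cderivable_const.
    - apply cderivable_pow, cderivable_id.
    - apply (cderivable_comp Cinv (fun s => Cpow s (Pos.to_nat p))); [apply cderivable_pow,
        cderivable_id|].
      apply cderivable_inv, Cpow_nz, Hs. }
  assert (H := ccontinuous_comp (fun s => Czpow s K) (fun z => csqrt (denom g z)) z Hroot Hpow).
  intros eps He. destruct (H eps He) as [d [Hd' Hw]]. exists d. split; [exact Hd'|]. intros w Hww.
  unfold jpow. rewrite !jfac_det1 by exact Hg. apply Hw, Hww.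
Qed.

Lemma sign_constant (Q : C -> C) : (forall z, upper z -> ccontinuous Q z /\ (Q z * Q z = 1)%C) ->
  forall z w, upper z -> upper w -> Q w = Q z.
Proof.
  intros H z w Hz Hw.
  set (p := fun t : R => (z + RtoC t * (w - z))%C).
  assert (Hp : forall t, 0 <= t <= 1 -> upper (p t)).
  { intros t Ht. destruct z as [a b], w as [c d].
    unfold p, upper, Im, Cplus, Cminus, Copp, Cmult, RtoC in *; simpl in *. nra. }
  assert (P0 : p 0 = z) by (unfold p; ring). assert (P1 : p 1 = w) by (unfold p; ring).
  assert (Hsgn : forall v, upper v -> Q v = 1%C \/ Q v = (- (1))%C).
  { intros v Hv. destruct (H v Hv) as [_ E].
    assert (E' : ((Q v - 1) * (Q v + 1) =
      0)%C) by (replace ((Q v - 1) * (Q v + 1))%C with (Q v * Q v - 1)%C by ring; rewrite E; ring).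
    destruct (classic (Q v - 1 = 0)%C) as [X|X].
    - left. replace (Q v) with (Q v - 1 + 1)%C by ring. rewrite X. ring.
    - right. destruct (classic (Q v + 1 = 0)%C) as [Y|Y].
      + replace (Q v) with (Q v + 1 - 1)%C by ring. rewrite Y. ring.
      + exfalso. apply (Cmult_neq_0 _ _ X Y E'). }
  rewrite <- P1. apply (segment_connected (fun t => Q (p t) = Q z)).
  - rewrite P0. reflexivity.
  - intros t Ht. destruct (proj1 (H _ (Hp t Ht)) 1 ltac:(lra)) as [d [Hd Hc]].
    set (L := Cmod (w - z) + 1).
    assert (HL : 0 < L) by (unfold L; assert (X := Cmod_ge_0 (w - z)); lra).
    exists (d / L). split; [apply Rdiv_lt_0_compat; lra|].
    assert (Heq : forall s, 0 <= s <= 1 -> Rabs (s - t) < d / L -> Q (p s) = Q (p t)).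
    { intros s Hs Hst. assert (Hst' : Rabs (s - t) * L < d).
      { apply Rlt_div_r in Hst; assumption. }
      assert (Hcl : Cmod (Q (p s) - Q (p t)) < 1).
      { apply Hc.
        replace (p s - p t)%C with (RtoC (s - t) * (w - z))%C by (unfold p; rewrite RtoC_minus;
          ring).
        rewrite Cmod_mult, Cmod_R. assert (X := Rabs_pos (s - t)). unfold L in Hst'. lra. }
      destruct (Hsgn _ (Hp s Hs)) as [X|X]; destruct (Hsgn _ (Hp t Ht)) as [Y|Y]; rewrite X,
        Y in *; auto; exfalso.
      - replace (1 - - (1))%C with (RtoC 2) in Hcl by (rewrite <- RtoC_opp,
          <- RtoC_minus; f_equal; ring).
        rewrite Cmod_R, Rabs_right in Hcl; lra.
      - replace (- (1) - 1)%C with (RtoC (-2)) in Hcl by (rewrite <- RtoC_opp,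
          <- RtoC_minus; f_equal; ring).
        rewrite Cmod_R, Rabs_left in Hcl; lra. }
    intros s s' Hs Hs' H1 H2 E. rewrite (Heq s' Hs' H2), <- (Heq s Hs H1). exact E.
Qed.

(** The principal branches compose up to a sign, which is locally constant. *)
Lemma jpow_cocycle K g h : mdet g = 1 -> mdet h = 1 ->
  exists e : C, e <> 0%C /\ forall z, upper z ->
    (jpow K g (mobius h z) * jpow K h z = e * jpow K (mmul g h) z)%C.
Proof.
  intros Hg Hh. assert (Hgh : mdet (mmul g h) = 1) by (rewrite mdet_mmul, Hg, Hh; ring).
  set (Q := fun z => (jpow K g (mobius h z) * jpow K h z * / jpow K (mmul g h) z)%C).
  assert (HQ : forall z, upper z -> ccontinuous Q z /\ (Q z * Q z = 1)%C).
  { intros z Hz. assert (Hhz := mobius_upper h z Hh Hz). assert (N := jpow_neq_0 K _ z Hgh Hz).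
    split.
    - apply ccontinuous_mult; [apply ccontinuous_mult|].
      + apply (ccontinuous_comp (jpow K g) (mobius h)); [|apply ccontinuous_jpow; assumption].
        apply cderivable_continuous, cderivable_mobius; assumption.
      + apply ccontinuous_jpow; assumption.
      + apply (ccontinuous_comp Cinv (jpow K (mmul g h))); [apply ccontinuous_jpow; assumption|].
        apply cderivable_continuous, cderivable_inv, N.
    - unfold Q.
      replace (jpow K g (mobius h z) * jpow K h z * / jpow K (mmul g h) z * (jpow K g (mobius h z)
        * jpow K h z * / jpow K (mmul g h) z))%C
       with ((jpow K g (mobius h z) * jpow K g (mobius h z)) * (jpow K h z * jpow K h z) / (jpow K
         (mmul g h) z * jpow K (mmul g h) z))%C by (field; exact N).
      rewrite !jpow_sqr by assumption. rewrite denom_mmul by assumption.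
      assert (N1 := denom_neq_0 g _ Hg Hhz). assert (N2 := denom_neq_0 h _ Hh Hz).
      rewrite Czpow_mult by assumption. field. split; apply Czpow_neq_0; assumption. }
  assert (Hi : upper Ci) by (unfold upper; simpl; lra).
  exists (Q Ci). split.
  - intros E. destruct (HQ Ci Hi) as [_ E']. rewrite E in E'. apply C1_nz. rewrite <- E'. ring.
  - intros z Hz. rewrite <- (sign_constant Q HQ Ci z Hi Hz). unfold Q. field.
    apply jpow_neq_0; assumption.
Qed.

(** Holomorphy at a cusp excludes the exponents [r < 0], vanishing those with
    [r <= 0]. Both cases are treated at once, for a predicate [P] between them. *)
Definition excluded_exponents (P : R -> Prop) : Prop :=
  (forall r, r < 0 -> P r) /\ (forall r, P r -> r <= 0).

Lemma excluded_scale P a r : excluded_exponents P -> 0 < a -> P r -> P (r / a).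
Proof.
  intros [H1 H2] Ha Hr. assert (L := H2 r Hr). destruct (Req_dec r 0) as [E|E].
  - subst r. replace (0 / a) with 0 by (field; lra). exact Hr.
  - apply H1. unfold Rdiv. assert (0 < / a) by (apply Rinv_0_lt_compat, Ha). nra.
Qed.

Definition regular (P : R -> Prop) (f : C -> C) : Prop :=
  exists c, has_qexp f c /\ forall r, P r -> c r = 0%C.

Lemma regular_ext P f g : (forall z, upper z -> f z = g z) -> regular P f -> regular P g.
Proof. intros E [c [H1 H2]]. exists c. split; [apply (has_qexp_ext f); assumption | exact H2]. Qed.
Lemma regular_plus P f g : regular P f -> regular P g -> regular P (fun z => f z + g z)%C.
Proof.
  intros [c [H1 H2]] [d [H3 H4]]. exists (fun r => c r + d r)%C.
  split; [apply has_qexp_plus; assumption|].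
  intros r Hr. rewrite H2, H4 by exact Hr. ring.
Qed.

Lemma regular_scal P a f : regular P f -> regular P (fun z => a * f z)%C.
Proof.
  intros [c [H1 H2]]. exists (fun r => a * c r)%C. split; [apply has_qexp_scal; assumption|].
  intros r Hr. rewrite H2 by exact Hr. ring.
Qed.

Lemma regular_zero P (f : C -> C) : (forall z, upper z -> f z = 0%C) -> regular P f.
Proof. intros H. exists (fun _ => 0%C). split; [|reflexivity]. intros z Hz. rewrite H by exact Hz.
apply qsum_zero. Qed.
Lemma regular_sum P A (l : list A) (F : C -> A -> C) :
  (forall x, In x l -> regular P (fun z => F z x)) -> regular P (fun z => sum_over l (F z)).
Proof.
  apply (sum_over_closed C A (regular P)); [apply regular_zero; reflexivity | apply regular_plus].
Qed.

Definition regular_at_cusp (P : R -> Prop) (K : Z) (f : C ->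
  C) (s : mat2) : Prop := regular P (slash K f s).

Lemma mone_slash K f z : upper z -> slash K f mone z = f z.
Proof.
  intros Hz. unfold slash. rewrite mobius_mone. unfold jpow. rewrite jfac_det1 by apply mdet_mone.
  replace (denom mone z) with (RtoC 1) by (unfold denom, mone; simpl; ring).
  rewrite csqrt_1, Czpow_1. field.
Qed.

Lemma mobius_upper_triangular u z : mdet u = 1 -> mc u = 0 ->
  mobius u z = (RtoC (ma u * ma u) * z + RtoC (ma u * mb u))%C.
Proof.
  intros Hu H0. unfold mobius. rewrite H0. unfold mdet in Hu. rewrite H0 in Hu.
  assert (Hd : md u <> 0) by (intros E; rewrite E in Hu; lra).
  assert (HdC : RtoC (md u) <> 0%C) by (intros E; apply RtoC_inj in E; contradiction).
  assert (E : (RtoC (ma u) * RtoC (md u) = 1)%C) by (rewrite <- RtoC_mult; f_equal; lra).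
  replace (RtoC 0 * z + RtoC (md u))%C with (RtoC (md u)) by ring. rewrite !RtoC_mult.
  replace ((RtoC (ma u) * z + RtoC (mb u)) / RtoC (md u))%C
    with ((RtoC (ma u) * RtoC (md u)) * (RtoC (ma u) * z + RtoC (mb u)) / RtoC (md u))%C by
      (rewrite E; field; exact HdC).
  field. exact HdC.
Qed.

Lemma jpow_upper_triangular K u z w : mdet u = 1 -> mc u = 0 -> jpow K u z = jpow K u w.
Proof.
  intros Hu H0. unfold jpow. rewrite !jfac_det1 by exact Hu. unfold denom. rewrite H0.
  replace (RtoC 0 * z + RtoC (md u))%C with (RtoC 0 * w + RtoC (md u))%C by ring. reflexivity.
Qed.

Lemma regular_upper_triangular P K f u : excluded_exponents P -> mdet u = 1 -> mc u = 0 ->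
  (exists p q : nat, (0 < p)%nat /\ (0 < q)%nat /\ ma u * ma u = INR p / INR q) ->
  regular P f -> regular P (slash K f u).
Proof.
  intros HP Hu H0 (p & q & Hp & Hq & Hpq) [c [Hc Hr]].
  assert (Ha : 0 < ma u * ma u) by (rewrite Hpq; apply Rdiv_lt_0_compat; apply INR_gt_0;
    assumption).
  apply (regular_ext P (fun z => / jpow K u Ci * f (RtoC (ma u * ma u) * z + RtoC (ma u * mb
    u)))%C).
  { intros z Hz. unfold slash.
    rewrite mobius_upper_triangular, (jpow_upper_triangular K u z Ci) by assumption. reflexivity. }
  apply regular_scal.
  exists (fun r => c (r / (ma u * ma u))%R * e1 (r / (ma u * ma u) * (ma u * mb u))%R)%C. split.
  - apply (has_qexp_affine f c _ _ p q); assumption.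
  - intros r Hr'. rewrite Hr; [ring|]. apply excluded_scale; assumption.
Qed.

Lemma slash_slash K f g h : mdet g = 1 -> mdet h = 1 -> exists e : C,
  forall z, upper z -> slash K (slash K f g) h z = (e * slash K f (mmul g h) z)%C.
Proof.
  intros Hg Hh. destruct (jpow_cocycle K g h Hg Hh) as [e [He H]]. exists (/ e)%C. intros z Hz.
  unfold slash. rewrite mobius_mmul by assumption.
  replace (/ jpow K h z * (/ jpow K g (mobius h z) * f (mobius g (mobius h z))))%C
    with (/ (jpow K g (mobius h z) * jpow K h z) * f (mobius g (mobius h z)))%C.
  - rewrite (H z Hz). field.
    split; [apply jpow_neq_0; [rewrite mdet_mmul, Hg, Hh; ring | exact Hz] | exact He].
  - field. split; apply jpow_neq_0; auto. apply mobius_upper; assumption.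
Qed.

Section AtCusps.
Variables (P : R -> Prop) (K : Z) (Ghat G' : mat2 -> Prop) (nu' : mat2 -> C).
Hypotheses (HP : excluded_exponents P) (Hhat : commensurable Ghat) (HG' : subgroup_SL2R G')
  (Hsub : subset G' Ghat).
Hypothesis (HF : automorphy_factor K G' nu').

(** Write [g s = s' u] with [u] upper triangular: the term of [g] is at [s] what [f]
    is at [s']. *)
Lemma trace_term_regular_at_cusp f g s : G' g -> SL2Z s -> nu' g <> 0%C ->
  (forall s', SL2Z s' -> mc (mmul (minv s') (mmul g s)) = 0 -> regular_at_cusp P K f s') ->
  regular_at_cusp P K (fun z => trace_term K nu' f z g) s.
Proof.
  intros Hg Hs Hn H. assert (Hgh := Hsub g Hg).
  destruct (cusp_image Ghat g s Hhat Hgh Hs) as (s' & Hs' & H0).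
  assert (Hrat := cusp_scaling_rational Ghat g s s' Hhat Hgh Hs Hs' H0).
  specialize (H s' Hs' H0). set (u := mmul (minv s') (mmul g s)) in *.
  assert (Hdg : mdet g = 1) by (apply HG', Hg). assert (Hds : mdet s = 1) by apply Hs.
  assert (Hds' : mdet s' = 1) by apply Hs'.
  assert (Hdu : mdet u = 1) by (unfold u; rewrite !mdet_mmul, mdet_minv, Hdg,
    Hds by assumption; ring).
  assert (Eu : mmul s' u = mmul g s) by (unfold u; rewrite <- mmul_assoc, mmul_minv_r,
    mmul_1_l by assumption; reflexivity).
  assert (R1 := regular_upper_triangular P K _ u HP Hdu H0 Hrat H).
  destruct (slash_slash K f s' u Hds' Hdu) as [e1 E1].
  destruct (slash_slash K f g s Hdg Hds) as [e2 E2].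
  destruct (jpow_cocycle K s' u Hds' Hdu) as [e [He Hj]].
  assert (R2 : regular P (slash K f (mmul g s))).
  { apply (regular_ext P (fun z => e * slash K (slash K f s') u z)%C); [|apply regular_scal, R1].
    intros z Hz. unfold slash. rewrite <- Eu, mobius_mmul by assumption.
    replace (jpow K (mmul s' u) z) with (/ e * (jpow K s' (mobius u z) * jpow K u z))%C by (rewrite
      (Hj z Hz); field; exact He).
    field. repeat split; try apply jpow_neq_0; auto. apply mobius_upper; assumption. }
  apply (regular_ext P (fun z => / nu' g * (e2 * slash K f (mmul g s) z))%C); [|do 2 apply
    regular_scal; exact R2].
  intros z Hz. rewrite <- E2 by exact Hz. unfold slash, trace_term, factor. field.
  assert (Hsz := mobius_upper s z Hds Hz). repeat split; try apply jpow_neq_0; auto.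
Qed.

Lemma regular_at_equivalent_cusp f s : modular K G' nu' f -> regular P f -> SL2Z s ->
  infinite_cusp G' s ->
  regular_at_cusp P K f s.
Proof.
  intros Hf Hr Hs (g & Hg & H0). assert (Hgh := Hsub g Hg).
  assert (Hdg : mdet g = 1) by (apply HG', Hg). assert (Hds : mdet s = 1) by apply Hs.
  assert (Eone : mmul (minv mone) (mmul g s) = mmul g s).
  { replace (minv mone) with mone; [apply mmul_1_l|].
    apply minv_unique; [apply mdet_mone | apply mmul_1_l]. }
  assert (Hrat := cusp_scaling_rational Ghat g s mone Hhat Hgh Hs (proj1 (proj2 SL2Z_subgroup))).
  rewrite Eone in Hrat. specialize (Hrat H0).
  set (u := mmul g s) in *.
  assert (Hdu : mdet u = 1) by (unfold u; rewrite mdet_mmul, Hdg, Hds; ring).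
  assert (Hgi : G' (minv g)) by (apply HG', Hg). assert (Hdgi := mdet_minv g Hdg).
  assert (Es : mmul (minv g) u = s) by (unfold u; rewrite <- mmul_assoc, mmul_minv_l,
    mmul_1_l by assumption; reflexivity).
  destruct (jpow_cocycle K (minv g) u Hdgi Hdu) as [e [He Hj]]. rewrite Es in Hj.
  apply (regular_ext P (fun z => (nu' (minv g) * e) * slash K f u z)%C);
    [|apply regular_scal, regular_upper_triangular; assumption].
  intros z Hz. assert (Huz := mobius_upper u z Hdu Hz). unfold slash. rewrite <- Es at 2.
  rewrite mobius_mmul by assumption. rewrite (Hf _ _ Hgi Huz).
  replace (jpow K s z) with (/ e * (jpow K (minv g)
    (mobius u z) * jpow K u z))%C by (rewrite (Hj z Hz); field; exact He).
  field. repeat split; try apply jpow_neq_0; auto.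
Qed.
End AtCusps.

(** * The cosets that fix the cusp oo *)
Definition plus_minus_trans (r : R) (t : mat2) : Prop := t = mtrans r \/ t = mopp (mtrans r).

Lemma plus_minus_trans_det r t : plus_minus_trans r t -> mdet t = 1.
Proof. intros [-> | ->]; [|rewrite mdet_mopp]; apply mdet_mtrans. Qed.
Lemma plus_minus_trans_mc r t : plus_minus_trans r t -> mc t = 0.
Proof. intros [-> | ->]; unfold mopp, mtrans; simpl; ring. Qed.
Lemma plus_minus_trans_mobius r t z : upper z -> plus_minus_trans r t ->
  mobius t z = (z + RtoC r)%C.
Proof.
  intros Hz H.
  assert (E : mobius (mtrans r) z = (z + RtoC r)%C) by (unfold mobius,
    mtrans; simpl; field; intros E; apply C1_nz; rewrite <- E; ring).
  destruct H as [-> | ->]; [exact E|]. rewrite mobius_mopp by (auto using mdet_mtrans). exact E.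
Qed.

Lemma plus_minus_trans_mul r s t u : plus_minus_trans r t -> plus_minus_trans s u ->
  plus_minus_trans (r + s) (mmul t u).
Proof.
  intros [-> | ->] [-> | ->]; rewrite ?mmul_mopp_l, ?mmul_mopp_r, ?mopp_mopp,
    mtrans_mul; [left | right | right | left]; reflexivity.
Qed.

Lemma plus_minus_trans_inv r t : plus_minus_trans r t -> plus_minus_trans (- r) (minv t).
Proof.
  intros [-> | ->].
  - left. apply mtrans_minv.
  - right. symmetry. apply minv_unique; [rewrite mdet_mopp; apply mdet_mtrans|].
    rewrite mmul_mopp_l, mmul_mopp_r, mopp_mopp, mtrans_mul, Rplus_opp_r. reflexivity.
Qed.

Lemma plus_minus_trans_eq r t u : plus_minus_trans r t -> plus_minus_trans r u ->
  u = t \/ u = mopp t.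
Proof.
  intros [-> | ->] [-> | ->]; rewrite ?mopp_mopp; auto.
Qed.

Lemma width_unique G w w1 : is_width G w -> is_width G w1 -> w1 = w.
Proof.
  intros [Hw H] [Hw1 H1].
  destruct (proj1 (H w1)) as [n Hn]; [apply H1; exists 1%Z; ring|].
  destruct (proj1 (H1 w)) as [m Hm]; [apply H; exists 1%Z; ring|].
  assert (Hnm : (n * m = 1)%Z).
  { apply eq_IZR. rewrite mult_IZR. apply Rmult_eq_reg_r with w; [|lra]. rewrite Hn in Hm. lra. }
  assert (Hn0 : 0 < IZR n) by nra. apply lt_IZR in Hn0.
  destruct (Z.mul_eq_1 n m Hnm) as [-> | ->]; [lra | lia].
Qed.

Lemma csqrt_m1 : csqrt (RtoC (-1)) = Ci.
Proof.
  unfold csqrt. rewrite Cmod_R, Rabs_left by lra. simpl.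
  replace ((- -1 + -1) / 2) with 0 by field. replace ((- -1 - -1) / 2) with 1 by field.
  rewrite sqrt_1, sqrt_0. destruct (Rle_dec 0 0); [|lra]. unfold Ci. f_equal. ring.
Qed.

Lemma jpow_trans K r z : jpow K (mtrans r) z = 1%C.
Proof.
  unfold jpow. rewrite jfac_det1 by apply mdet_mtrans.
  replace (denom (mtrans r) z) with (RtoC 1) by (unfold denom, mtrans; simpl; ring).
  rewrite csqrt_1. apply Czpow_1.
Qed.

Lemma jpow_opp_trans K r z : jpow K (mopp (mtrans r)) z = Czpow Ci K.
Proof.
  unfold jpow. rewrite jfac_det1 by (rewrite mdet_mopp; apply mdet_mtrans).
  replace (denom (mopp (mtrans r)) z) with (RtoC (-1)); [rewrite csqrt_m1; reflexivity|].
  unfold denom, mopp, mtrans; simpl. replace (- 0) with 0 by ring.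
  replace (Ropp 1) with (-1) by ring. ring.
Qed.

Section Exponents.
Variables (K : Z) (G : mat2 -> Prop) (nu : mat2 -> C).
Hypotheses (HG : subgroup_SL2R G) (HF : automorphy_factor K G nu).

Lemma shift_iff w s t z : G t -> plus_minus_trans w t -> upper z ->
  (is_shift K G nu w s <-> 0 <= s < 1 /\ e1 s = factor K nu t z).
Proof.
  intros Ht Hpm Hz.
  assert (E1 : G (mtrans w) -> factor K nu t z = nu (mtrans w)).
  { intros H.
    replace (nu (mtrans w)) with (factor K nu (mtrans w) z) by (unfold factor; rewrite jpow_trans;
      ring).
    destruct Hpm as [-> | ->]; [reflexivity|]. apply (factor_mopp K G nu HG HF); assumption. }
  assert (E2 : ~ G (mtrans w) -> factor K nu t z = (nu (mopp (mtrans w)) * Czpow Ci K)%C).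
  { intros H. destruct Hpm as [-> | ->]; [contradiction|]. unfold factor. rewrite jpow_opp_trans.
    reflexivity. }
  unfold is_shift. fold (e1 s). split.
  - intros (Hs & H1 & H2). split; [exact Hs|]. destruct (classic (G (mtrans w))) as [H|H].
    + rewrite E1 by exact H. auto.
    + rewrite E2 by exact H. auto.
  - intros [Hs E]. split; [exact Hs|]. split; intros H; [rewrite <- E1 | rewrite <- E2]; assumption.
Qed.

(** [x] is an exponent iff the translation by the width acts on [q^x] as the
    automorphy factor prescribes. *)
Lemma exponents_iff w t z x : is_width G w -> G t -> plus_minus_trans w t -> upper z ->
  (exponents K G nu x <-> e1 (x * w) = factor K nu t z).
Proof.
  intros Hw Ht Hpm Hz. split.
  - intros (w1 & s & Hw1 & Hs & n & ->). rewrite (width_unique G w w1 Hw Hw1) in *.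
    apply (shift_iff w s t z Ht Hpm Hz) in Hs. destruct Hs as [_ <-].
    destruct Hw as [Hw _]. replace ((IZR n + s) / w * w) with (IZR n + s) by (field; lra).
    rewrite e1_plus, e1_int. ring.
  - intros E. destruct (base_Int_part (x * w)) as [B1 B2]. set (n := Int_part (x * w)) in *.
    exists w, (x * w - IZR n). split; [exact Hw|]. split.
    + apply (shift_iff w _ t z Ht Hpm Hz). split; [lra|]. unfold Rminus.
      rewrite e1_plus, e1_opp, e1_int, E. field.
    + exists n. destruct Hw as [Hw _]. field. lra.
Qed.
End Exponents.

Lemma geometric_sum W (om : C) : (sum_over (seq 0 W)
  (fun j => Cpow om j) * (om - 1) = Cpow om W - 1)%C.
Proof.
  induction W as [|W IH].
  - unfold sum_over; simpl. ring.
  - rewrite seq_S, sum_over_app, Cmult_plus_distr_r, IH. unfold sum_over; simpl. ring.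
Qed.

Lemma root_of_unity_sum W (om : C) : om <> 1%C -> Cpow om W = 1%C ->
  sum_over (seq 0 W) (fun j => Cpow om j) = 0%C.
Proof.
  intros H1 H2. assert (G := geometric_sum W om). rewrite H2 in G.
  apply NNPP. intros Hn. apply (Cmult_neq_0 _ (om - 1) Hn); [|rewrite G; ring].
  intros E. apply H1. replace om with (om - 1 + 1)%C by ring. rewrite E. ring.
Qed.

Lemma trivial_root_sum W : sum_over (seq 0 W) (fun j => Cpow 1 j) = RtoC (INR W).
Proof.
  induction W as [|W IH]; [reflexivity|]. rewrite seq_S, sum_over_app, IH, S_INR, RtoC_plus.
  unfold sum_over; simpl.
  rewrite <- RtoC_pow, pow1. ring.
Qed.

Section InfiniteCosets.
Variables (K : Z) (G G' : mat2 -> Prop) (nu nu' : mat2 -> C) (w w' : R).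
Hypotheses (HG : subgroup_SL2R G) (HG' : subgroup_SL2R G') (Hsub : subset G G').
Hypothesis (HF : automorphy_factor K G' nu').
Hypothesis (Hext : forall g, G g -> nu' g = nu g).
Hypotheses (Hw : is_width G w) (Hw' : is_width G' w').

Lemma width_multiple : exists W : nat, (0 < W)%nat /\ w = INR W * w'.
Proof.
  destruct Hw as [Hw0 H], Hw' as [Hw0' H'].
  destruct (proj1 (H' w)) as [n Hn].
  { destruct (proj2 (H w)) as [X|X]; [exists 1%Z; ring | left | right]; apply Hsub, X. }
  assert (Hn0 : 0 < IZR n) by nra. apply lt_IZR in Hn0.
  exists (Z.to_nat n). split; [lia|]. rewrite INR_IZR_INZ, Z2Nat.id by lia. exact Hn.
Qed.

Lemma width_generator (H : mat2 -> Prop) r : is_width H r -> exists t, H t /\ plus_minus_trans r t.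
Proof.
  intros [_ Hr]. destruct (proj2 (Hr r)) as [X|X].
  - exists 1%Z. ring.
  - exists (mtrans r). split; [exact X | left; reflexivity].
  - exists (mopp (mtrans r)). split; [exact X | right; reflexivity].
Qed.

Variables (W : nat) (T : mat2).
Hypotheses (HW : w = INR W * w') (HT : G' T) (HpmT : plus_minus_trans w' T).

(** The coset of [g] maps oo to a cusp that is [G]-equivalent to oo. *)
Definition infinite_coset (g : mat2) : Prop := exists h, G h /\ mc (mmul h g) = 0.

Lemma power_trans j : plus_minus_trans (INR j * w') (mpow T j).
Proof.
  induction j as [|j IH].
  - left. unfold mpow, mone, mtrans; simpl. f_equal. ring.
  - change (mpow T (S j)) with (mmul T (mpow T j)). rewrite S_INR.
    replace ((INR j + 1) * w') with (w' + INR j * w') by ring.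
    apply plus_minus_trans_mul; assumption.
Qed.

Lemma same_coset_power i j : same_coset G (mpow T i) (mpow T j) ->
  exists n : Z, INR i - INR j = IZR n * INR W.
Proof.
  intros H. unfold same_coset in H.
  assert (Hp := plus_minus_trans_mul _ _ _ _ (power_trans i)
    (plus_minus_trans_inv _ _ (power_trans j))).
  set (t := mmul (mpow T i) (minv (mpow T j))) in *.
  assert (Hin : pm G (mtrans (INR i * w' + - (INR j * w')))).
  { destruct Hp as [E|E]; rewrite E in H; [exact H|].
    destruct H as [H|H]; [right; exact H | left; rewrite mopp_mopp in H; exact H]. }
  apply Hw in Hin. destruct Hin as [n Hn]. exists n. destruct Hw' as [Hw0' _]. rewrite HW in Hn.
  apply Rmult_eq_reg_r with w'; lra.
Qed.

Lemma infinite_coset_power j : infinite_coset (mpow T j).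
Proof.
  exists mone. split; [apply HG|]. rewrite mmul_1_l.
  apply (plus_minus_trans_mc _ _ (power_trans j)).
Qed.

Lemma infinite_coset_same g r : G' g -> G' r -> same_coset G g r -> infinite_coset g ->
  infinite_coset r.
Proof.
  intros Hg Hr H (h & Hh & H0). assert (Hdr : mdet r = 1) by (apply HG', Hr).
  destruct H as [H|H].
  - exists (mmul h (mmul g (minv r))). split; [apply HG; assumption|].
    rewrite mmul_assoc, mmul_minvK' by exact Hdr. exact H0.
  - exists (mmul h (mopp (mmul g (minv r)))). split; [apply HG; assumption|].
    rewrite mmul_mopp_r, mmul_mopp_l, mmul_assoc, mmul_minvK' by exact Hdr.
    change (- mc (mmul h g) = 0). rewrite H0. ring.
Qed.

Lemma infinite_coset_represented (HW0 : (0 < W)%nat) r : G' r -> infinite_coset r ->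
  exists j, (j < W)%nat /\ same_coset G r (mpow T j).
Proof.
  intros Hr (h & Hh & H0).
  assert (Hdr : mdet r = 1) by (apply HG', Hr). assert (Hdh : mdet h = 1) by (apply HG, Hh).
  destruct (stabiliser_infinity G' w' (mmul h r) HG' Hw') as [n Hn].
  { apply HG'; [apply Hsub, Hh | exact Hr]. }
  { exact H0. }
  change (plus_minus_trans (IZR n * w') (mmul h r)) in Hn.
  set (j := Z.to_nat (n mod Z.of_nat W)).
  assert (Hmod := Z.mod_pos_bound n (Z.of_nat W) ltac:(lia)).
  assert (Hdiv := Z.div_mod n (Z.of_nat W) ltac:(lia)).
  exists j. split; [unfold j; lia|].
  assert (Hp := plus_minus_trans_mul _ _ _ _ Hn (plus_minus_trans_inv _ _ (power_trans j))).
  assert (Ej : IZR n * w' + - (INR j * w') = IZR (n / Z.of_nat W) * w).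
  { rewrite HW. unfold j. rewrite !INR_IZR_INZ, Z2Nat.id by lia.
    apply (f_equal IZR) in Hdiv. rewrite plus_IZR, mult_IZR in Hdiv. rewrite Hdiv at 1. ring. }
  rewrite Ej in Hp.
  assert (Hin : pm G (mmul (mmul h r) (minv (mpow T j)))).
  { assert (X : pm G (mtrans (IZR (n / Z.of_nat W) * w))) by (apply Hw; eexists; reflexivity).
    destruct Hp as [-> | ->]; [exact X|].
    destruct X as [X|X]; [right; rewrite mopp_mopp; exact X | left; exact X]. }
  unfold same_coset.
  replace (mmul r (minv (mpow T j))) with (mmul (minv h) (mmul (mmul h r) (minv (mpow T j)))).
  - apply (pm_subgroup G HG); [apply (pm_subgroup G HG); left; exact Hh | exact Hin].
  - rewrite <- !mmul_assoc, mmul_minv_l, mmul_1_l by exact Hdh. reflexivity.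
Qed.

Definition is_infinite_coset (g : mat2) : bool :=
  if excluded_middle_informative (infinite_coset g) then true else false.
(** Representatives of all cosets, chosen as the first [W] powers of the generating
    translation of [G'] for those that fix the cusp oo. *)
Definition adapted_reps (reps : list mat2) : list mat2 :=
  map (mpow T) (seq 0 W) ++ filter (fun g => negb (is_infinite_coset g)) reps.

Lemma in_finite_part reps g : In g (filter (fun g => negb (is_infinite_coset g)) reps) <-> In g
  reps /\ ~ infinite_coset g.
Proof.
  rewrite filter_In. unfold is_infinite_coset.
  destruct (excluded_middle_informative (infinite_coset g)); simpl; intuition congruence.
Qed.

Lemma power_injective i j : (i < W)%nat -> (j < W)%nat -> same_coset G (mpow T i) (mpow T j) ->
  i = j.
Proof.
  intros Hi Hj H. destruct (same_coset_power i j H) as [n Hn].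
  rewrite !INR_IZR_INZ, <- minus_IZR, <- mult_IZR in Hn. apply eq_IZR in Hn.
  destruct (Z.lt_trichotomy n 0) as [L|[->|L]]; [nia | lia | nia].
Qed.

Lemma power_in_G' j : G' (mpow T j).
Proof. apply mpow_in; assumption. Qed.

Lemma adapted_coset_reps reps : (0 < W)%nat -> coset_reps G G' reps ->
  coset_reps G G' (adapted_reps reps).
Proof.
  intros HW0 HR. assert (HR' := HR). destruct HR' as (ND & Hin & Hex).
  assert (Hin' : forall r, In r (adapted_reps reps) ->
     (exists j, (j < W)%nat /\ r = mpow T j) \/ (In r reps /\ ~ infinite_coset r)).
  { intros r Hr. unfold adapted_reps in Hr. apply in_app_or in Hr. destruct Hr as [Hr|Hr].
    - left. apply in_map_iff in Hr. destruct Hr as [j [<- Hj]]. apply in_seq in Hj. exists j.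
      split; [lia | reflexivity].
    - right. apply in_finite_part, Hr. }
  assert (HinG : forall r, In r (adapted_reps reps) -> G' r).
  { intros r Hr. destruct (Hin' r Hr) as [[j [_ ->]]|[H _]]; [apply power_in_G' | auto]. }
  split; [|split].
  - apply NoDup_app.
    + apply NoDup_map_in; [apply seq_NoDup|]. intros i j Hi Hj E. apply in_seq in Hi.
      apply in_seq in Hj.
      apply power_injective; try lia. rewrite E. apply (same_coset_refl G G' HG HG'), power_in_G'.
    + apply NoDup_filter, ND.
    + intros g Hg Hg'. apply in_finite_part in Hg'. apply in_map_iff in Hg.
      destruct Hg as [j [<- _]].
      apply (proj2 Hg'), infinite_coset_power.
  - exact HinG.
  - intros g Hg.
    assert (Hu : forall x y, In x (adapted_reps reps) ->
       In y (adapted_reps reps) ->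
       same_coset G g x -> same_coset G g y -> x = y).
    { intros x y Hx Hy Hgx Hgy. assert (Gx := HinG x Hx). assert (Gy := HinG y Hy).
      assert (Hxy : same_coset G x y).
      { apply (same_coset_trans G G' HG HG' x g y Hg); [apply (same_coset_sym G G' HG HG');
          assumption | exact Hgy]. }
      assert (Hyx : same_coset G y x) by (apply (same_coset_sym G G' HG HG'); assumption).
      destruct (Hin' x Hx) as [[i [Hi ->]]|[Rx Nx]]; destruct (Hin' y Hy) as [[j [Hj ->]]|[Ry Ny]].
      - f_equal. apply power_injective; assumption.
      - exfalso. apply Ny. apply (infinite_coset_same (mpow T i) y); auto.
        apply infinite_coset_power.
      - exfalso. apply Nx. apply (infinite_coset_same (mpow T j) x); auto.
        apply infinite_coset_power.
      - apply (coset_reps_unique G G' reps g); assumption. }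
    destruct (Hex g Hg) as [r [[Hr1 Hr2] _]]. assert (Gr := Hin r Hr1).
    destruct (classic (infinite_coset r)) as [Hi|Hi].
    + destruct (infinite_coset_represented HW0 r Gr Hi) as [j [Hj Hs]].
      assert (Hj' : In (mpow T j) (adapted_reps reps)).
      { apply in_or_app. left. apply in_map, in_seq. lia. }
      assert (Hgj : same_coset G g (mpow T j)) by (apply (same_coset_trans G G' HG HG' g r _ Gr);
        assumption).
      exists (mpow T j). split; [split; assumption|]. intros y [Hy1 Hy2]. apply Hu; assumption.
    + assert (Hr' : In r (adapted_reps reps)).
      { apply in_or_app. right. apply in_finite_part. auto. }
      exists r. split; [split; assumption|]. intros y [Hy1 Hy2]. apply Hu; assumption.
Qed.

Lemma factor_translation_constant t r z y : G' t -> plus_minus_trans r t ->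
  factor K nu' t z = factor K nu' t y.
Proof.
  intros Ht Hp. unfold factor. rewrite (jpow_upper_triangular K t z y); [reflexivity | |].
  - apply (plus_minus_trans_det _ _ Hp).
  - apply (plus_minus_trans_mc _ _ Hp).
Qed.

Lemma factor_power j z : upper z -> factor K nu' (mpow T j) z = Cpow (factor K nu' T Ci) j.
Proof.
  intros Hz. induction j as [|j IH].
  - apply (factor_scalar HF); [apply HG' | | exact Hz]. unfold mscalar, mone; simpl. auto.
  - change (mpow T (S j)) with (mmul T (mpow T j)).
    rewrite (factor_mmul HF); [|exact HT|apply power_in_G'|exact Hz].
    rewrite IH. simpl. f_equal. apply (factor_translation_constant T w'); assumption.
Qed.

Lemma trace_term_power f j z : upper z ->
  trace_term K nu' f z (mpow T j) = (/ Cpow (factor K nu' T Ci) j * f (z + RtoC (INR j * w')))%C.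
Proof.
  intros Hz. unfold trace_term.
  rewrite factor_power, (plus_minus_trans_mobius _ _ z Hz (power_trans j)) by exact Hz. reflexivity.
Qed.

(** [q^r] occurs in forms for [G'] iff this is 1, and in forms for [G] iff its
    [W]-th power is 1. *)
Definition character_ratio (r : R) : C := (e1 (r * w') / factor K nu' T Ci)%C.

Lemma upper_Ci : upper Ci.
Proof. unfold upper; simpl; lra. Qed.

Lemma exponents_character r : exponents K G' nu' r <-> character_ratio r = 1%C.
Proof.
  assert (N := factor_neq_0 HF T Ci HT upper_Ci).
  rewrite (exponents_iff K G' nu' HG' HF w' T Ci r Hw' HT HpmT upper_Ci). unfold character_ratio.
  split; intros E.
  - rewrite E. field. exact N.
  - replace (e1 (r * w')) with (e1 (r * w') / factor K nu' T Ci * factor K nu' T Ci)%C by (field;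
      exact N). rewrite E. ring.
Qed.

Lemma exponents_character_pow r : exponents K G nu r <-> Cpow (character_ratio r) W = 1%C.
Proof.
  assert (N := factor_neq_0 HF T Ci HT upper_Ci).
  assert (HFG : automorphy_factor K G nu).
  { destruct HF as [F1 F2 F3 F4].
    assert (E : forall g z, G g -> factor K nu g z =
      factor K nu' g z) by (intros g z Hg; unfold factor; rewrite Hext by exact Hg; reflexivity).
    split.
    - intros g z Hg Hz. rewrite E by exact Hg. apply F1; auto.
    - intros g h z Hg Hh Hz. rewrite !E by (auto; apply HG; assumption). apply F2; auto.
    - intros g Hg z Hz. apply (cderivable_ext_loc (factor K nu' g)); [|apply F3; auto].
      exists 1. split; [lra|]. intros v _. symmetry. apply E, Hg.
    - intros g z Hg Hs Hz. rewrite E by exact Hg. apply F4; auto. }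
  destruct (width_generator G w Hw) as [t [Ht Hpt]].
  rewrite (exponents_iff K G nu HG HFG w t Ci r Hw Ht Hpt upper_Ci).
  assert (Ef : factor K nu t Ci = Cpow (factor K nu' T Ci) W).
  { rewrite <- (factor_power W Ci upper_Ci). assert (Hp := power_trans W). rewrite <- HW in Hp.
    transitivity (factor K nu' t Ci); [unfold factor; rewrite Hext by exact Ht; reflexivity|].
    destruct (plus_minus_trans_eq _ _ _ Hp Hpt) as [-> | ->]; [reflexivity|].
    apply (factor_mopp K G' nu' HG' HF); [apply power_in_G' | apply Hsub, Ht | exact upper_Ci]. }
  rewrite Ef. unfold character_ratio, Cdiv. rewrite Cpow_mult_l, e1_pow, Cpow_inv by exact N.
  replace (INR W * (r * w')) with (r * w) by (rewrite HW; ring).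
  assert (NW := Cpow_nz _ W N). split; intros E.
  - rewrite E. field. exact NW.
  - replace (e1 (r * w)) with (e1 (r * w) * / Cpow (factor K nu' T Ci) W * Cpow (factor K nu' T Ci)
      W)%C by (field; exact NW).
    rewrite E. ring.
Qed.
End InfiniteCosets.

(** * The trace of the canonical bases *)

Lemma modular_restrict K G G' nu nu' f : subset G G' -> (forall g, G g -> nu' g = nu g) ->
  modular K G' nu' f -> modular K G nu f.
Proof. intros Hs He H g z Hg Hz. rewrite <- He by exact Hg. apply H; auto. Qed.

Lemma qsum_sum A (l : list A) (c : A -> R -> C) z (v : A -> C) :
  (forall x, In x l -> is_qsum (c x) z (v x)) ->
    is_qsum (fun r => sum_over l (fun x => c x r)) z (sum_over l v).
Proof.
  induction l as [|x l IH]; intros H; [apply qsum_zero|].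
  apply (qsum_plus (c x) (fun r => sum_over l (fun x => c x r))).
  - apply H. left. reflexivity.
  - apply IH. intros y Hy. apply H. right. exact Hy.
Qed.

Lemma has_qexp_sum A (l : list A) (F : C -> A -> C) (c : A -> R -> C) :
  (forall x, In x l -> has_qexp (fun z => F z x) (c x)) ->
  has_qexp (fun z => sum_over l (F z)) (fun r => sum_over l (fun x => c x r)).
Proof. intros H z Hz. apply qsum_sum. intros x Hx. apply (H x Hx z Hz). Qed.

Lemma has_qexp_translate f c b : has_qexp f c ->
  has_qexp (fun z => f (z + RtoC b)%C) (fun r => c r * e1 (r * b)%R)%C.
Proof.
  intros H. assert (H1 := has_qexp_affine f c 1 b 1 1 ltac:(lia) ltac:(lia) ltac:(simpl; field) H).
  intros z Hz. specialize (H1 z Hz). cbv beta in H1.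
  replace (1 * z + b)%C with (z + b)%C in H1 by ring.
  revert H1. apply qsum_ext. intros r. replace (r / 1) with r by field. reflexivity.
Qed.

(** The canonical bases when the spaces of forms are trivial: [F m] is [q^(-m)] plus
    a series without excluded exponents. *)
Record reduced_family (P : R -> Prop) (K : Z) (G : mat2 -> Prop) (nu : mat2 -> C) (F : R -> C ->
  C) : Prop := {
  reduced_off : forall m, ~ (P (- m) /\ exponents K G nu (- m)) -> forall z, upper z -> F m z = 0%C;
  reduced_modular : forall m, modular K G nu (F m);
  reduced_holomorphic : forall m, holomorphic_upper (F m);
  reduced_cusps : forall m s, SL2Z s -> ~ infinite_cusp G s -> regular_at_cusp P K (F m) s;
  reduced_expansion : forall m, P (- m) -> exponents K G nu (- m) ->
    exists c, has_qexp (F m) c /\ c (- m) = 1%C /\ forall r, P r -> r <> - m -> c r = 0%C }.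

Arguments reduced_off {P K G nu F}.
Arguments reduced_modular {P K G nu F}.
Arguments reduced_holomorphic {P K G nu F}.
Arguments reduced_cusps {P K G nu F}.
Arguments reduced_expansion {P K G nu F}.

Section TraceOfBasis.
Variables (P : R -> Prop) (K : Z) (G Ghat G' : mat2 -> Prop) (nu nu' : mat2 ->
  C) (w w' : R) (F F' : R -> C -> C).
Hypotheses (HP : excluded_exponents P) (Hhat : commensurable Ghat).
Hypotheses (HG : subgroup_SL2R G) (HG' : subgroup_SL2R G') (Hsub : subset G G')
  (Hsub' : subset G' Ghat).
Hypothesis (HF : automorphy_factor K G' nu').
Hypothesis (Hnz : forall g, G' g -> nu' g <> 0%C).
Hypothesis (Hext : forall g, G g -> nu' g = nu g).
Hypotheses (Hw : is_width G w) (Hw' : is_width G' w').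
Hypothesis (Hvan : forall f, modular K G nu f -> holomorphic_upper f ->
  (forall s, SL2Z s -> regular_at_cusp P K f s) -> forall z, upper z -> f z = 0%C).
Hypotheses (HfamF : reduced_family P K G nu F) (HfamF' : reduced_family P K G' nu' F').

Lemma not_infinite_image g s s' : G' g -> SL2Z s' -> mdet s = 1 ->
  mc (mmul (minv s') (mmul g s)) = 0 ->
  infinite_cusp G s' -> exists h, G h /\ mc (mmul (mmul h g) s) = 0.
Proof.
  intros Hg Hs' Hds Hu (h & Hh & H0). exists h. split; [exact Hh|].
  assert (Hds' : mdet s' = 1) by apply Hs'.
  assert (E : mmul (mmul h g) s = mmul (mmul h s') (mmul (minv s') (mmul g s))).
  { rewrite !mmul_assoc. f_equal. rewrite <- mmul_assoc, mmul_minv_r, mmul_1_l by exact Hds'.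
    reflexivity. }
  rewrite E. set (a := mmul h s') in *. set (b := mmul (minv s') (mmul g s)) in *. clearbody a b.
  unfold mmul; simpl. rewrite Hu, H0. ring.
Qed.

Lemma trace_term_regular_infinity m g : G' g -> ~ infinite_coset G g ->
  regular P (fun z => trace_term K nu' (F m) z g).
Proof.
  intros Hg Hi.
  assert (R1 : regular_at_cusp P K (fun z => trace_term K nu' (F m) z g) mone).
  { apply (trace_term_regular_at_cusp P K Ghat G' nu' HP Hhat HG' Hsub'); auto.
    - apply SL2Z_subgroup.
    - intros s' Hs' Hu. apply (reduced_cusps HfamF); [exact Hs'|]. intros Hinf.
      destruct (not_infinite_image g mone s' Hg Hs' mdet_mone Hu Hinf) as (h & Hh & H0).
      rewrite mmul_1_r in H0. apply Hi. exists h. auto. }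
  revert R1. apply regular_ext. intros z Hz. apply mone_slash, Hz.
Qed.

(** Only the cosets that fix the cusp contribute excluded exponents. They multiply
    the coefficient of [q^r] by the sum of [om r ^ j] over [j < W], for a [W]-th
    root of unity [om r]: this is [W = w / w'] if [r] is an exponent for [G'], and 0
    otherwise. *)
Lemma difference_regular_infinity m reps : coset_reps G G' reps -> P (- m) ->
  exponents K G nu (- m) ->
  regular P (fun z => sum_over reps (trace_term K nu' (F m) z) + - RtoC (w / w') * F' m z)%C.
Proof.
  intros HR HPm Hm.
  destruct (width_multiple G G' w w' Hsub Hw Hw') as (W & HW0 & HW).
  destruct (width_generator G' w' Hw') as (T & HT & HpmT).
  assert (HA := adapted_coset_reps G G' w w' HG HG' Hsub Hw Hw' W T HW HT HpmT reps HW0 HR).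
  destruct (reduced_expansion HfamF m HPm Hm) as (c & Hc & Hc1 & Hc0).
  assert (Hmod := reduced_modular HfamF m).
  set (om := character_ratio K nu' w' T).
  set (S1 := fun z => sum_over (seq 0 W) (fun j => trace_term K nu' (F m) z (mpow T j))).
  set (c1 := fun r => (c r * sum_over (seq 0 W) (fun j => Cpow (om r) j))%C).
  assert (HfT := factor_neq_0 HF T Ci HT upper_Ci).
  assert (HS1 : has_qexp S1 c1).
  { assert (H1 : has_qexp S1 (fun r => sum_over (seq 0 W)
      (fun j => / Cpow (factor K nu' T Ci) j * (c r * e1 (r * (INR j * w'))))%C)).
    { apply (has_qexp_sum nat (seq 0 W) (fun z j => trace_term K nu' (F m) z (mpow T j))
        (fun j r => / Cpow (factor K nu' T Ci) j * (c r * e1 (r * (INR j * w'))))%C).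
      intros j _.
      apply (has_qexp_ext (fun z => / Cpow (factor K nu' T Ci) j * F m (z + RtoC (INR j * w')))%C).
      - intros z Hz. symmetry. apply (trace_term_power K G' nu' w' HG' HF T HT HpmT); exact Hz.
      - apply has_qexp_scal. apply (has_qexp_translate (F m) c (INR j * w')). exact Hc. }
    intros z Hz. generalize (H1 z Hz). apply qsum_ext. intros r. unfold c1.
    rewrite <- sum_over_scal.
    apply sum_over_ext. intros j _. unfold om, character_ratio, Cdiv.
    rewrite Cpow_mult_l, e1_pow, Cpow_inv by exact HfT.
    replace (INR j * (r * w')) with (r * (INR j * w')) by ring. ring. }
  set (others := filter (fun g => negb (is_infinite_coset G g)) reps).
  assert (HS2 : regular P (fun z => sum_over others (trace_term K nu' (F m) z))).
  { apply regular_sum. intros g Hg. apply in_finite_part in Hg. destruct Hg as [Hg Hi].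
    apply trace_term_regular_infinity; [apply HR, Hg | exact Hi]. }
  destruct HS2 as [c2 [HS2 Hc2]].
  assert (Hroot : Cpow (om (- m)) W = 1%C).
  { apply (exponents_character_pow K G G' nu nu' w w' HG HG' Hsub HF Hext Hw W T HW HT HpmT).
    exact Hm. }
  assert (HF' : exists c', has_qexp (F' m) c' /\ (forall r, P r -> r <> - m -> c' r = 0%C) /\
     sum_over (seq 0 W) (fun j => Cpow (om (- m)) j) = (RtoC (w / w') * c' (- m)%R)%C).
  { assert (HWw : w / w' = INR W) by (rewrite HW; field; destruct Hw' as [X _]; lra).
    destruct (classic (om (- m) = 1%C)) as [E|E].
    - assert (Hm' : exponents K G' nu' (- m)).
      { apply (exponents_character K G' nu' w' HG' HF Hw' T HT HpmT). exact E. }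
      destruct (reduced_expansion HfamF' m HPm Hm') as (c' & H1 & H2 & H3).
      exists c'. split; [exact H1|]. split; [exact H3|]. rewrite H2, E, trivial_root_sum, HWw. ring.
    - exists (fun _ => 0%C). split.
      + intros z Hz. rewrite (reduced_off HfamF' m); [apply qsum_zero | | exact Hz].
        intros [_ Hm']. apply E. apply (exponents_character K G' nu' w' HG' HF Hw' T HT HpmT).
        exact Hm'.
      + split; [reflexivity|]. rewrite (root_of_unity_sum W _ E Hroot). ring. }
  destruct HF' as (c' & H1 & H2 & H3).
  exists (fun r => (c1 r + c2 r) + - RtoC (w / w') * c' r)%C. split.
  - apply (has_qexp_ext (fun z => (S1 z + sum_over others (trace_term K nu' (F m) z)) + - RtoC (w /
      w') * F' m z)%C).
    + intros z Hz. f_equal. unfold S1.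
      rewrite <- (sum_over_map nat mat2 (seq 0 W) (mpow T)
        (trace_term K nu' (F m) z)), <- sum_over_app.
      apply (coset_sum_unique G G' HG HG'); [exact HA | exact HR|].
      intros g r Hg Hr Hs. apply (trace_term_coset K G G' nu nu' HG HG' Hsub HF Hext); assumption.
    + apply has_qexp_plus; [apply has_qexp_plus; assumption|]. apply has_qexp_scal, H1.
  - intros r Hr. rewrite (Hc2 r Hr). unfold c1. destruct (Req_dec r (- m)) as [->|Hne].
    + rewrite H3, Hc1. ring.
    + rewrite (Hc0 r Hr Hne), (H2 r Hr Hne). ring.
Qed.

(** The difference of the two sides is a form for [G] without excluded exponents at
    any cusp, hence zero. *)
Theorem trace_of_basis m reps z : coset_reps G G' reps -> upper z ->
  sum_over reps (trace_term K nu' (F m) z) = (RtoC (w / w') * F' m z)%C.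
Proof.
  intros HR Hz.
  destruct (classic (P (- m) /\ exponents K G nu (- m))) as [[HPm Hm]|Hoff].
  - set (D := fun z => (sum_over reps (trace_term K nu' (F m) z) + - RtoC (w / w') * F' m z)%C).
    assert (Hmod : modular K G' nu' D).
    { intros g v Hg Hv. unfold D.
      rewrite (trace_modular K G G' nu nu' HG HG' Hsub HF Hext (F m) reps (reduced_modular HfamF m)
        HR g v Hg Hv).
      rewrite (reduced_modular HfamF' m g v Hg Hv). ring. }
    assert (E : D z = 0%C).
    { apply Hvan; [| | |exact Hz].
      - apply (modular_restrict K G G' nu nu'); assumption.
      - intros v Hv. apply cderivable_plus.
        + apply (sum_over_closed _ _ holomorphic_upper reps (trace_term K nu' (F m))); [| | |exact
            Hv].
          { intros u _. apply cderivable_const. }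
          { intros f g Hf Hg u Hu. apply cderivable_plus; auto. }
          intros g Hg.
          apply (trace_term_holomorphic K G' nu' HG' HF); [apply (reduced_holomorphic HfamF) |
            apply HR, Hg].
        + apply cderivable_mult; [apply cderivable_const | apply (reduced_holomorphic HfamF'), Hv].
      - intros s Hs. assert (Hds : mdet s = 1) by apply Hs.
        destruct (classic (infinite_cusp G' s)) as [Hi|Hi].
        + apply (regular_at_equivalent_cusp P K Ghat G' nu' HP Hhat HG' Hsub'); auto.
          apply difference_regular_infinity; assumption.
        + apply (regular_ext P (fun z => sum_over reps (fun g => slash K (fun z => trace_term K nu'
            (F m) z g) s z)
              + - RtoC (w / w') * slash K (F' m) s z)%C).
          * intros v Hv. unfold D, slash. rewrite sum_over_scal. ring.
          * apply regular_plus; [|apply regular_scal, (reduced_cusps HfamF'); assumption].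
            apply (regular_sum P mat2 reps (fun z g => slash K (fun z => trace_term K nu' (F m) z
              g) s z)).
            intros g Hg. assert (Hg' : G' g) by (apply HR, Hg).
            apply (trace_term_regular_at_cusp P K Ghat G' nu' HP Hhat HG' Hsub'); auto.
            intros s' Hs' Hu. apply (reduced_cusps HfamF); [exact Hs'|]. intros Hinf.
            destruct (not_infinite_image g s s' Hg' Hs' Hds Hu Hinf) as (h & Hh & H0).
            apply Hi. exists (mmul h g). split; [apply HG'; auto | exact H0]. }
    unfold D in E.
    replace (sum_over reps (trace_term K nu' (F m) z))
      with (sum_over reps (trace_term K nu' (F m) z) + - RtoC (w / w') * F' m z + RtoC (w / w') *
        F' m z)%C by ring.
    rewrite E. ring.
  - destruct (width_multiple G G' w w' Hsub Hw Hw') as (W & HW0 & HW).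
    destruct (width_generator G' w' Hw') as (T & HT & HpmT).
    rewrite (reduced_off HfamF' m); [|intros [HPm Hm']; apply Hoff; split; [exact HPm|]|exact Hz].
    + rewrite (sum_over_ext _ _ _ (fun _ => RtoC 0 * RtoC 0)%C), sum_over_scal; [ring|].
      intros g Hg. unfold trace_term. rewrite (reduced_off HfamF m Hoff); [ring|].
      apply mobius_upper; [apply HG', HR, Hg | exact Hz].
    + apply (exponents_character_pow K G G' nu nu' w w' HG HG' Hsub HF Hext Hw W T HW HT HpmT).
      apply (exponents_character K G' nu' w' HG' HF Hw' T HT HpmT) in Hm'. rewrite Hm'.
      rewrite <- RtoC_pow, pow1. reflexivity.
Qed.
End TraceOfBasis.

(** * The generating functions *)
Lemma orders_trivial V x : trivial_space V -> ~ orders V x.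
Proof. intros HV (f & c & Hf & Hc & Hne & Hx). apply Hne.
apply (leading_coefficient_zero f c); auto. Qed.

Definition negative (r : R) : Prop := r < 0.
Definition nonpositive (r : R) : Prop := r <= 0.
Lemma excluded_negative : excluded_exponents negative.
Proof. split; unfold negative; intros; lra. Qed.
Lemma excluded_nonpositive : excluded_exponents nonpositive.
Proof. split; unfold nonpositive; intros; lra. Qed.

(** Modular forms without excluded exponents: [Mform] and [Sform] are the two
    instances. *)
Definition forms_without (P : R -> Prop) (K : Z) (G : mat2 -> Prop) (nu : mat2 -> C) (f : C ->
  C) : Prop :=
  Mweak K G nu f /\ forall s, SL2Z s -> regular_at_cusp P K f s.

Lemma trivial_restrict P K G G' nu nu' : subset G G' -> (forall g, G g -> nu' g = nu g) ->
  trivial_space (forms_without P K G nu) -> trivial_space (forms_without P K G' nu').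
Proof.
  intros Hs He H f [[Hm [Hh Hc]] Hc']. apply H. split; [|exact Hc'].
  split; [apply (modular_restrict K G G' nu nu'); assumption | split; assumption].
Qed.

Lemma trivial_vanishing P K G nu : trivial_space (forms_without P K G nu) ->
  forall f, modular K G nu f -> holomorphic_upper f -> (forall s, SL2Z s ->
    regular_at_cusp P K f s) ->
  forall z, upper z -> f z = 0%C.
Proof.
  intros HM f H1 H2 H3. apply HM. split; [|exact H3]. split; [exact H1|]. split; [exact H2|].
  intros s Hs. destruct (H3 s Hs) as [c [Hc _]]. exists c. exact Hc.
Qed.

Lemma conj_mult_involutive nu g : conj_mult (conj_mult nu) g = nu g.
Proof. unfold conj_mult, Cconj. destruct (nu g). simpl. f_equal. ring. Qed.

(** The sets of orders in the defining disjoint union are empty. *)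
Lemma index_I_trivial K G nu m : trivial_space (Mform K G nu) ->
  trivial_space (Sform (4 - K) G (conj_mult nu)) ->
  (index_I K G nu m <-> - m < 0 /\ exponents K G nu (- m)).
Proof.
  intros HM HS. assert (NM := orders_trivial _ (- m) HM). assert (NS := orders_trivial _ m HS).
  unfold index_I. split.
  - intros [[[H1 H2]|H] _]; [split; [lra | exact H2] | contradiction].
  - intros [H1 H2]. split; [left; split; [lra | exact H2] | exact NS].
Qed.

Lemma index_J_trivial K G nu n : trivial_space (Mform K G nu) ->
  trivial_space (Sform (4 - K) G (conj_mult nu)) ->
  (index_J (4 - K) G (conj_mult nu) n <-> - n <= 0 /\ exponents (4 - K) G (conj_mult nu) (- n)).
Proof.
  intros HM HS. assert (NS := orders_trivial _ (- n) HS).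
  assert (NM : ~ orders (Mform (4 - (4 - K)) G (conj_mult (conj_mult nu))) n).
  { replace (4 - (4 - K))%Z with K by lia. apply orders_trivial.
    apply (trivial_restrict negative K G G nu); [intros g Hg; exact Hg | | exact HM].
    intros g _. apply conj_mult_involutive. }
  unfold index_J. split.
  - intros [[[H1 H2]|H] _]; [split; [lra | exact H2] | contradiction].
  - intros [H1 H2]. split; [left; split; [lra | exact H2] | exact NM].
Qed.

Lemma reduced_family_of_basis P K G nu V I F : subgroup_SL2R G -> canonical_basis K G nu V I F ->
  (forall m, I m <-> P (- m) /\ exponents K G nu (- m)) ->
  (forall f, V f -> modular K G nu f /\ holomorphic_upper f /\
     forall s, SL2Z s -> ~ infinite_cusp G s -> regular_at_cusp P K f s) ->
  reduced_family P K G nu F.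
Proof.
  intros HG [Hoff Hon] HI HV. split.
  - intros m Hm. apply Hoff. rewrite HI. exact Hm.
  - intros m. destruct (classic (I m)) as [Hm|Hm]; [apply HV, Hon, Hm|].
    intros g z Hg Hz. rewrite (Hoff m Hm z Hz), (Hoff m Hm (mobius g z)); [ring|].
    apply mobius_upper; [apply HG, Hg | exact Hz].
  - intros m. destruct (classic (I m)) as [Hm|Hm]; [apply HV, Hon, Hm|].
    intros z Hz. apply (cderivable_ext_loc (fun _ => RtoC 0)); [|apply cderivable_const].
    exists (Im z). split; [exact Hz|]. intros v Hv. symmetry. apply (Hoff m Hm).
    apply Im_near in Hv. unfold upper. lra.
  - intros m s Hs Hi.
    destruct (classic (I m)) as [Hm|Hm]; [apply HV; [apply Hon, Hm | exact Hs | exact Hi]|].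
    apply (regular_zero P (slash K (F m) s)). intros z Hz. unfold slash.
    rewrite (Hoff m Hm); [ring|].
    apply mobius_upper; [apply Hs | exact Hz].
  - intros m HPm Hm. destruct (Hon m) as [_ (c & Hc & H1 & Hn)]; [apply HI; auto|].
    exists c. split; [exact Hc|]. split; [exact H1|]. intros r Hr Hne. apply NNPP. intros Hcr.
    destruct (Hn r Hne Hcr) as [He HnI]. apply HnI, HI. rewrite Ropp_involutive. auto.
Qed.

Lemma reduced_family_f K G nu f : subgroup_SL2R G ->
  trivial_space (Mform K G nu) -> trivial_space (Sform (4 - K) G (conj_mult nu)) ->
  canonical_f K G nu f -> reduced_family negative K G nu f.
Proof.
  intros HG HM HS Hf. apply (reduced_family_of_basis _ _ _ _ _ _ _ HG Hf).
  - intros m. apply index_I_trivial; assumption.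
  - intros h [[H1 [H2 _]] H3]. auto.
Qed.

Lemma reduced_family_g K G nu g : subgroup_SL2R G ->
  trivial_space (Mform K G nu) -> trivial_space (Sform (4 - K) G (conj_mult nu)) ->
  canonical_g (4 - K) G (conj_mult nu) g -> reduced_family nonpositive (4 - K) G (conj_mult nu) g.
Proof.
  intros HG HM HS Hg. apply (reduced_family_of_basis _ _ _ _ _ _ _ HG Hg).
  - intros n. apply index_J_trivial; assumption.
  - intros h [[[H1 [H2 _]] _] H3]. auto.
Qed.

Lemma list_bound A (l : list A) (Q : A -> R -> Prop) :
  (forall x Y Y', In x l -> Y <= Y' -> Q x Y -> Q x Y') ->
  (forall x, In x l -> exists Y, Q x Y) -> exists Y, forall x, In x l -> Q x Y.
Proof.
  induction l as [|x l IH]; intros Hmono H.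
  - exists 0. intros x [].
  - destruct IH as [Y HY].
    { intros y Y Y' Hy. apply Hmono. right. exact Hy. }
    { intros y Hy. apply H. right. exact Hy. }
    destruct (H x (or_introl eq_refl)) as [Y1 HY1]. exists (Rmax Y1 Y).
    intros y [<-|Hy].
    + apply (Hmono x Y1); [left; reflexivity | apply Rmax_l | exact HY1].
    + apply (Hmono y Y); [right; exact Hy | apply Rmax_r | apply HY, Hy].
Qed.

Definition expands_along (f : R -> C -> C) (L : C -> C -> C) : Prop :=
  forall z, upper z -> exists Y : R, forall t, upper t -> Y < Im t ->
    is_qsum (fun m => f m z) t (L z t).

(** A trace is a finite sum, so it may be taken coefficientwise. *)
Lemma trace_expansion K nu' reps f f' L L' (a : C) : (forall g, In g reps -> mdet g = 1) ->
  expands_along f L -> expands_along f' L' ->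
  (forall m z, upper z -> sum_over reps (trace_term K nu' (f m) z) = (a * f' m z)%C) ->
  forall z, upper z -> exists Y : R, forall t, upper t -> Y < Im t ->
    sum_over reps (trace_term K nu' (fun z => L z t) z) = (a * L' z t)%C.
Proof.
  intros Hdet HL HL' HT z Hz.
  destruct (list_bound _ reps (fun g Y => forall t, upper t -> Y < Im t ->
     is_qsum (fun m => f m (mobius g z)) t (L (mobius g z) t))) as [Y HY].
  { intros g Y Y' _ HYY H t Ht Hl. apply H; [exact Ht | lra]. }
  { intros g Hg. apply HL, mobius_upper; [apply Hdet, Hg | exact Hz]. }
  destruct (HL' z Hz) as [Y' HY'].
  exists (Rmax Y Y'). intros t Ht Hl.
  assert (M1 := Rmax_l Y Y'). assert (M2 := Rmax_r Y Y').
  apply (qsum_unique (fun m => sum_over reps (trace_term K nu' (f m) z)) t).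
  - apply (qsum_sum _ reps (fun g m => trace_term K nu' (f m) z g)). intros g Hg.
    apply (qsum_scal (/ factor K nu' g z) (fun m => f m (mobius g z))).
    apply HY; [exact Hg | exact Ht | lra].
  - apply (qsum_ext (fun m => a * f' m z)%C).
    + intros m. symmetry. apply HT, Hz.
    + apply qsum_scal, HY'; [exact Ht | lra].
Qed.

Lemma near2_upper2 p : upper2 p -> near2 p upper2.
Proof.
  intros [H1 H2]. apply near2_bidisc. exists (Rmin (Im (fst p)) (Im (snd p))).
  split; [apply Rmin_pos; assumption|].
  intros q [Hq1 Hq2]. apply Im_near in Hq1. apply Im_near in Hq2.
  assert (M1 := Rmin_l (Im (fst p)) (Im (snd p))). assert (M2 := Rmin_r (Im (fst p)) (Im (snd p))).
  split; unfold upper; lra.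
Qed.

Lemma meromorphic2_ext F F' : (forall p, upper2 p -> F p = F' p) -> meromorphic2 F ->
  meromorphic2 F'.
Proof.
  intros E H p Hp. destruct (H p Hp) as (A & B & HA & HB & NB & EB). exists A, B.
  split; [exact HA|]. split; [exact HB|]. split; [exact NB|].
  generalize (near2_and _ _ _ EB (near2_upper2 p Hp)). apply near2_imp. intros q [H1 H2] Hn.
  rewrite <- E by exact H2. auto.
Qed.

Lemma meromorphic2_scal a F : meromorphic2 F -> meromorphic2 (fun p => a * F p)%C.
Proof.
  intros H p Hp. destruct (H p Hp) as (A & B & HA & HB & NB & EB). exists (fun q => a * A q)%C, B.
  split; [apply hol2_mult; [apply hol2_const | exact HA]|]. split; [exact HB|]. split; [exact NB|].
  revert EB. apply near2_imp. intros q E Hn. rewrite (E Hn). field. exact Hn.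
Qed.

Lemma trace_meromorphic K G' nu' reps H : subgroup_SL2R G' -> automorphy_factor K G' nu' ->
  (forall g, G' g -> nu' g <> 0%C) -> (forall g, In g reps -> G' g) -> meromorphic2 H ->
  meromorphic2 (fun p => trace K nu' reps (fun z => H (z, snd p)) (fst p)).
Proof.
  intros HG' HF Hnz Hin HH.
  apply (meromorphic2_ext (fun p => sum_over reps (fun g => / factor K nu' g (fst p) * H (mobius g
    (fst p), snd p)))%C).
  - intros p [Hp _]. symmetry.
    apply (trace_sum_over K nu' reps (fun z => H (z, snd p)) (fst p)); [|exact Hp].
    intros g Hg. split; [apply Hnz, Hin, Hg | apply HG', Hin, Hg].
  - apply (sum_over_closed _ _ meromorphic2 reps
      (fun p g => / factor K nu' g (fst p) * H (mobius g (fst p), snd p))%C);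
      [apply meromorphic2_const | apply meromorphic2_plus|].
    intros g Hg. assert (Hg' := Hin g Hg). assert (Hdg : mdet g = 1) by (apply HG', Hg').
    assert (Hdi := mdet_minv g Hdg).
    apply (meromorphic2_comp_fst H (mobius g) (mobius (minv g)) (factor K nu' g) HH).
    + intros z Hz. assert (Hgz := mobius_upper g z Hdg Hz). split; [exact Hgz|].
      split; [apply cderivable_mobius; assumption|]. split; [apply cderivable_mobius; assumption|].
      apply mobius_minv_l; assumption.
    + intros z Hz. apply mobius_minv_r; assumption.
    + intros z Hz.
      split; [apply (factor_holomorphic HF); assumption | apply (factor_neq_0 HF); assumption].
Qed.

Theorem theorem7p4
  (G Ghat G' : mat2 -> Prop) (K : Z) (nu nu' : mat2 -> C)
  (w w' : R) (H H' : C * C -> C)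
  (hG : commensurable G)
  (hGhat : maximal_commensurable Ghat) (hGGhat : subset G Ghat)
  (hnu : consistent_multiplier K G nu) (hnufin : finite_multiplier G nu)
  (hM : trivial_space (Mform K G nu))
  (hS : trivial_space (Sform (4 - K) G (conj_mult nu)))
  (hG' : subgroup_SL2R G') (hGG' : subset G G') (hG'Ghat : subset G' Ghat)
  (hnu' : consistent_multiplier K G' nu') (hnu'fin : finite_multiplier G' nu')
  (hext : forall g, G g -> nu' g = nu g)
  (hw : is_width G w) (hw' : is_width G' w')
  (hH : generating_function K G nu H)
  (hH' : generating_function K G' nu' H') :
  forall reps : list mat2, coset_reps G G' reps ->
    mero_eq
      (fun p => trace K nu' reps (fun z => H (z, snd p)) (fst p))
      (fun p => trace (4 - K) (conj_mult nu') reps (fun t => H (fst p, t)) (snd p))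
    /\
    mero_eq
      (fun p => trace (4 - K) (conj_mult nu') reps (fun t => H (fst p, t)) (snd p))
      (fun p => (RtoC (w / w') * H' p)%C).
Proof.
  intros reps HR.
  assert (HGs : subgroup_SL2R G) by apply hG.
  assert (Hhat : commensurable Ghat) by apply hGhat.
  assert (HF := consistent_factor K G' nu' hG' hnu').
  assert (HFd := dual_factor K G' nu' hG' hnu').
  assert (Hnz : forall g, G' g -> nu' g <> 0%C) by apply hnu'.
  assert (Hnzd : forall g, G' g -> conj_mult nu' g <> 0%C).
  { intros g Hg E. apply (Hnz g Hg). rewrite <- conj_mult_involutive. unfold conj_mult at 1.
    rewrite E.
    unfold Cconj, RtoC; simpl. f_equal. ring. }
  assert (hextd : forall g, G g -> conj_mult nu' g = conj_mult nu g).
  { intros g Hg. unfold conj_mult. rewrite hext by exact Hg. reflexivity. }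
  assert (hM' := trivial_restrict negative K G G' nu nu' hGG' hext hM).
  assert (hS' := trivial_restrict nonpositive (4 - K) G G' _ _ hGG' hextd hS).
  assert (Hin : forall g, In g reps -> G' g) by apply HR.
  assert (Hdet : forall g, In g reps -> mdet g = 1) by (intros g Hg; apply hG', Hin, Hg).
  destruct hH as (mH & (f & Hf & Ef) & (g & Hg & Eg)).
  destruct hH' as (mH' & (f' & Hf' & Ef') & (g' & Hg' & Eg')).
  set (F1 := fun p => trace K nu' reps (fun z => H (z, snd p)) (fst p)).
  set (F2 := fun p => trace (4 - K) (conj_mult nu') reps (fun t => H (fst p, t)) (snd p)).
  set (F3 := fun p => (RtoC (w / w') * H' p)%C).
  assert (m1 : meromorphic2 F1) by (apply (trace_meromorphic K G'); assumption).
  assert (m2 : meromorphic2 F2).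
  { exact (meromorphic2_swap _ (trace_meromorphic (4 - K) G' (conj_mult nu') reps _ hG' HFd Hnzd
      Hin (meromorphic2_swap H mH))). }
  assert (m3 : meromorphic2 F3) by (apply meromorphic2_scal; exact mH').
  assert (Tf := trace_of_basis negative K G Ghat G' nu nu' w w' f f' excluded_negative Hhat HGs hG'
    hGG' hG'Ghat HF Hnz hext
     hw hw' (trivial_vanishing negative K G nu hM) (reduced_family_f K G nu f HGs hM hS Hf)
       (reduced_family_f K G' nu' f' hG' hM' hS' Hf')).
  assert (Tg := trace_of_basis nonpositive (4 - K) G Ghat G' (conj_mult nu)
    (conj_mult nu') w w' g g' excluded_nonpositive Hhat HGs hG' hGG' hG'Ghat HFd Hnzd hextd
     hw hw' (trivial_vanishing nonpositive (4 - K) G _ hS)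
       (reduced_family_g K G nu g HGs hM hS Hg) (reduced_family_g K G' nu' g' hG' hM' hS' Hg')).
  assert (A13 : forall p, upper2 p -> agree F1 F3 p).
  { apply agree_of_region; [exact m1 | exact m3|]. intros z Hz.
    destruct (trace_expansion K nu' reps f f' (fun z t => H (z, t)) (fun z t => H' (z, t))
      (RtoC (w / w')) Hdet Ef Ef'
      (fun m z Hz => Tf m reps z HR Hz) z Hz) as [Y HY].
    exists Y. intros t Ht Hl. unfold F1, F3. cbn [fst snd]. rewrite <- HY by assumption.
    apply trace_sum_over; [|exact Hz]. intros x Hx. auto. }
  assert (A23 : forall p, upper2 p -> agree F2 F3 p).
  { apply agree_of_region_swap; [exact m2 | exact m3|]. intros t Ht.
    destruct (trace_expansion (4 - K) (conj_mult nu') reps g g' (fun t z => - H (z,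
      t))%C (fun t z => - H' (z, t))%C (RtoC (w / w')) Hdet Eg Eg'
      (fun m z Hz => Tg m reps z HR Hz) t Ht) as [Y HY].
    exists Y. intros z Hz Hl. specialize (HY z Hz Hl). unfold F2, F3. cbn [fst snd].
    rewrite trace_sum_over; [|intros x Hx; auto|exact Ht].
    replace (RtoC (w / w') * H' (z, t))%C with (- (1) * (RtoC (w / w') * - H' (z, t)))%C by ring.
    rewrite <- HY, <- sum_over_scal. apply sum_over_ext. intros x _. unfold trace_term. cbv beta.
    ring. }
  split; apply mero_eq_of_agree; try assumption.
  intros p Hp. apply (agree_trans F1 F3 F2); [apply A13, Hp | apply agree_sym, A23, Hp].
Qed.
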